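(* Let $a,b,c$ be pairwise coprime positive integers. Assume: (i) $K$ is a field of characteristic $0$; (ii) $\mathfrak p=\mathfrak p_K(a,b,c)$ is minimally generated by the three elements $x^s-y^{t_1}z^{u_1}$, $y^t-x^{s_2}z^{u_2}$, $z^u-x^{s_3}y^{t_3}$ (notation in the context); (iii) $uc<\sqrt{abc}$. Then the symbolic Rees ring $\mathcal R_s(\mathfrak p)=\bigoplus_{n\ge 0}\mathfrak p^{(n)}T^n\subset S[T]$ is a Noetherian ring if and only if there exists a homogeneous element $\eta\in[\mathfrak p^{(u)}]_{ab}$ (i.e. $\eta\in\mathfrak p^{(u)}$ of degree $ab$) such that $$\ell_S\bigl(S/(x,\ z^u-x^{s_3}y^{t_3},\ \eta)\bigr)=u\cdot \ell_S\bigl(S/((x)+\mathfrak p)\bigr).$$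
   Context: $S=K[x,y,z]$ is the polynomial ring graded by $\deg x=a$, $\deg y=b$, $\deg z=c$, and $[M]_d$ denotes the degree-$d$ component of a graded module $M$. $\mathfrak p_K(a,b,c)$ is the kernel of the $K$-algebra map $S\to K[t]$, $x\mapsto t^a$, $y\mapsto t^b$, $z\mapsto t^c$. $\mathfrak p^{(n)}=\mathfrak p^nS_{\mathfrak p}\cap S$ is the $n$-th symbolic power, and $T$ is an indeterminate. $\ell_S$ denotes length. Let $s$ (resp. $t$, $u$) be the least positive integer such that $sa\in\mathbb N_0b+\mathbb N_0c$ (resp. $tb\in\mathbb N_0a+\mathbb N_0c$, $uc\in\mathbb N_0a+\mathbb N_0b$), where $\mathbb N_0$ is the set of non-negative integers. Let $t_1,u_1,s_2,u_2,s_3,t_3$ be non-negative integers with $sa=t_1b+u_1c$, $tb=s_2a+u_2c$, $uc=s_3a+t_3b$. When $\mathfrak p$ is minimally generated by three elements, these six integers are positive, $s=s_2+s_3$, $t=t_1+t_3$, $u=u_1+u_2$, and $\mathfrak p$ is minimally generated by the three binomials in (ii). *)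

(* Defs.v *)
From HB Require Import structures.
From mathcomp Require Import all_boot all_order all_algebra.
From mathcomp Require Import boolp mpoly realalg.

Set Implicit Arguments.
Unset Strict Implicit.
Unset Printing Implicit Defensive.

Import GRing.Theory.

Local Open Scope ring_scope.
Local Open Scope quotient_scope.

Section Ideals.

Variable R : comNzRingType.
Implicit Types (A I J : {pred R}).

Definition ideal_gen A : {pred R} := fun f =>
  `[< exists2 s : seq (R * R),
        {in s, forall u, u.2 \in A} & f = \sum_(u <- s) u.1 * u.2 >].

Lemma ideal_genP A f :
  reflect (exists2 s : seq (R * R),
             {in s, forall u, u.2 \in A} & f = \sum_(u <- s) u.1 * u.2)
          (f \in ideal_gen A).
Proof. exact: asboolP. Qed.

Lemma mem_ideal_gen A f : f \in A -> f \in ideal_gen A.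
Proof.
move=> fA; apply/ideal_genP; exists [:: (1, f)].
  by move=> u; rewrite inE => /eqP ->.
by rewrite big_seq1 mul1r.
Qed.

Lemma ideal_gen0 A : 0 \in ideal_gen A.
Proof. by apply/ideal_genP; exists [::] => //; rewrite big_nil. Qed.

Lemma ideal_genD A f g :
  f \in ideal_gen A -> g \in ideal_gen A -> f + g \in ideal_gen A.
Proof.
move=> /ideal_genP[s sA ->] /ideal_genP[s' s'A ->]; apply/ideal_genP.
exists (s ++ s'); last by rewrite big_cat.
by move=> u; rewrite mem_cat => /orP[/sA|/s'A].
Qed.

Lemma ideal_genM A a f : f \in ideal_gen A -> a * f \in ideal_gen A.
Proof.
move=> /ideal_genP[s sA ->]; apply/ideal_genP.
exists [seq (a * u.1, u.2) | u <- s].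
  by move=> _ /mapP[u /sA uA ->].
by rewrite big_map big_distrr /=; apply: eq_bigr => u _; rewrite mulrA.
Qed.

Lemma ideal_gen_zmod_closed A : zmod_closed (ideal_gen A).
Proof.
split=> [|f g fA gA]; first exact: ideal_gen0.
by rewrite -mulN1r ideal_genD // ideal_genM.
Qed.

HB.instance Definition _ A :=
  GRing.isZmodClosed.Build R (ideal_gen A) (ideal_gen_zmod_closed A).

Definition ideal_pow I n : {pred R} := ideal_gen (fun f =>
  `[< exists2 s : seq R, size s = n /\ {in s, forall g, g \in I}
                         & f = \prod_(g <- s) g >]).

Lemma ideal_powM I m n f g :
  f \in ideal_pow I m -> g \in ideal_pow I n -> f * g \in ideal_pow I (m + n).
Proof.
move=> /ideal_genP[s sI ->] gI; rewrite big_distrl big_seq /=.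
apply: (big_ind (fun h => h \in ideal_pow I (m + n))).
- exact: ideal_gen0.
- by move=> ? ?; apply: ideal_genD.
move=> u /sI /asboolP[p [<- pI] ->]; rewrite -mulrA; apply: ideal_genM.
case/ideal_genP: gI => s' s'I ->; rewrite big_distrr big_seq /=.
apply: (big_ind (fun h => h \in ideal_pow I _)).
- exact: ideal_gen0.
- by move=> ? ?; apply: ideal_genD.
move=> v /s'I /asboolP[q [<- qI] ->]; rewrite mulrCA; apply: ideal_genM.
apply: mem_ideal_gen; apply/asboolP; exists (p ++ q); last by rewrite big_cat.
split=> [|h]; first by rewrite size_cat.
by rewrite mem_cat => /orP[/pI|/qI].
Qed.

Definition minimally_generated_by I (gens : seq R) : Prop :=
  ideal_gen (mem gens) =i I /\
  forall s, subseq s gens -> s != gens -> ~ (ideal_gen (mem s) =i I).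

(* An ideal of R is a submodule of the regular module R^o. *)
Definition noetherian : Prop :=
  forall J : {pred R^o}, submod_closed J ->
    exists s : seq R, ideal_gen (mem s) =i J.

End Ideals.

(* The library's {ideal_quot I} is a ring quotient, and needs a proper ideal;
   here R / ideal_gen A is only made an R-module, for any set A. *)
Section QuotientModule.

Variables (R : comNzRingType) (A : {pred R}).

Definition ideal_quotient := {ideal_quot (ideal_gen A)}.

HB.instance Definition _ := GRing.Zmodule.on ideal_quotient.
HB.instance Definition _ := Quotient.on ideal_quotient.

Implicit Type x : ideal_quotient.

Definition quotient_scale (a : R) x : ideal_quotient :=
  \pi_ideal_quotient (a * repr x).

Lemma quotient_scale_pi a f :
  quotient_scale a (\pi f) = \pi_ideal_quotient (a * f).
Proof.
apply/eqP; rewrite -Quotient.idealrBE -mulrBr; apply: ideal_genM.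
by rewrite Quotient.idealrBE reprK.
Qed.

Lemma quotient_scaleA a b x :
  quotient_scale a (quotient_scale b x) = quotient_scale (a * b) x.
Proof. by rewrite quotient_scale_pi mulrA. Qed.

Lemma quotient_scale1 : left_id 1 quotient_scale.
Proof. by move=> x; rewrite /quotient_scale mul1r reprK. Qed.

Let piD (f g : R) :
  \pi_ideal_quotient (f + g) = \pi_ideal_quotient f + \pi_ideal_quotient g.
Proof. exact: (raddfD (\pi_({ideal_quot (ideal_gen A)}))). Qed.

Lemma quotient_scaleDr : right_distributive quotient_scale +%R.
Proof.
move=> a x y; rewrite -[x]reprK -[y]reprK.
by rewrite -piD !quotient_scale_pi mulrDr piD.
Qed.

Lemma quotient_scaleDl x : {morph quotient_scale^~ x : a b / a + b}.
Proof. by move=> a b; rewrite /quotient_scale mulrDl piD. Qed.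

HB.instance Definition _ := GRing.Zmodule_isLmodule.Build R ideal_quotient
  quotient_scaleA quotient_scale1 quotient_scaleDr quotient_scaleDl.

End QuotientModule.

Section Length.

Variables (R : nzRingType) (V : lmodType R).

Definition has_submodule_chain (n : nat) : Prop :=
  exists2 N : nat -> {pred V}, forall i, submod_closed (N i)
    & forall i, (i < n)%N ->
        {subset N i <= N i.+1} /\ exists2 v, v \in N i.+1 & v \notin N i.

(* The length is a natural number or infinity; None stands for infinity. *)
Definition module_length : option nat :=
  match pselect (exists n, has_submodule_chain n /\
                   forall m, has_submodule_chain m -> (m <= n)%N) with
  | left exn => Some (projT1 (cid exn))
  | right _ => None
  end.

End Length.

Section SymbolicPowers.

Variables (R : idomainType) (P : prime_idealr R).

Local Notation "f %:F" := (@FracField.tofrac R f).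

(* R being a domain, R_P is taken inside the fraction field of R. *)
Definition localization : {pred {fraction R}} := fun h =>
  `[< exists f g : R, g \notin P /\ h = f%:F / g%:F >].

Definition localized_ideal (I : {pred R}) : {pred {fraction R}} := fun h =>
  `[< exists2 s : seq ({fraction R} * R),
        {in s, forall u, u.1 \in localization /\ u.2 \in I}
        & h = \sum_(u <- s) u.1 * u.2%:F >].

Definition symbolic_power (n : nat) : {pred R} := fun f =>
  f%:F \in localized_ideal (ideal_pow P n).

Definition symbolic_rees : {pred {poly R}} := fun F =>
  `[< forall n, F`_n \in symbolic_power n >].

Lemma localizationM h k :
  h \in localization -> k \in localization -> h * k \in localization.
Proof.
move=> /asboolP[f [g [gP ->]]] /asboolP[f' [g' [g'P ->]]].
apply/asboolP; exists (f * f'), (g * g'); split.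
  by rewrite prime_idealrM negb_or gP.
by rewrite !tofracM invfM mulrACA.
Qed.

Lemma tofrac_localization f : f%:F \in localization.
Proof.
apply/asboolP; exists f, 1; rewrite tofrac1 divr1; split=> //.
by rewrite idealr1.
Qed.

Lemma localized_ideal0 I : 0 \in localized_ideal I.
Proof. by apply/asboolP; exists [::] => //; rewrite big_nil. Qed.

Lemma localized_idealD I h k :
  h \in localized_ideal I -> k \in localized_ideal I ->
  h + k \in localized_ideal I.
Proof.
move=> /asboolP[s sI ->] /asboolP[s' s'I ->]; apply/asboolP.
exists (s ++ s'); last by rewrite big_cat.
by move=> u; rewrite mem_cat => /orP[/sI|/s'I].
Qed.

Lemma localized_idealM I h k :
  h \in localization -> k \in localized_ideal I -> h * k \in localized_ideal I.
Proof.
move=> hP /asboolP[s sI ->]; apply/asboolP.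
exists [seq (h * u.1, u.2) | u <- s].
  by move=> _ /mapP[u /sI[uP uI] ->]; split=> //; apply: localizationM.
by rewrite big_map big_distrr /=; apply: eq_bigr => u _; rewrite mulrA.
Qed.

Lemma localized_ideal_gen I f : f \in I -> f%:F \in localized_ideal I.
Proof.
move=> fI; apply/asboolP; exists [:: (1, f)]; last by rewrite big_seq1 mul1r.
by move=> u; rewrite inE => /eqP ->; rewrite -tofrac1 tofrac_localization.
Qed.

Lemma symbolic_power0 n : 0 \in symbolic_power n.
Proof. by rewrite unfold_in tofrac0 localized_ideal0. Qed.

Lemma symbolic_powerD n f g :
  f \in symbolic_power n -> g \in symbolic_power n -> f + g \in symbolic_power n.
Proof. by rewrite !unfold_in tofracD; apply: localized_idealD. Qed.

Lemma symbolic_powerN n f : f \in symbolic_power n -> - f \in symbolic_power n.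
Proof.
rewrite !unfold_in -mulN1r tofracM.
by apply: localized_idealM; apply: tofrac_localization.
Qed.

Lemma symbolic_powerM m n f g :
  f \in symbolic_power m -> g \in symbolic_power n ->
  f * g \in symbolic_power (m + n).
Proof.
rewrite !unfold_in tofracM => /asboolP[s sI ->] gI.
rewrite big_distrl big_seq /=.
apply: (big_ind (fun h => h \in localized_ideal _)).
- exact: localized_ideal0.
- by move=> ? ?; apply: localized_idealD.
move=> u /sI[uP uI]; rewrite -mulrA; apply: localized_idealM => //.
case/asboolP: gI => s' s'I ->; rewrite big_distrr big_seq /=.
apply: (big_ind (fun h => h \in localized_ideal _)).
- exact: localized_ideal0.
- by move=> ? ?; apply: localized_idealD.
move=> v /s'I[vP vI]; rewrite mulrCA; apply: localized_idealM => //.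
by rewrite -tofracM; apply: localized_ideal_gen; apply: ideal_powM.
Qed.

Lemma symbolic_rees_subring_closed : subring_closed symbolic_rees.
Proof.
split=> [|F G FP GP|F G FP GP]; apply/asboolP=> n.
- rewrite coef1; case: n => [|n] /=; last exact: symbolic_power0.
  rewrite unfold_in; apply: localized_ideal_gen; apply: mem_ideal_gen.
  by apply/asboolP; exists [::] => //; rewrite big_nil.
- rewrite coefB; apply: symbolic_powerD; first by move/asboolP: FP; apply.
  by apply: symbolic_powerN; move/asboolP: GP; apply.
rewrite coefM; apply: (big_ind (fun h => h \in symbolic_power n)); first exact: symbolic_power0.
  by move=> ? ?; apply: symbolic_powerD.
move=> i _; have le_in : (i <= n)%N by rewrite -ltnS.
move/asboolP/(_ i): FP => Fi; move/asboolP/(_ (n - i)%N): GP => Gi.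
by have := symbolic_powerM Fi Gi; rewrite subnKC.
Qed.

HB.instance Definition _ :=
  GRing.isSubringClosed.Build {poly R} symbolic_rees
    symbolic_rees_subring_closed.

Record symbolic_rees_ring := SymbolicRees {
  symbolic_rees_val :> {poly R};
  symbolic_rees_valP : symbolic_rees_val \in symbolic_rees }.

HB.instance Definition _ := [isSub for symbolic_rees_val].
HB.instance Definition _ := [Choice of symbolic_rees_ring by <:].
HB.instance Definition _ :=
  [SubChoice_isSubComNzRing of symbolic_rees_ring by <:].

End SymbolicPowers.

Section MonomialCurve.

Variables (K : fieldType) (a b c : nat).

Definition curve_weight : 3.-tuple nat := [tuple a; b; c].

Definition weighted_degree (m : 'X_{1..3}) : nat :=
  (\sum_(i < 3) m i * tnth curve_weight i)%N.

Lemma weighted_degree0 : weighted_degree 0%MM = 0%N.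
Proof. by apply: big1 => i _; rewrite mnm0E. Qed.

Lemma weighted_degreeD :
  {morph weighted_degree : m n / (m + n)%MM >-> (m + n)%N}.
Proof.
by move=> m n; rewrite -big_split; apply: eq_bigr => i _; rewrite mnmDE mulnDl.
Qed.

HB.instance Definition _ :=
  isMeasure.Build 3 weighted_degree weighted_degree0 weighted_degreeD.

Definition curve_morphism : {mpoly K[3]} -> {poly K} :=
  mmap (@polyC K) (fun i => 'X^(tnth curve_weight i)).

HB.instance Definition _ := GRing.RMorphism.copy curve_morphism
  (mmap (@polyC K) (fun i => 'X^(tnth curve_weight i))).

Definition monomial_prime : {pred {mpoly K[3]}} :=
  fun f => curve_morphism f == 0.

Lemma monomial_prime_idealr_closed : idealr_closed monomial_prime.
Proof.
split=> [||h f g]; rewrite !unfold_in ?rmorph0 ?rmorph1 ?oner_eq0 //.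
by move=> /eqP f0 /eqP g0; rewrite rmorphD rmorphM /= f0 g0 mulr0 addr0.
Qed.

Lemma monomial_prime_prime : prime_idealr_closed monomial_prime.
Proof. by move=> f g; rewrite !unfold_in rmorphM /= mulf_eq0. Qed.

HB.instance Definition _ :=
  isIdealr.Build {mpoly K[3]} monomial_prime monomial_prime_idealr_closed.
HB.instance Definition _ :=
  isPrimeIdealrClosed.Build {mpoly K[3]} monomial_prime monomial_prime_prime.

End MonomialCurve.

Arguments monomial_prime : clear implicits.

Definition varx {K : fieldType} : {mpoly K[3]} := 'X_(0 : 'I_3).
Definition vary {K : fieldType} : {mpoly K[3]} := 'X_(1 : 'I_3).
Definition varz {K : fieldType} : {mpoly K[3]} := 'X_(2 : 'I_3).

Definition in_semigroup (d e n : nat) : Prop :=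
  exists i j : nat, n = (i * d + j * e)%N.

Definition least_positive (P : nat -> Prop) (n : nat) : Prop :=
  [/\ (0 < n)%N, P n & forall k, (0 < k)%N -> P k -> (n <= k)%N].

Lemma curve_morphism_var (K : fieldType) (a b c : nat) :
  [/\ curve_morphism a b c (varx : {mpoly K[3]}) = 'X^a,
      curve_morphism a b c (vary : {mpoly K[3]}) = 'X^b
    & curve_morphism a b c (varz : {mpoly K[3]}) = 'X^c].
Proof. by split; rewrite /curve_morphism mmapX mmap1U. Qed.

(* Main.v *)
(* Let [f = z^u - x^s3 y^t3]. Sending [x, y, z] to [tau^a, tau^b, tau^c] times suitable
   monomials in [1 + V, 1 + W] straightens the curve to [V = W = 0], so that
   [p^(n)] consists of the polynomials of order [>= n] in [(V, W)], while [f]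
   becomes [W] up to a unit. Modulo [f], a homogeneous element of degree [d] is a
   polynomial [pi0 h] in one variable [X = 1 + V]; if it lies in [p^(n)] and
   [pi0 h] is not zero, then [(X - 1)^n] divides [pi0 h], whose exponents fill an
   interval of length at most [d u / (a b)], so [d u >= n a b].

   For [eta] in [p^(u)] of degree [a b], the two lengths agree iff [y^a] occurs in
   [eta]. In this case [eta] divides, modulo [f], all the homogeneous elements of
   [p^(n)] for [n >= u], and hence [R_s(p)] is generated by [f T], [eta T^u]
   and symbolic powers of bounded exponent.

   Conversely, [u c < sqrt(a b c)] leaves enough monomials to lift polynomials
   [pi0 h] to elements of [p^(n)] of bounded defect [d u - n a b], for all multiples
   [n] of [u].
   Defects are additive, so finite generation of [R_s(p)] forces an element of
   [p^(u m)] of degree [a b m] and defect zero. In characteristic 0, Newton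
   iteration along the powers of [f] extracts its [m]-th root up to [f^u], and this
   root is [eta]. *)

Require Import Defs.
From HB Require Import structures.
From mathcomp Require Import all_boot all_order all_algebra.
From mathcomp Require Import boolp mpoly realalg zify ring.

Set Implicit Arguments.
Unset Strict Implicit.
Unset Printing Implicit Defensive.

Import Order.TTheory GRing.Theory Num.Theory.
Local Open Scope ring_scope.

(** * Noetherian rings *)

(** The sqrt hypothesis is used as [u u c < a b]. One order of vanishing is charged [a b / u] in
    degree, and a factor [f], of degree [u c], costs less; this leaves room to correct the higher
    coefficients in [W] by multiples of powers of [f].

    Characteristic zero enters mainly through [sparse_poly_eq0]: a polynomial with at most [N] terms
    cannot vanish to order [N] at 1 unless it is zero. This kills the remainder of a division by
    [eta], which has at most [u] terms, and makes the interpolation behind the lifting solvable.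

    The obstacle in the sufficiency is that [h = eta g + f k] says nothing about the symbolic orders
    of [g] and [k]. It is overcome by a stabilising chain of colon ideals, once for each residue
    modulo [u]. In the necessity, generators of the ideal of positive degree in [T] replace algebra
    generators: one generator is split off at a time, each of bounded degree in [T]. *)

Definition is_ideal (R : comNzRingType) (J : {pred R}) : Prop :=
  [/\ 0 \in J, {in J &, forall f g, f + g \in J}
    & forall a, {in J, forall f, a * f \in J}].

Lemma is_ideal_gen (R : comNzRingType) (A : {pred R}) : is_ideal (ideal_gen A).
Proof.
split=> [|f g fA gA|a f fA]; first exact: ideal_gen0.
  exact: ideal_genD.
exact: ideal_genM.
Qed.

Lemma is_idealB (R : comNzRingType) (J : {pred R}) f g :
  is_ideal J -> f \in J -> g \in J -> f - g \in J.
Proof. by move=> [_ JD JM] fJ gJ; rewrite JD // -mulN1r JM. Qed.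

Lemma is_ideal_sum (R : comNzRingType) (J : {pred R}) (I : eqType)
    (r : seq I) (F : I -> R) :
  is_ideal J -> {in r, forall i, F i \in J} -> \sum_(i <- r) F i \in J.
Proof.
move=> [J0 JD _] FJ; rewrite big_seq.
by apply: (big_ind (fun h => h \in J)) => // f g; apply: JD.
Qed.

Lemma ideal_gen_subP (R : comNzRingType) (A J : {pred R}) :
  is_ideal J -> {subset A <= J} -> {subset ideal_gen A <= J}.
Proof.
move=> idJ AJ _ /ideal_genP[w wA ->]; apply: is_ideal_sum => // v /wA vA.
by case: idJ => _ _; apply; apply: AJ.
Qed.

Lemma ideal_gen_mono (R : comNzRingType) (A B : {pred R}) :
  {subset A <= B} -> {subset ideal_gen A <= ideal_gen B}.
Proof.
move=> AB; apply: ideal_gen_subP; first exact: is_ideal_gen.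
by move=> f /AB; apply: mem_ideal_gen.
Qed.

Lemma ideal_gen3P (R : comNzRingType) (g1 g2 g3 h : R) :
  h \in ideal_gen (mem [:: g1; g2; g3]) <->
  exists x1 x2 x3, h = x1 * g1 + x2 * g2 + x3 * g3.
Proof.
split=> [/ideal_genP[w wg ->]|[x1 [x2 [x3 ->]]]].
  elim: w wg => [|v w IH] wg.
    by exists 0, 0, 0; rewrite big_nil !mul0r !addr0.
  have [|x1 [x2 [x3 e]]] := IH; first by move=> y yw; apply: wg; rewrite inE yw orbT.
  have := wg v (mem_head _ _); rewrite big_cons e !inE => /or3P[] /eqP ->.
  - by exists (v.1 + x1), x2, x3; ring.
  - by exists x1, (v.1 + x2), x3; ring.
  by exists x1, x2, (v.1 + x3); ring.
by do 2?apply: ideal_genD; apply: ideal_genM; apply: mem_ideal_gen; rewrite !inE eqxx ?orbT.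
Qed.

Lemma mem_ideal_gen3 (R : comNzRingType) (g1 g2 g3 : R) :
  [/\ g1 \in ideal_gen (mem [:: g1; g2; g3]), g2 \in ideal_gen (mem [:: g1; g2; g3])
    & g3 \in ideal_gen (mem [:: g1; g2; g3])].
Proof. by split; apply: mem_ideal_gen; rewrite !inE eqxx ?orbT. Qed.

Lemma ideal_gen3_subP (R : comNzRingType) (J : {pred R}) (g1 g2 g3 : R) :
  is_ideal J -> g1 \in J -> g2 \in J -> g3 \in J ->
  {subset ideal_gen (mem [:: g1; g2; g3]) <= J}.
Proof.
move=> idJ gJ1 gJ2 gJ3; apply: ideal_gen_subP => // g.
by rewrite !inE => /or3P[] /eqP ->.
Qed.

Lemma noetherian_ideal (R : comNzRingType) (J : {pred R}) :
  noetherian R -> is_ideal J -> exists s : seq R, ideal_gen (mem s) =i J.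
Proof.
move=> noeR [J0 JD JM]; apply: noeR; split=> // a f g fJ gJ.
by apply: JD => //; apply: JM.
Qed.

Lemma noetherianI (R : comNzRingType) :
  (forall J : {pred R}, is_ideal J -> exists2 s : seq R,
     {subset s <= J} & {subset J <= ideal_gen (mem s)}) -> noetherian R.
Proof.
move=> fgR J [J0 JL].
have idJ : is_ideal (J : {pred R}).
  split=> // [f g fJ gJ|a f fJ]; last by have := JL a f 0 fJ J0; rewrite addr0.
  by have := JL 1 f g fJ gJ; rewrite scale1r.
have [s sJ Js] := fgR _ idJ; exists s => f.
by apply/idP/idP=> [|/Js //]; apply: ideal_gen_subP.
Qed.

Lemma noetherian_chain (R : comNzRingType) (J : nat -> {pred R}) :
  noetherian R -> (forall n, is_ideal (J n)) ->
  (forall n, {subset J n <= J n.+1}) ->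
  exists N, forall n, (N <= n)%N -> {subset J n <= J N}.
Proof.
move=> noeR idJ incJ.
have mono m n : (m <= n)%N -> {subset J m <= J n}.
  move=> /subnK <-; elim: (n - m)%N => // k IH f /IH; exact: incJ.
pose U : {pred R} := fun f => `[< exists n, f \in J n >].
have idU : is_ideal U.
  split=> [|f g /asboolP[m fm] /asboolP[n gn]|a f /asboolP[n fn]].
  - by apply/asboolP; exists 0%N; case: (idJ 0%N).
  - apply/asboolP; exists (maxn m n); case: (idJ (maxn m n)) => _ D _.
    by apply: D; [apply: mono fm; apply: leq_maxl|apply: mono gn; apply: leq_maxr].
  - by apply/asboolP; exists n; case: (idJ n) => _ _; apply.
have [s sU] := noetherian_ideal noeR idU.
have [N sN] : exists N, {subset s <= J N}.
  have: {subset s <= U} by move=> f fs; rewrite -sU mem_ideal_gen.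
  elim: s {sU} => [|f s IH] sU; first by exists 0%N.
  have [N sN] := IH (fun g gs => sU g (mem_behead (s := f :: s) gs)).
  have /asboolP[n fn] := sU f (mem_head _ _).
  exists (maxn n N) => g; rewrite inE => /predU1P[->|/sN].
    by apply: mono fn; apply: leq_maxl.
  by apply: mono; apply: leq_maxr.
exists N => n _ f fn.
have : f \in ideal_gen (mem s) by rewrite sU; apply/asboolP; exists n.
exact: ideal_gen_subP.
Qed.

Lemma noetherian_field (K : fieldType) : noetherian K.
Proof.
apply: noetherianI => J [J0 JD JM].
have [[a aJ a0]|nJ] := pselect (exists2 a, a \in J & a != 0).
  exists [:: a] => [b|b _]; first by rewrite inE => /eqP ->.
  rewrite -[b](divfK a0); apply: ideal_genM; apply: mem_ideal_gen.
  exact: mem_head.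
exists [::] => // b bJ; have [->|b0] := eqVneq b 0; first exact: ideal_gen0.
by case: nJ; exists b.
Qed.

(** * Hilbert's basis theorem *)

Section HilbertBasis.

Variables (R : comNzRingType) (noeR : noetherian R).
Variables (J : {pred {poly R}}) (idJ : is_ideal J).

(** Generators of an ideal of leading coefficients are lifted to [J] and then shifted by powers of
    [X]. The relation [Q] allows two uses: with [Q] always true, [L] is the ideal of all leading
    coefficients; with [Q] fixing the degree, [N] is at most that degree. *)
Let lift_leading (L : {pred R}) (Q : R -> nat -> {poly R} -> Prop) :
  is_ideal L ->
  (forall a, a \in L <-> exists n, exists2 p, Q a n p &
     [/\ p \in J, (size p <= n.+1)%N & p`_n = a]) ->
  exists s : seq {poly R}, exists N, [/\ {subset s <= J},
    (forall k, (forall a n p, Q a n p -> (n <= k)%N) -> (N <= k)%N)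
    & forall n a, a \in L -> (N <= n)%N ->
      exists2 q, q \in ideal_gen (mem s) & (size q <= n.+1)%N /\ q`_n = a].
Proof.
move=> idL LP; have [s sL] := noetherian_ideal noeR idL.
have /choice[F FP] : forall a, exists np : nat * {poly R}, a \in s ->
    Q a np.1 np.2 /\ [/\ np.2 \in J, (size np.2 <= np.1.+1)%N & np.2`_np.1 = a].
  move=> a; have [as_|] := boolP (a \in s); last by exists (0%N, 0).
  have /LP[n [p Qp pP]] : a \in L by rewrite -sL mem_ideal_gen.
  by exists (n, p).
exists [seq (F a).2 | a <- s], (\max_(a <- s) (F a).1)%N; split.
- by move=> _ /mapP[a /FP[_ [pJ _ _]] ->].
- move=> k kP; apply/bigmax_leqP_seq => a /FP[Qa _] _.
  exact: kP Qa.
move=> n a; rewrite -sL => /ideal_genP[w ws ->] leNn.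
exists (\sum_(v <- w) (v.1 *: 'X^(n - (F v.2).1)) * (F v.2).2).
  apply: (is_ideal_sum (is_ideal_gen _)) => v /ws vs.
  by apply: ideal_genM; apply: mem_ideal_gen; apply: map_f.
have leF v : v \in w -> ((F v.2).1 <= n)%N.
  by move=> /ws vs; apply: leq_trans leNn; apply: leq_bigmax_seq.
split; last first.
  rewrite coef_sum big_seq [RHS]big_seq; apply: eq_bigr => v vw.
  have /FP[_ [_ sF eF]] := ws v vw; have leFn := leF v vw.
  rewrite -scalerAl coefZ coefXnM ltnNge leq_subr /= subKn //.
  by rewrite eF.
rewrite big_seq; apply: (big_ind (fun q : {poly R} => size q <= n.+1)%N).
- by rewrite size_poly0.
- by move=> p q sp sq; apply: leq_trans (size_polyD _ _) _; rewrite geq_max sp.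
move=> v vw; have /FP[_ [_ sF _]] := ws v vw; have leFn := leF v vw.
rewrite -scalerAl; apply: leq_trans (size_scale_leq _ _) _.
apply/leq_sizeP => j ltnj; rewrite coefXnM; case: ltnP => // le_j.
by move/leq_sizeP: sF; apply; rewrite ltn_subRL subnK.
Qed.

Lemma hilbert_basis_ideal : exists2 s : seq {poly R},
  {subset s <= J} & {subset J <= ideal_gen (mem s)}.
Proof.
have [J0 JD JM] := idJ.
pose L : {pred R} := fun a => `[< exists n, exists2 p, p \in J &
  (size p <= n.+1)%N /\ p`_n = a >].
pose Ln n : {pred R} := fun a => `[< exists2 p, p \in J &
  (size p <= n.+1)%N /\ p`_n = a >].
have idLn n : is_ideal (Ln n).
  split=> [|a b /asboolP[p pJ [sp <-]] /asboolP[q qJ [sq <-]]|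
             a b /asboolP[p pJ [sp <-]]]; apply/asboolP.
  - by exists 0 => //; rewrite size_poly0 coef0.
  - exists (p + q); first exact: JD.
    by rewrite coefD (leq_trans (size_polyD _ _)) // geq_max sp.
  - exists (a%:P * p); first exact: JM.
    by rewrite mul_polyC coefZ (leq_trans (size_scale_leq _ _)).
have idL : is_ideal L.
  split=> [|a b /asboolP[m [p pJ [sp <-]]] /asboolP[n [q qJ [sq <-]]]|
             a b /asboolP[n bL]]; apply/asboolP.
  - by exists 0%N, 0 => //; rewrite size_poly0 coef0.
  - exists (m + n)%N, ('X^n * p + 'X^m * q); first by apply: JD; apply: JM.
    split; last first.
      by rewrite coefD !coefXnM ltnNge leq_addl ltnNge leq_addr /= addnK addKn.
    apply/leq_sizeP => j ltj; rewrite coefD !coefXnM.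
    move/leq_sizeP: sp => sp; move/leq_sizeP: sq => sq.
    by rewrite sp ?sq; [rewrite !if_same addr0|lia|lia].
  - have [_ _ LM] := idLn n; have bn : b \in Ln n by apply/asboolP.
    by have /asboolP ? := LM a b bn; exists n.
have [|s [N [sJ _ sL]]] := @lift_leading L (fun _ _ _ => True) idL.
  move=> a; split=> [/asboolP[n [p pJ [sp ep]]]|[n [p _ [pJ sp ep]]]].
    by exists n, p.
  by apply/asboolP; exists n, p.
have /choice[T TP] : forall n, exists t : seq {poly R}, {subset t <= J} /\
    forall a, a \in Ln n -> exists2 q, q \in ideal_gen (mem t)
      & (size q <= n.+1)%N /\ q`_n = a.
  move=> n; have [|t [M [tJ Mn tL]]] := @lift_leading (Ln n) (fun _ k _ => k = n) (idLn n).
    move=> a; split=> [/asboolP[p pJ [sp ep]]|[_ [p -> [pJ sp ep]]]].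
      by exists n, p.
    by apply/asboolP; exists p.
  exists t; split=> // a aL; apply: tL => //; apply: Mn => _ k _ -> //.
(* From degree [N] on, the lifts in [s] reach every leading coefficient; the finitely many lower
   degrees each need a list [T n] of their own. *)
pose G := s ++ flatten [seq T n | n <- iota 0 N].
have idG := is_ideal_gen (mem G).
exists G => [p|].
  rewrite mem_cat => /orP[/sJ //|/flattenP[_ /mapP[n _ ->]]].
  by case: (TP n) => tJ _; apply: tJ.
move=> p; move: {2}(size p) (leqnn (size p)) => n.
elim: n p => [|n IH] p sp pJ.
  by rewrite (eqP (_ : p == 0)) ?ideal_gen0 // -size_poly_leq0.
have [q qG [sq eq]] : exists2 q, q \in ideal_gen (mem G) &
    (size q <= n.+1)%N /\ q`_n = p`_n.
  have [leNn|ltnN] := leqP N n.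
    have [|q qs qP] := sL n p`_n _ leNn.
      by apply/asboolP; exists n, p.
    exists q => //; apply: ideal_gen_mono qs => g gs.
    by rewrite -[_ \in _]/(_ \in G) mem_cat (gs : g \in s).
  have [_ tL] := TP n; have [|q qs qP] := tL p`_n.
    by apply/asboolP; exists p.
  exists q => //; apply: ideal_gen_mono qs => g gt.
  rewrite -[_ \in _]/(_ \in G) mem_cat; apply/orP; right; apply/flattenP.
  by exists (T n) => //; apply: map_f; rewrite mem_iota.
have [_ GD _] := idG.
rewrite -[p](subrK q); apply: GD => //; apply: IH.
  apply/leq_sizeP => j; rewrite leq_eqVlt coefB => /predU1P[<-|ltnj].
    by rewrite eq subrr.
  by move/leq_sizeP: sp => ->//; move/leq_sizeP: sq => -> //; rewrite subrr.
apply: is_idealB => //; apply: ideal_gen_subP qG => // g.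
rewrite -[_ \in _]/(_ \in G) mem_cat => /orP[/sJ //|/flattenP[_ /mapP[k _ ->]]].
by case: (TP k) => tJ _; apply: tJ.
Qed.

End HilbertBasis.

Lemma noetherian_poly (R : comNzRingType) :
  noetherian R -> noetherian {poly R}.
Proof.
by move=> noeR; apply: noetherianI => J; apply: hilbert_basis_ideal.
Qed.

(** [T] and [R] have the same image in [B], and [T] embeds, so [T] is a quotient of [R]. The
    quotient map is the choice function [g], which is a morphism because [v] is injective. *)
Lemma noetherian_image (R B T : comNzRingType) (phi : {rmorphism R -> B})
    (v : {rmorphism T -> B}) :
  injective v -> (forall r, exists t, v t = phi r) ->
  (forall t, exists r, phi r = v t) -> noetherian R -> noetherian T.
Proof.
move=> vI phiT Tphi noeR; apply: noetherianI => J [J0 JD JM].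
have /choice[g gP] := phiT.
pose J' : {pred R} := fun r => g r \in J.
have gD r r' : g (r + r') = g r + g r' by apply: vI; rewrite rmorphD !gP rmorphD.
have gM r r' : g (r * r') = g r * g r' by apply: vI; rewrite rmorphM !gP rmorphM.
have g0 : g 0 = 0 by apply: vI; rewrite gP !rmorph0.
have idJ' : is_ideal J'.
  split=> [|r r'|a r]; rewrite !unfold_in ?g0 //.
    by rewrite gD; apply: JD.
  by rewrite gM; apply: JM.
have [s sJ'] := noetherian_ideal noeR idJ'.
exists [seq g r | r <- s].
  move=> _ /mapP[r rs ->]; have : r \in J' by rewrite -sJ' mem_ideal_gen.
  by rewrite unfold_in.
move=> t tJ; have [r rt] := Tphi t.
have gr : g r = t by apply: vI; rewrite gP.
have : r \in ideal_gen (mem s) by rewrite sJ' unfold_in gr.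
rewrite -gr => /ideal_genP[w ws ->].
elim: w ws => [|u w IH] ws; first by rewrite big_nil g0 ideal_gen0.
rewrite big_cons gD; apply: ideal_genD; last first.
  by apply: IH => z zw; apply: ws; rewrite inE zw orbT.
rewrite gM; apply: ideal_genM; apply: mem_ideal_gen.
by apply: map_f; apply: ws; apply: mem_head.
Qed.

(** The elements of [l] are adjoined one at a time, each as the value of a new polynomial variable,
    so [R] is an iterated polynomial ring over [K]. That [phi] stays in [Z] is what later lets its
    values be viewed as elements of the Rees ring. *)
Lemma noetherian_cover (K : fieldType) (B : comNzRingType)
    (io : {rmorphism K -> B}) (Z : {pred B}) (l : seq B) :
  subring_closed Z -> (forall c, io c \in Z) -> {subset l <= Z} ->
  exists (R : comNzRingType) (phi : {rmorphism R -> B}),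
    [/\ noetherian R, forall r, phi r \in Z, forall c, exists r, phi r = io c
      & {in l, forall g, exists r, phi r = g}].
Proof.
move=> Zsub ioZ; have [Z1 ZB ZM] := Zsub.
have Z0 : 0 \in Z by rewrite -(subrr 1) ZB.
have ZD : {in Z &, forall f g, f + g \in Z}.
  by move=> f g fZ gZ; rewrite -[g]opprK ZB // -sub0r ZB.
elim: l => [|g l IH] lZ.
  by exists K, io; split=> //; [apply: noetherian_field|move=> c; exists c].
have [|R [phi [noeR phiZ phiK phil]]] := IH.
  by move=> h hl; apply: lZ; rewrite inE hl orbT.
have cg : commr_rmorph phi g by move=> r; apply: mulrC.
exists {poly R}, (horner_morph cg); split.
- exact (noetherian_poly noeR).
- move=> p; rewrite /=; rewrite /horner_morph; rewrite horner_coef.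
  apply: (big_ind (fun h => h \in Z)) => // i _; apply: (ZM).
    by rewrite coef_map /= phiZ.
  elim: (i : nat) => [|k IHk]; rewrite ?expr0 // exprS ZM //.
  by apply: lZ; apply: mem_head.
- by move=> c; have [r <-] := phiK c; exists r%:P; rewrite /= horner_morphC.
move=> h; rewrite inE => /predU1P[->|/phil[r <-]].
  by exists 'X; rewrite /= horner_morphX.
by exists r%:P; rewrite /= horner_morphC.
Qed.

(** * Arithmetic of the weights *)

Lemma least_semigroup_swap b c a s :
  least_positive (fun k => in_semigroup b c (k * a)%N) s ->
  least_positive (fun k => in_semigroup c b (k * a)%N) s.
Proof.
move=> [s0 [i [j ij]] smin]; split=> // [|k k0 [i' [j' ij']]].
  by exists j, i; rewrite addnC.
by apply: smin => //; exists j', i'; rewrite addnC.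
Qed.

Lemma least_semigroup_le b c a s k i j :
  least_positive (fun k => in_semigroup b c (k * a)%N) s ->
  (0 < k)%N -> (k * a = i * b + j * c)%N -> (s <= k)%N.
Proof. by move=> [_ _ smin] k0 e; apply: smin => //; exists i, j. Qed.

(* The cases in which two of the three binomials, or all of them, add up to
   zero; one of the binomials is then redundant. *)
Definition binomials_redundant (s t u t1 u1 s2 u2 s3 t3 : nat) : Prop :=
  (s = s2 /\ t = t1 /\ u1 = 0 /\ u2 = 0)%N \/
  (t = t3 /\ u = u2 /\ s2 = 0 /\ s3 = 0)%N \/
  (s = s3 /\ u = u1 /\ t1 = 0 /\ t3 = 0)%N \/
  (s = s3 /\ t = t1 /\ u = u2 /\ u1 = 0 /\ s2 = 0 /\ t3 = 0)%N \/
  (s = s2 /\ t = t3 /\ u = u1 /\ t1 = 0 /\ u2 = 0 /\ s3 = 0)%N.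

(** If [u1 = 0], coprimality turns the first binomial into [x^b - y^a]. Subtracting its relation
    from the others gives competitors for the least multiples, and minimality leaves only
    configurations in which binomials cancel. *)
Lemma redundant_of_u1_eq0 (a b c s t u t1 u1 s2 u2 s3 t3 : nat) :
  (0 < a)%N -> (0 < b)%N -> (0 < c)%N ->
  coprime a b -> coprime a c -> coprime b c ->
  least_positive (fun k => in_semigroup b c (k * a)%N) s ->
  least_positive (fun k => in_semigroup a c (k * b)%N) t ->
  least_positive (fun k => in_semigroup a b (k * c)%N) u ->
  (s * a = t1 * b + u1 * c)%N ->
  (t * b = s2 * a + u2 * c)%N ->
  (u * c = s3 * a + t3 * b)%N ->
  u1 = 0%N -> binomials_redundant s t u t1 u1 s2 u2 s3 t3.
Proof.
move=> a0 b0 c0 cab cac cbc hs ht hu esa etb euc u10.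
have [s0 _ _] := hs; have [t0 _ _] := ht; have [u0 _ _] := hu.
have leS k i j := least_semigroup_le (k := k) (i := i) (j := j) hs.
have leT k i j := least_semigroup_le (k := k) (i := i) (j := j) ht.
have leU k i j := least_semigroup_le (k := k) (i := i) (j := j) hu.
move: esa; rewrite u10 mul0n addn0 => esa.
have sb : s = b.
  have : (b %| s)%N by rewrite -(@Gauss_dvdl b s a) 1?coprime_sym // esa dvdn_mull.
  have : (s <= b)%N by apply: (leS b a 0%N) => //; lia.
  by move=> le_sb /(dvdn_leq s0); lia.
have t1a : t1 = a.
  by apply/eqP; rewrite -(eqn_pmul2r b0) -esa sb mulnC.
have le_ta : (t <= a)%N by apply: (leT a b 0%N) => //; lia.
have [ta|nta] := eqVneq t a.
  have [u20|u20] := posnP u2.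
    left; do !split=> //; last lia.
    by apply/eqP; rewrite -(eqn_pmul2r a0) sb; move: etb; rewrite u20 ta; lia.
  have [s20|s20] := posnP s2; last first.
    have lt_s2b : (s2 < b)%N by rewrite -(ltn_pmul2r a0); nia.
    have := leS (b - s2)%N 0%N u2; rewrite mulnBl sb.
    have -> : (b * a - s2 * a = 0 * b + u2 * c)%N by rewrite -ta; nia.
    by move=> h; have := h _ erefl; lia.
  (* Here [a b = u2 c] with [c] prime to [a] and to [b]. Once [c = 1], all three least multiples
     equal 1 and the last relation reads [s3 + t3 = 1]. *)
  have c1 : c = 1%N.
    have : (c %| a * b)%N by rewrite -ta etb s20 dvdn_addl // dvdn_mull.
    have : coprime c (a * b) by rewrite coprimeMr !(coprime_sym c) cac cbc.
    by rewrite /coprime => h1 /gcdn_idPl h2; rewrite h2 in h1; apply/eqP.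
  have s1 : (s <= 1)%N by apply: (leS 1 0 a)%N => //; lia.
  have b1 : b = 1%N by lia.
  have tl1 : (t <= 1)%N by apply: (leT 1 0 b)%N => //; lia.
  have ul1 : (u <= 1)%N by apply: (leU 1 1 0)%N => //; lia.
  have s3t3 : (s3 + t3 = 1)%N by nia.
  rewrite /binomials_redundant; have [s30|s30] := posnP s3.
    by right; left; do !split; nia.
  by do 3 right; left; do !split; nia.
have [s20|s20] := posnP s2; last first.
  have lt_s2b : (s2 < b)%N by rewrite -(ltn_pmul2r a0); nia.
  have := leS (b - s2)%N (a - t)%N u2; rewrite !mulnBl sb.
  have -> : (b * a - s2 * a = a * b - t * b + u2 * c)%N by nia.
  by move=> h; have := h _ erefl; lia.
move: etb; rewrite s20 mul0n add0n => etb.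
have tc : t = c.
  have : (c %| t)%N by rewrite -(@Gauss_dvdl c t b) 1?coprime_sym // etb dvdn_mull.
  have : (t <= c)%N by apply: (leT c 0 b)%N => //; lia.
  by move=> le_tc /(dvdn_leq t0); lia.
have u2b : u2 = b.
  by apply/eqP; rewrite -(eqn_pmul2r c0) -etb tc mulnC.
have lt_ca : (c < a)%N by lia.
have le_ub : (u <= b)%N by apply: (leU b 0 c)%N => //; lia.
have dvd_a k : (k * c = s3 * a)%N -> (a %| k)%N.
  by move=> e; rewrite -(@Gauss_dvdl a k c) // e dvdn_mull.
have [ub|nub] := eqVneq u b; last first.
  have [t30|t30] := posnP t3; last first.
    have lt_t3c : (t3 < c)%N by rewrite -(ltn_pmul2r b0); nia.
    have := leT (c - t3)%N s3 (b - u)%N; rewrite !mulnBl tc.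
    have -> : (c * b - t3 * b = s3 * a + (b * c - u * c))%N by nia.
    by move=> h; have := h _ erefl; lia.
  have /(dvdn_leq u0) le_au : (a %| u)%N by apply: dvd_a; lia.
  have : (s <= c)%N by apply: (leS c 0 a)%N => //; lia.
  lia.
have [s30|s30] := posnP s3.
  right; left; do !split=> //; last lia.
  by apply/eqP; rewrite -(eqn_pmul2r b0); move: euc; rewrite s30 ub tc; lia.
have [t30|t30] := posnP t3; last first.
  have lt_t3c : (t3 < c)%N by rewrite -(ltn_pmul2r b0); nia.
  have := leT (c - t3)%N s3 0%N; rewrite !mulnBl tc.
  have -> : (c * b - t3 * b = s3 * a + 0 * c)%N by nia.
  by move=> h; have := h _ erefl; lia.
have : (a %| b)%N by apply: dvd_a; nia.
move=> /gcdn_idPl e; move: cab; rewrite /coprime e; lia.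
Qed.

(** Each of the six exponents is moved to the place of [u1] by a permutation of [a], [b], [c];
    [binomials_redundant] collects the outcomes of all permutations. *)
Lemma exponents_gt0 (a b c s t u t1 u1 s2 u2 s3 t3 : nat) :
  (0 < a)%N -> (0 < b)%N -> (0 < c)%N ->
  coprime a b -> coprime a c -> coprime b c ->
  least_positive (fun k => in_semigroup b c (k * a)%N) s ->
  least_positive (fun k => in_semigroup a c (k * b)%N) t ->
  least_positive (fun k => in_semigroup a b (k * c)%N) u ->
  (s * a = t1 * b + u1 * c)%N ->
  (t * b = s2 * a + u2 * c)%N ->
  (u * c = s3 * a + t3 * b)%N ->
  ~ binomials_redundant s t u t1 u1 s2 u2 s3 t3 ->
  [/\ 0 < t1, 0 < u1, 0 < s2 & [/\ 0 < u2, 0 < s3 & 0 < t3]]%N.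
Proof.
move=> a0 b0 c0 ab ac bc hs ht hu esa etb euc nred.
have hs' := least_semigroup_swap hs; have ht' := least_semigroup_swap ht.
have hu' := least_semigroup_swap hu.
have [ba ca cb] : [/\ coprime b a, coprime c a & coprime c b].
  by rewrite !(coprime_sym c) (coprime_sym b).
have pos n : (n = 0 -> False)%N -> (0 < n)%N by case: n => // /(_ erefl).
rewrite /binomials_redundant in nred.
do 2?split; apply: pos => z0; apply: nred.
- by have := redundant_of_u1_eq0 a0 c0 b0 ac ab cb hs' hu ht
    (etrans esa (addnC _ _)) euc etb z0; rewrite /binomials_redundant; tauto.
- by have := redundant_of_u1_eq0 a0 b0 c0 ab ac bc hs ht hu esa etb euc z0;
    rewrite /binomials_redundant; tauto.
- by have := redundant_of_u1_eq0 b0 c0 a0 bc ba ca ht' hu' hs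
    (etrans etb (addnC _ _)) (etrans euc (addnC _ _)) esa z0;
    rewrite /binomials_redundant; tauto.
- by have := redundant_of_u1_eq0 b0 a0 c0 ba bc ac ht hs hu'
    etb esa (etrans euc (addnC _ _)) z0; rewrite /binomials_redundant; tauto.
- by have := redundant_of_u1_eq0 c0 b0 a0 cb ca ba hu' ht' hs'
    (etrans euc (addnC _ _)) (etrans etb (addnC _ _)) (etrans esa (addnC _ _)) z0;
    rewrite /binomials_redundant; tauto.
by have := redundant_of_u1_eq0 c0 a0 b0 ca cb ab hu hs' ht'
    euc (etrans esa (addnC _ _)) (etrans etb (addnC _ _)) z0;
    rewrite /binomials_redundant; tauto.
Qed.

(* Subtracting the relation [s a = t b + u c] from a relation [i a = j b + k c]
   shortens it: [j] and [t], or [k] and [u], partially cancel. *)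
Lemma relation_descent (a b c s t u : nat) (i j k : int) :
  (0 < a)%N -> (0 < b)%N -> (0 < c)%N -> (0 < t)%N -> (0 < u)%N ->
  (s * a = t * b + u * c)%N ->
  (forall i j k, 0 < k -> k * a = i * b + j * c -> s <= k)%N ->
  0 < i -> j <= 0 -> k <= 0 -> i * a%:Z + j * b%:Z + k * c%:Z = 0 ->
  (`|(i - s%:Z)%R| * a + `|(j + t%:Z)%R| * b + `|(k + u%:Z)%R| * c
     < `|i| * a + `|j| * b + `|k| * c)%N.
Proof.
move=> a0 b0 c0 t0 u0 e smin.
case: i => // I I0; rewrite -[j]opprK -[k]opprK !oppr_le0.
case: (- j) => // J _; case: (- k) => // K _ eq0.
have {eq0} eq0 : (I * a = J * b + K * c)%N by lia.
have {smin} le : (s <= I)%N by apply: smin eq0.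
have -> : `|(I%:Z - s%:Z)%R|%N = (I - s)%N by lia.
have hb : (`|(- J%:Z + t%:Z)%R| * b <= (J + t) * b)%N by rewrite leq_mul2r; lia.
have hc : (`|(- K%:Z + u%:Z)%R| * c <= (K + u) * c)%N by rewrite leq_mul2r; lia.
have lt : (`|(- J%:Z + t%:Z)%R| * b + `|(- K%:Z + u%:Z)%R| * c
            < (J + t) * b + (K + u) * c)%N.
  have [J0|J0] := posnP J; last first.
    rewrite -addSn leq_add // ltn_mul2r b0; lia.
  have [K0|K0] := posnP K; last first.
    rewrite -addnS leq_add // ltn_mul2r c0; lia.
  by move: eq0 I0; rewrite J0 K0 !mul0n; nia.
have -> : (`|I| * a + `|(- J%:Z)%R| * b + `|(- K%:Z)%R| * c =
   (I - s) * a + (J + t) * b + (K + u) * c)%N.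
  by rewrite !abszN !absz_nat mulnBl !mulnDl; have := leq_mul2r a s I; lia.
by rewrite -!addnA ltn_add2l.
Qed.

(** The weights are positive, so a nonzero relation has entries of both signs; among three entries,
    one sign is then carried by a single entry. *)
Lemma relation_signs (a b c : nat) (i j k : int) :
  (0 < a)%N -> (0 < b)%N -> (0 < c)%N -> i * a%:Z + j * b%:Z + k * c%:Z = 0 ->
  let one_pos i j k := [\/ [/\ 0 < i, j <= 0 & k <= 0], [/\ 0 < j, i <= 0 & k <= 0]
                        | [/\ 0 < k, i <= 0 & j <= 0]] in
  [\/ [/\ i = 0, j = 0 & k = 0], one_pos i j k | one_pos (- i) (- j) (- k)].
Proof.
move=> a0 b0 c0 e one_pos.
have pos (x y z : int) : 0 <= x -> 0 <= y -> 0 <= z ->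
    x * a%:Z + y * b%:Z + z * c%:Z = 0 -> [/\ x = 0, y = 0 & z = 0].
  move=> x0 y0 z0 /eqP; rewrite paddr_eq0 ?addr_ge0 ?mulr_ge0 //.
  rewrite paddr_eq0 ?mulr_ge0 // !mulf_eq0 => /andP[/andP[]].
  by rewrite !eqz_nat; split; apply/eqP; lia.
have e' : (- i) * a%:Z + (- j) * b%:Z + (- k) * c%:Z = 0.
  by rewrite -[RHS]oppr0 -e; ring.
have ei := pos i j k; have en := pos (- i) (- j) (- k).
have [i0|i0] := ltrP 0 i; have [j0|j0] := ltrP 0 j; have [k0|k0] := ltrP 0 k.
- by case: ei; lia.
- apply: Or33; apply: Or33; suff k1 : k != 0 by split; lia.
  by apply/negP => /eqP k1; case: ei; lia.
- apply: Or33; apply: Or32; suff j1 : j != 0 by split; lia.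
  by apply/negP => /eqP j1; case: ei; lia.
- by apply: Or32; apply: Or31.
- apply: Or33; apply: Or31; suff i1 : i != 0 by split; lia.
  by apply/negP => /eqP i1; case: ei; lia.
- by apply: Or32; apply: Or32.
- by apply: Or32; apply: Or33.
by apply: Or31; case: en; [lia|lia|lia|exact: e'|split; lia].
Qed.

(** * The lattice of exponent vectors of degree zero *)

Section Lattice.

Variables a b c s t u t1 u1 s2 u2 s3 t3 : nat.
Hypotheses (a0 : (0 < a)%N) (b0 : (0 < b)%N) (c0 : (0 < c)%N).
Hypotheses (cab : coprime a b).
Hypothesis hs : least_positive (fun k => in_semigroup b c (k * a)%N) s.
Hypothesis ht : least_positive (fun k => in_semigroup a c (k * b)%N) t.
Hypothesis hu : least_positive (fun k => in_semigroup a b (k * c)%N) u.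
Hypothesis esa : (s * a = t1 * b + u1 * c)%N.
Hypothesis etb : (t * b = s2 * a + u2 * c)%N.
Hypothesis euc : (u * c = s3 * a + t3 * b)%N.
Hypotheses (t10 : (0 < t1)%N) (u10 : (0 < u1)%N) (s20 : (0 < s2)%N).
Hypotheses (u20 : (0 < u2)%N) (s30 : (0 < s3)%N) (t30 : (0 < t3)%N).

Let leS k i j (k0 : (0 < k)%N) (e : (k * a = i * b + j * c)%N) : (s <= k)%N :=
  least_semigroup_le hs k0 e.
Let leT k i j (k0 : (0 < k)%N) (e : (k * b = i * a + j * c)%N) : (t <= k)%N :=
  least_semigroup_le ht k0 e.
Let leU k i j (k0 : (0 < k)%N) (e : (k * c = i * a + j * b)%N) : (u <= k)%N :=
  least_semigroup_le hu k0 e.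

(** Adding two of the relations and cancelling gives a competitor for the third least multiple,
    hence three inequalities. The preliminary strict bounds ensure that the cancellations leave
    positive multiples. *)
Lemma exponents_sum : [/\ s = s2 + s3, t = t1 + t3 & u = u1 + u2]%N.
Proof.
have [s0 _ _] := hs; have [t0 _ _] := ht; have [u0 _ _] := hu.
have lt_s2 : (s2 < s)%N.
  rewrite ltnNge; apply/negP => le.
  have lt : (t1 < t)%N by rewrite -(ltn_pmul2r b0); nia.
  by have := @leT (t - t1) (s2 - s) (u1 + u2); nia.
have lt_s3 : (s3 < s)%N.
  rewrite ltnNge; apply/negP => le.
  have lt : (u1 < u)%N by rewrite -(ltn_pmul2r c0); nia.
  by have := @leU (u - u1) (s3 - s) (t1 + t3); nia.
have lt_t1 : (t1 < t)%N.
  rewrite ltnNge; apply/negP => le.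
  have lt : (s2 < s)%N by [].
  by have := @leS (s - s2) (t1 - t) (u1 + u2); nia.
have lt_t3 : (t3 < t)%N.
  rewrite ltnNge; apply/negP => le.
  have lt : (u2 < u)%N by rewrite -(ltn_pmul2r c0); nia.
  by have := @leU (u - u2) (s2 + s3) (t3 - t); nia.
have lt_u1 : (u1 < u)%N.
  rewrite ltnNge; apply/negP => le.
  by have := @leS (s - s3) (t1 + t3) (u1 - u); nia.
have lt_u2 : (u2 < u)%N.
  rewrite ltnNge; apply/negP => le.
  by have := @leT (t - t3) (s2 + s3) (u2 - u); nia.
have leu : (u <= u1 + u2)%N by apply: (@leU _ (s - s2) (t - t1)); nia.
have let' : (t <= t1 + t3)%N by apply: (@leT _ (s - s3) (u - u1)); nia.
have les : (s <= s2 + s3)%N by apply: (@leS _ (t - t3) (u - u2)); nia.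
(* The sum of the three relations: both sides of the three inequalities have the same weighted
   total, so none is strict. *)
have E : ((s2 + s3) * a + (t1 + t3) * b + (u1 + u2) * c =
          s * a + t * b + u * c)%N by lia.
by split; apply/eqP; rewrite eqn_leq; apply/andP; split=> //; nia.
Qed.

(** By induction on the weighted absolute size: up to sign one entry is positive alone, and
    [relation_descent] subtracts the matching binomial vector. Two vectors suffice because the three
    sum to zero by [exponents_sum]. *)
Lemma degree0_lattice (i j k : int) : i * a%:Z + j * b%:Z + k * c%:Z = 0 ->
  exists p q : int,
    [/\ i = p * s%:Z - q * s3%:Z, j = - p * t1%:Z - q * t3%:Z
      & k = - p * u1%:Z + q * u%:Z].
Proof.
pose P (i j k : int) := exists p q : int,
    [/\ i = p * s%:Z - q * s3%:Z, j = - p * t1%:Z - q * t3%:Z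
      & k = - p * u1%:Z + q * u%:Z].
have [es et eu] := exponents_sum.
have PN i' j' k' : P (- i') (- j') (- k') -> P i' j' k'.
  by move=> [p [q [e1 e2 e3]]]; exists (- p), (- q);
     split; apply: oppr_inj; rewrite ?e1 ?e2 ?e3; ring.
rewrite -/(P i j k).
have [n] := ubnP (`|i| * a + `|j| * b + `|k| * c)%N.
elim: n i j k => // n IH i j k len e.
have main i' j' k' :
    (`|i'| * a + `|j'| * b + `|k'| * c < n.+1)%N ->
    i' * a%:Z + j' * b%:Z + k' * c%:Z = 0 ->
    [\/ [/\ 0 < i', j' <= 0 & k' <= 0], [/\ 0 < j', i' <= 0 & k' <= 0]
     | [/\ 0 < k', i' <= 0 & j' <= 0]] -> P i' j' k'.
  clear i j k len e => len e [] [h1 h2 h3].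
  - have lt := relation_descent a0 b0 c0 t10 u10 esa (fun i j k => @leS k i j)
      h1 h2 h3 e.
    case: (IH _ _ _ (leq_trans lt len)).
      by rewrite -[RHS]e; have : s%:Z * a%:Z = t1%:Z * b%:Z + u1%:Z * c%:Z;
         [rewrite -!PoszM esa|move=> E; ring: E].
    move=> p [q [e1 e2 e3]]; exists (p + 1), q; split.
    + by rewrite -[i'](subrK s%:Z) e1; ring.
    + by rewrite -[j'](addrK t1%:Z) e2; ring.
    + by rewrite -[k'](addrK u1%:Z) e3; ring.
  - have e' : j' * b%:Z + i' * a%:Z + k' * c%:Z = 0 by rewrite -e; ring.
    have lt := relation_descent b0 a0 c0 s20 u20 etb (fun i j k => @leT k i j)
      h1 h2 h3 e'.
    rewrite [in X in (X < _)%N](addnC (`|_| * b)%N) in lt.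
    rewrite [in X in (_ < X)%N](addnC (`|_| * b)%N) in lt.
    case: (IH _ _ _ (leq_trans lt len)).
      by rewrite -[RHS]e; have : t%:Z * b%:Z = s2%:Z * a%:Z + u2%:Z * c%:Z;
         [rewrite -!PoszM etb|move=> E; ring: E].
    (* The vector of the second binomial is minus the sum of the other two. *)
    move=> p [q [e1 e2 e3]]; exists (p - 1), (q - 1); split.
    + by rewrite -[i'](addrK s2%:Z) e1 es PoszD; ring.
    + by rewrite -[j'](subrK t%:Z) e2 et PoszD; ring.
    + by rewrite -[k'](addrK u2%:Z) e3 eu PoszD; ring.
  - have e' : k' * c%:Z + i' * a%:Z + j' * b%:Z = 0 by rewrite -e; ring.
    have lt := relation_descent c0 a0 b0 s30 t30 euc (fun i j k => @leU k i j)
      h1 h2 h3 e'.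
    rewrite -[X in (X < _)%N]addnA [X in (X < _)%N]addnC in lt.
    rewrite -[X in (_ < X)%N]addnA [X in (_ < X)%N]addnC in lt.
    case: (IH _ _ _ (leq_trans lt len)).
      by rewrite -[RHS]e; have : u%:Z * c%:Z = s3%:Z * a%:Z + t3%:Z * b%:Z;
         [rewrite -!PoszM euc|move=> E; ring: E].
    move=> p [q [e1 e2 e3]]; exists p, (q + 1); split.
    + by rewrite -[i'](addrK s3%:Z) e1; ring.
    + by rewrite -[j'](addrK t3%:Z) e2; ring.
    + by rewrite -[k'](subrK u%:Z) e3; ring.
have [[-> -> ->]|pos|neg] := relation_signs a0 b0 c0 e.
- by exists 0, 0; split; ring.
- exact: main.
by apply: PN; apply: main => //; rewrite ?abszN // -[RHS]oppr0 -e; ring.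
Qed.

(* The cross product of the exponent vectors of the first and third binomials
   is [- (a, b, c)]. *)
Lemma weightsE : [/\ a = t1 * u + u1 * t3, b = s2 * u + s3 * u2
  & c = s * t3 + t1 * s3]%N.
Proof.
have [es et eu] := exponents_sum.
(* The Koszul relations [(b, -a, 0)], [(c, 0, -a)], [(0, c, -b)] are written in the basis. Their 2
   by 2 minors are multiples of the minors [N1], [N2] of the basis up to sign, whence [N1] divides
   [a a] and [a b], and [N2] divides [b b] and [b a]. *)
have [p [q [e1 e2 e3]]] : exists p q : int,
    [/\ b%:Z = p * s%:Z - q * s3%:Z, - a%:Z = - p * t1%:Z - q * t3%:Z
      & 0 = - p * u1%:Z + q * u%:Z].
  by apply: degree0_lattice; ring.
have [p' [q' [f1 f2 f3]]] : exists p q : int,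
    [/\ c%:Z = p * s%:Z - q * s3%:Z, 0 = - p * t1%:Z - q * t3%:Z
      & - a%:Z = - p * u1%:Z + q * u%:Z].
  by apply: degree0_lattice; ring.
have [r [v [h1 h2 h3]]] : exists p q : int,
    [/\ 0 = p * s%:Z - q * s3%:Z, c%:Z = - p * t1%:Z - q * t3%:Z
      & - b%:Z = - p * u1%:Z + q * u%:Z].
  by apply: degree0_lattice; ring.
set N1 := (t1 * u + _)%N; set N2 := (s2 * u + _)%N; set N3 := (s * t3 + _)%N.
have dvd (x y n : nat) (d : int) : x%:Z * y%:Z = d * n%:Z -> (n %| x * y)%N.
  by move=> /(congr1 absz); rewrite !abszM /= => ->; apply: dvdn_mull.
have N2Z : N2%:Z = s%:Z * u%:Z - s3%:Z * u1%:Z.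
  by rewrite /N2 es eu !(PoszD, PoszM); ring.
have N1Z : N1%:Z = t1%:Z * u%:Z + u1%:Z * t3%:Z by rewrite /N1 PoszD !PoszM.
have d1 : (N1 %| a * a)%N.
  apply: (dvd _ _ _ (q * p' - p * q')).
  have E : 0 = (- p * u1%:Z + q * u%:Z) * (- p' * t1%:Z - q' * t3%:Z).
    by rewrite -e3 mul0r.
  by rewrite -[LHS]mulrNN {1}e2 f3 -[LHS]subr0 E N1Z; ring.
have d2 : (N1 %| a * b)%N.
  apply: (dvd _ _ _ (q * r - p * v)).
  have E : 0 = (- p * u1%:Z + q * u%:Z) * (- r * t1%:Z - v * t3%:Z).
    by rewrite -e3 mul0r.
  by rewrite -[LHS]mulrNN e2 h3 -[LHS]subr0 E N1Z; ring.
have d3 : (N2 %| b * b)%N.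
  apply: (dvd _ _ _ (q * r - p * v)).
  have E : 0 = (- p * u1%:Z + q * u%:Z) * (r * s%:Z - v * s3%:Z).
    by rewrite -e3 mul0r.
  by rewrite -[LHS]opprK -mulrN h3 e1 -[LHS]add0r E N2Z; ring.
have d4 : (N2 %| b * a)%N.
  apply: (dvd _ _ _ (q * p' - p * q')).
  have E : 0 = (- p * u1%:Z + q * u%:Z) * (p' * s%:Z - q' * s3%:Z).
    by rewrite -e3 mul0r.
  by rewrite -[LHS]opprK -mulrN f3 e1 -[LHS]add0r E N2Z; ring.
have dN1 : (N1 %| a)%N.
  have : (N1 %| gcdn (a * a) (a * b))%N by rewrite dvdn_gcd d1.
  by rewrite -muln_gcdr (eqP (cab : gcdn a b == 1%N)) muln1.
have dN2 : (N2 %| b)%N.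
  have : (N2 %| gcdn (b * b) (b * a))%N by rewrite dvdn_gcd d3.
  by rewrite -muln_gcdr gcdnC (eqP (cab : gcdn a b == 1%N)) muln1.
have E12 : (a * N2 = b * N1)%N.
  by apply/eqP; rewrite -eqz_nat !PoszM N1Z N2Z; apply/eqP;
     move: esa euc => /(congr1 Posz) + /(congr1 Posz);
     rewrite !PoszD !PoszM => E1 E3; ring: E1 E3.
have E13 : (a * N3 = c * N1)%N.
  by apply/eqP; rewrite -eqz_nat !PoszM N1Z /N3; apply/eqP;
     move: esa euc => /(congr1 Posz) + /(congr1 Posz);
     rewrite !PoszD !PoszM => E1 E3; ring: E1 E3.
have [s0 _ _] := hs; have [u0 _ _] := hu.
have N10 : (0 < N1)%N by rewrite addn_gt0 muln_gt0 t10 u0.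
have N20 : (0 < N2)%N by rewrite addn_gt0 muln_gt0 s20 u0.
have [x ex] := dvdnP dN1; have [y ey] := dvdnP dN2.
have exy : x = y.
  apply/eqP; rewrite -(eqn_pmul2r N10) -(eqn_pmul2r N20); apply/eqP.
  by rewrite -ex E12 [RHS]mulnAC -ey.
have x1 : x = 1%N.
  have : (x %| gcdn a b)%N.
    by rewrite dvdn_gcd {1}ex dvdn_mulr // ey -exy dvdn_mulr.
  by rewrite (eqP (cab : gcdn a b == 1%N)) dvdn1 => /eqP.
have ea : a = N1 by rewrite ex x1 mul1n.
split=> //; first by rewrite ey -exy x1 mul1n.
by apply/eqP; rewrite -(eqn_pmul2r N10) -E13 ea mulnC.
Qed.

(** Integer dual functionals come from a Bezout identity for [a] and [b]. Adding a large multiple of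
    the weight vector, which kills all vectors of degree zero, makes their entries nonnegative. *)
Lemma curve_functionals : exists f1 f2 f3 p1 p2 p3 : nat,
  [/\ (f1 * s = f2 * t1 + f3 * u1 + 1)%N, (f3 * u = f1 * s3 + f2 * t3)%N,
      (p1 * s = p2 * t1 + p3 * u1)%N & (p3 * u = p1 * s3 + p2 * t3 + 1)%N].
Proof.
have [ea eb ec] := weightsE; have [es et eu] := exponents_sum.
have [k1 [k2 ek]] : exists k1 k2 : int, k1 * a%:Z + k2 * b%:Z = 1.
  have := egcdnP b a0; case: egcdnP => // km kn e _ _.
  exists km%:Z, (- kn%:Z); move: e; rewrite (eqP (cab : gcdn a b == 1%N)).
  by move=> /(congr1 Posz); rewrite PoszD !PoszM => ->; ring.
have nat_of (x : int) (n L : nat) : (0 < n)%N -> (`|x| <= L)%N ->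
    exists y : nat, y%:Z = x + L%:Z * n%:Z.
  move=> n0 le; exists `|(x + L%:Z * n%:Z)%R|%N; rewrite gez0_abs //.
  have : (L <= L * n)%N by rewrite leq_pmulr.
  rewrite -PoszM; lia.
(* With [k = (k1, k2, 0)], [v1 = (s, -t1, -u1)] and [v3 = (-s3, -t3, u)], these are the cross
   products [x = k × v3] and [y = v1 × k]. Since [v3 × v1 = (a, b, c)], both [x . v1] and [y . v3]
   equal [k . (a, b, c) = 1]. *)
pose x1 := u%:Z * k2; pose x2 := - (u%:Z * k1); pose x3 := s3%:Z * k2 - t3%:Z * k1.
pose y1 := k2 * u1%:Z; pose y2 := - (k1 * u1%:Z); pose y3 := k1 * t1%:Z + k2 * s%:Z.
pose L := (`|x1| + `|x2| + `|x3| + `|y1| + `|y2| + `|y3|)%N.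
have [||f1 e1] := nat_of x1 a L => //; first by rewrite /L; lia.
have [||f2 e2] := nat_of x2 b L => //; first by rewrite /L; lia.
have [||f3 e3] := nat_of x3 c L => //; first by rewrite /L; lia.
have [||p1 h1] := nat_of y1 a L => //; first by rewrite /L; lia.
have [||p2 h2] := nat_of y2 b L => //; first by rewrite /L; lia.
have [||p3 h3] := nat_of y3 c L => //; first by rewrite /L; lia.
have N1 : t1%:Z * u%:Z = a%:Z - u1%:Z * t3%:Z.
  by rewrite ea PoszD !PoszM addrK.
have N2 : s%:Z * u%:Z = b%:Z + s3%:Z * u1%:Z.
  by rewrite eb es eu !(PoszD, PoszM); ring.
have E1 : s%:Z * a%:Z = t1%:Z * b%:Z + u1%:Z * c%:Z.
  by rewrite -!PoszM esa.
have E3 : u%:Z * c%:Z = s3%:Z * a%:Z + t3%:Z * b%:Z by rewrite -!PoszM euc.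
have ek' : k1 * a%:Z = 1 - k2 * b%:Z by rewrite -ek addrK.
exists f1, f2, f3, p1, p2, p3.
split; apply/eqP; rewrite -eqz_nat ?(PoszD, PoszM) ?e1 ?e2 ?e3 ?h1 ?h2 ?h3;
  apply/eqP; clear - N1 N2 E1 E3 ek'.
- rewrite /x1 /x2 /x3.
  transitivity (k2 * (s%:Z * u%:Z) + L%:Z * (s%:Z * a%:Z)); first by ring.
  rewrite N2 E1.
  transitivity (k1 * a%:Z - k1 * (t1%:Z * u%:Z + u1%:Z * t3%:Z)
     + k2 * (b%:Z + s3%:Z * u1%:Z) + L%:Z * (t1%:Z * b%:Z + u1%:Z * c%:Z)).
    by rewrite N1; ring.
  by rewrite ek'; ring.
- by rewrite /x1 /x2 /x3; ring: E3.
- by rewrite /y1 /y2 /y3; ring: E1.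
rewrite /y1 /y2 /y3.
transitivity (k1 * (t1%:Z * u%:Z) + k2 * (s%:Z * u%:Z) + L%:Z * (u%:Z * c%:Z)).
  by ring.
by rewrite N1 N2 E3 mulrBr ek'; ring.
Qed.

End Lattice.

(** * Bivariate orders of vanishing and sparse polynomials *)

Section Order.

Variable D : comNzRingType.
Implicit Types F G : {poly {poly D}}.

(* Membership of [F] in the [n]-th power of the ideal of the two variables. *)
Definition ordge n F : Prop := forall i j, (i + j < n)%N -> F`_i`_j = 0.

Lemma ordge0 n : ordge n 0.
Proof. by move=> i j _; rewrite !coef0. Qed.

Lemma ordge_le m n F : (m <= n)%N -> ordge n F -> ordge m F.
Proof. by move=> le oF i j lt; apply: oF; apply: leq_trans le. Qed.

Lemma ordgeD n F G : ordge n F -> ordge n G -> ordge n (F + G).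
Proof. by move=> oF oG i j lt; rewrite !coefD oF ?oG ?addr0. Qed.

Lemma ordgeN n F : ordge n F -> ordge n (- F).
Proof. by move=> oF i j lt; rewrite !coefN oF ?oppr0. Qed.

Lemma ordgeB n F G : ordge n F -> ordge n G -> ordge n (F - G).
Proof. by move=> oF oG; apply: ordgeD => //; apply: ordgeN. Qed.

Lemma ordgeM m n F G : ordge m F -> ordge n G -> ordge (m + n) (F * G).
Proof.
move=> oF oG i j lt; rewrite coefM coef_sum big1 // => k _.
rewrite coefM big1 // => l _; have [lkm|] := ltnP (k + l) m.
  by rewrite oF ?mul0r.
move=> lemk; rewrite oG ?mulr0 //.
by have := ltn_ord k; have := ltn_ord l; lia.
Qed.

Lemma ordgeX m n F : ordge m F -> ordge (m * n) (F ^+ n).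
Proof.
move=> oF; elim: n => [|n IH]; first by rewrite muln0 => i j.
by rewrite exprS mulnS; apply: ordgeM.
Qed.

Lemma ordge_sum (I : Type) (r : seq I) (P : pred I) n
    (F : I -> {poly {poly D}}) :
  (forall i, P i -> ordge n (F i)) -> ordge n (\sum_(i <- r | P i) F i).
Proof.
move=> oF; apply: (big_ind (ordge n)) => //; first exact: ordge0.
by move=> G H; apply: ordgeD.
Qed.

Lemma coef_mulXX F p q i j :
  (F * ('X^p)%:P * 'X^q)`_i`_j =
  if (i < q)%N || (j < p)%N then 0 else F`_(i - q)`_(j - p).
Proof.
rewrite coefMXn; case: ltnP => _ /=; first by rewrite coef0.
by rewrite coefMC coefMXn; case: ltnP.
Qed.

End Order.

(** [S] is a nonzero constant plus a term of order 1. If [F] has order [n], then this constant times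
    [F] differs from [S F] by a term of order [n + 1]. *)
Lemma ordge_mulKl (D : idomainType) n (S F : {poly {poly D}}) :
  S`_0`_0 != 0 -> ordge n (S * F) -> ordge n F.
Proof.
move=> S0; elim: n => [|n IH] oSF; first by [].
have oF : ordge n F by apply: IH; apply: ordge_le oSF.
pose c := S`_0`_0; have oS : ordge 1 (S - c%:P%:P).
  by case=> [|i] [|j] // _; rewrite !coefB !coefC /= ?coefC subrr.
have oc : ordge n.+1 (c%:P%:P * F).
  have := ordgeB oSF (ordgeM oS oF).
  by rewrite -mulrBl opprB addrC subrK.
move=> i j lt; have := oc i j lt; rewrite !coefCM => /eqP.
by rewrite mulf_eq0 (negPf S0) => /eqP.
Qed.

Lemma dvdp_XnP (K : fieldType) n (p : {poly K}) :
  reflect (forall i, (i < n)%N -> p`_i = 0) ('X^n %| p)%R.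
Proof.
apply: (iffP (dvdpP _ _)) => [[q ->] i lt|p0]; first by rewrite coefMXn lt.
exists (drop_poly n p); rewrite -[LHS](poly_take_drop n).
rewrite [take_poly n p](_ : _ = 0) ?add0r //; apply/polyP=> i.
by rewrite coef_take_poly coef0; case: ltnP => // /p0.
Qed.

Lemma ordge_dvdp (K : fieldType) n (F : {poly {poly K}}) :
  ordge n F <-> forall i, (i < n)%N -> ('X^(n - i) %| F`_i)%R.
Proof.
split=> [oF i lt|dF i j lt].
  by apply/dvdp_XnP=> j lt'; apply: oF; lia.
by have /dvdp_XnP := dF i (leq_ltn_trans (leq_addr _ _) lt); apply; lia.
Qed.

Lemma dvdp_shift (K : fieldType) n (p : {poly K}) :
  ('X^n %| p \Po ('X + 1%:P)) = (('X - 1%:P) ^+ n %| p).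
Proof.
apply/idP/idP=> [] /dvdpP[q e]; apply/dvdpP.
  exists (q \Po ('X - 1%:P)).
  have := congr1 (fun r => r \Po ('X - 1%:P)) e.
  rewrite -comp_polyA comp_polyD comp_polyC comp_polyX subrK comp_polyXr => ->.
  by rewrite comp_polyM rmorphXn /= comp_polyX.
exists (q \Po ('X + 1%:P)); rewrite e comp_polyM rmorphXn /=.
by rewrite comp_polyB comp_polyC comp_polyX addrK.
Qed.

Section CharacteristicZero.

Variables (K : fieldType) (hK : [pchar K] =i pred0).
Implicit Types p q : {poly K}.

Lemma natr_neq0 n : (0 < n)%N -> n%:R != 0 :> K.
Proof. by move/pcharf0P: hK => ->; rewrite lt0n. Qed.

Lemma coprime_Xsub1 k n : coprimep (('X - 1%:P : {poly K}) ^+ n) ('X^k).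
Proof.
apply: coprimep_expl; apply: coprimep_expr.
by rewrite coprimepX root_XsubC eq_sym oner_eq0.
Qed.

(* Dividing by a power of [X] and differentiating kills one term and lowers the
   order of vanishing at 1 by one. *)
Lemma sparse_poly_eq0 (l : seq nat) p :
  (forall i, p`_i != 0 -> i \in l) -> (('X - 1%:P) ^+ size l %| p) -> p = 0.
Proof.
have [N] := ubnP (size l); elim: N l p => // N IH l p ltN lp dvd.
have [//|p0] := eqVneq p 0; exfalso.
have [k pk kmin] : exists2 k, p`_k != 0 & forall i, (i < k)%N -> p`_i = 0.
  have ex : exists k, p`_k != 0 by exists (size p).-1; rewrite -lead_coefE lead_coef_eq0.
  exists (ex_minn ex); case: ex_minnP => // m pm min i lt.
  by apply: contraTeq lt => /min; rewrite -leqNgt.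
have kl := lp k pk.
have l0 : (0 < size l)%N by case: (l) kl.
pose q := drop_poly k p.
have pq : p = q * 'X^k.
  rewrite -[LHS](poly_take_drop k) [take_poly k p](_ : _ = 0) ?add0r //.
  by apply/polyP=> i; rewrite coef_take_poly coef0; case: ltnP => // /kmin.
have dvdq : ('X - 1%:P) ^+ size l %| q.
  by move: dvd; rewrite pq Gauss_dvdpl // coprime_Xsub1.
pose l' := [seq (i - k.+1)%N | i <- l & i != k].
have ltl : (size l' < size l)%N.
  rewrite size_map size_filter -(count_predC (predC1 k) l) -[X in (X < _)%N]addn0.
  by rewrite ltn_add2l -has_count; apply/hasP; exists k => //=; rewrite negbK.
have q'0 : q^`() = 0.
  apply: (IH l'); first by apply: leq_trans ltl _.
    move=> i; rewrite coef_deriv coef_drop_poly => nz.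
    have pi : p`_(i.+1 + k) != 0 by apply: contraNneq nz => ->; rewrite mul0rn.
    apply/mapP; exists (i.+1 + k)%N; last by lia.
    by rewrite mem_filter lp // andbT; lia.
  case/dvdpP: dvdq => r ->; case: (size l) l0 ltl => // n _ ltn.
  rewrite derivM deriv_exp derivB derivX derivC subr0 mul1r /=.
  apply: dvdp_trans (dvdp_exp2l _ (ltn : (size l' <= n)%N)) _.
  rewrite exprS mulrA mulrnAr -mulr_natl; apply: dvdp_add; first exact: dvdp_mulIr.
  by rewrite mulrA; apply: dvdp_mulIr.
have qC : q = (q`_0)%:P.
  apply/polyP=> [[|i]]; rewrite coefC //=.
  have := congr1 (fun r : {poly K} => r`_i) q'0; rewrite coef_deriv coef0 => /eqP.
  by rewrite -mulr_natr mulf_eq0 (negPf (natr_neq0 _)) // orbF => /eqP.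
have q0 : q`_0 != 0 by rewrite coef_drop_poly.
have := dvdp_leq _ dvdq; rewrite qC polyC_eq0 q0 => /(_ isT).
by rewrite size_exp_XsubC size_polyC q0; lia.
Qed.

Lemma sparse_sum_eq0 N (e : 'I_N -> nat) (c : 'I_N -> K) :
  injective e -> ('X - 1%:P) ^+ N %| \sum_i c i *: 'X^(e i) ->
  forall i, c i = 0.
Proof.
move=> eI dvd i.
have S0 : \sum_i c i *: 'X^(e i) = 0 :> {poly K}.
  apply: (@sparse_poly_eq0 [seq e i | i : 'I_N]); last by rewrite size_map -cardE card_ord.
  move=> k; apply: contraR => kl; rewrite coef_sum big1 // => j _.
  rewrite coefZ coefXn; case: eqP => [kj|]; last by rewrite mulr0.
  by case/negP: kl; apply/mapP; exists j; rewrite ?mem_enum.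
have := congr1 (fun p : {poly K} => p`_(e i)) S0.
rewrite coef0 coef_sum (bigD1 i) //= coefZ coefXn eqxx mulr1 big1 ?addr0 //.
by move=> j ji; rewrite coefZ coefXn (inj_eq eI) eq_sym (negPf ji) mulr0.
Qed.

(** Hermite interpolation at one point. A vector in the kernel of the matrix is a polynomial with
    [N] terms vanishing to order [N] at 1, hence zero, so the matrix is invertible. *)
Lemma sparse_interpolation N (e : 'I_N -> nat) p : injective e ->
  exists c : 'I_N -> K, 'X^N %| p - \sum_i c i *: ('X + 1%:P) ^+ (e i).
Proof.
move=> eI.
pose A : 'M[K]_N := \matrix_(i, l) (('X + 1%:P : {poly K}) ^+ (e i))`_l.
have uA : A \in unitmx.
  rewrite -row_free_unit; apply: inj_row_free => v vA.
  apply/rowP=> i; rewrite mxE; apply: (@sparse_sum_eq0 N e) => //.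
  rewrite -dvdp_shift; apply/dvdp_XnP=> l lt.
  have := congr1 (fun M : 'rV_N => M 0 (Ordinal lt)) vA; rewrite !mxE => {2}<-.
  rewrite rmorph_sum /= coef_sum; apply: eq_bigr => j _.
  by rewrite mxE comp_polyZ rmorphXn /= comp_polyX coefZ.
have [c cA] : exists c : 'rV_N, c *m A = \row_l p`_l.
  by exists ((\row_l p`_l : 'rV_N) *m invmx A); apply: mulmxKV.
exists (fun i => c 0 i); apply/dvdp_XnP=> l lt.
have := congr1 (fun M : 'rV_N => M 0 (Ordinal lt)) cA.
rewrite !mxE /= coefB => <-; apply/eqP; rewrite subr_eq0; apply/eqP.
rewrite coef_sum; apply: eq_bigr => j _.
by rewrite mxE coefZ.
Qed.

End CharacteristicZero.

(** * Monomials in three variables *)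

Definition mon (i j k : nat) : 'X_{1..3} := [multinom [tuple i; j; k]].

Definition lin (x y z : nat) (m : 'X_{1..3}) : nat :=
  (m 0%R * x + m 1%R * y + m 2%R * z)%N.

Lemma lift_ord3 :
  (lift ord0 ord0 = 1%R :> 'I_3) * (lift ord0 (lift ord0 ord0) = 2%R :> 'I_3).
Proof. by split; apply: val_inj. Qed.

Lemma monP (m : 'X_{1..3}) : m = mon (m 0%R) (m 1%R) (m 2%R).
Proof.
by apply/mnmP; case; case=> [|[|[|//]]] lt; rewrite [RHS]multinomE;
   congr (m _); apply: val_inj.
Qed.

Lemma eq_mon (m m' : 'X_{1..3}) :
  m 0%R = m' 0%R -> m 1%R = m' 1%R -> m 2%R = m' 2%R -> m = m'.
Proof. by move=> e0 e1 e2; rewrite (monP m) e0 e1 e2 -monP. Qed.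

Lemma monE i j k :
  (mon i j k 0%R = i) * (mon i j k 1%R = j) * (mon i j k 2%R = k).
Proof. by []. Qed.

Lemma mon_lem i j k (m : 'X_{1..3}) :
  (mon i j k <= m)%MM = [&& i <= m 0%R, j <= m 1%R & k <= m 2%R]%N.
Proof.
apply/mnm_lepP/and3P => [le|[le0 le1 le2]]; first by split; apply: le.
case; case=> [|[|[|//]]] lt.
- by rewrite (_ : Ordinal lt = 0) ?monE //; apply: val_inj.
- by rewrite (_ : Ordinal lt = 1) ?monE //; apply: val_inj.
by rewrite (_ : Ordinal lt = 2) ?monE //; apply: val_inj.
Qed.

Lemma linE x y z i j k : lin x y z (mon i j k) = (i * x + j * y + k * z)%N.
Proof. by []. Qed.

Lemma linD x y z m m' : lin x y z (m + m')%MM = (lin x y z m + lin x y z m')%N.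
Proof. by rewrite /lin !mnmDE; lia. Qed.

Lemma weighted_degreeE a b c m : weighted_degree a b c m = lin a b c m.
Proof.
rewrite /weighted_degree !big_ord_recl big_ord0 addn0 addnA !(tnth_nth 0%N) /=.
by rewrite lift_ord3.2 lift_ord3.1.
Qed.

Section Vars.

Variable K : fieldType.
Implicit Types h : {mpoly K[3]}.

Lemma mpolyX_mon i j k :
  'X_[mon i j k] = varx ^+ i * vary ^+ j * varz ^+ k :> {mpoly K[3]}.
Proof.
rewrite /varx /vary /varz !mpolyXn -!mpolyXD; congr 'X_[_].
apply: eq_mon; rewrite !mnmDE !mulmnE !mnm1E monE /=;
  by rewrite ?mul1n ?mul0n ?addn0.
Qed.

Lemma mpoly_linear_ind (P : {mpoly K[3]} -> Prop) h :
  P 0 -> (forall g g', P g -> P g' -> P (g + g')) ->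
  (forall e g, P g -> P (e *: g)) -> (forall m, m \in msupp h -> P 'X_[m]) -> P h.
Proof.
move=> P0 PD PZ PX; rewrite [h]mpolyE big_seq.
by apply: (big_ind P) => // m mh; apply: PZ; apply: PX.
Qed.

Lemma mcoeffXM (m k : 'X_{1..3}) h :
  ('X_[m] * h)@_k = if (m <= k)%MM then h@_(k - m) else 0.
Proof.
rewrite mulrC; case: ifP => le; first by rewrite -{1}(submK le) addmC mcoeffMX.
apply/eqP; rewrite mcoeff_eq0; apply/negP => /msuppM_le /allpairsP[[m1 m2] /= [_]].
rewrite msuppX inE => /eqP -> e.
by move: le; rewrite e lem_addl.
Qed.

End Vars.

Lemma coef_X1n (D : nzRingType) n i : (('X + 1%:P : {poly D}) ^+ n)`_i = 'C(n, i)%:R.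
Proof.
elim: n i => [|n IH] i; first by rewrite expr0 coef1 bin0n.
rewrite exprS mulrDl mul1r coefD coefXM !IH.
by case: i => [|i] /=; rewrite ?bin0 ?add0r // binS natrD addrC.
Qed.

(** * The local coordinates of the curve *)

Section LocalCoordinates.

Variables (K : fieldType) (a b c f1 f2 f3 p1 p2 p3 : nat).

Local Notation wt := (lin a b c).
Local Notation fd := (lin f1 f2 f3).
Local Notation pd := (lin p1 p2 p3).

(* A ring map sending the monomial [m] to [tau^wt (1 + V)^fd (1 + W)^pd], where
   [W] is the outer and [V] the inner polynomial variable. *)
Section Rho.

Variables (D : comNzRingType) (io : {rmorphism K -> D}) (tau : D).

Definition rho : {mpoly K[3]} -> {poly {poly D}} :=
  mmap (polyC \o polyC \o io) (fun i =>
    (tau ^+ tnth [tuple a; b; c] i)%:P%:P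
    * (('X + 1%:P) ^+ tnth [tuple f1; f2; f3] i)%:P
    * ('X + 1%:P) ^+ tnth [tuple p1; p2; p3] i).

HB.instance Definition _ := GRing.RMorphism.copy rho
  (mmap (polyC \o polyC \o io) (fun i =>
    (tau ^+ tnth [tuple a; b; c] i)%:P%:P
    * (('X + 1%:P) ^+ tnth [tuple f1; f2; f3] i)%:P
    * ('X + 1%:P) ^+ tnth [tuple p1; p2; p3] i)).

Lemma rhoX m : rho 'X_[m] =
  (tau ^+ wt m)%:P%:P * (('X + 1%:P) ^+ fd m)%:P * ('X + 1%:P) ^+ pd m.
Proof.
rewrite /rho mmapX /mmap1 !big_ord_recl big_ord0 /= mulr1 /lin.
rewrite !(tnth_nth 0%N) /= !(exprMn_comm _ (mulrC _ _)) -!exprM -!rmorphXn /=.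
rewrite -!exprM !exprD !rmorphM /=.
rewrite -![(m _ * _)%N]mulnC.
rewrite lift_ord3.2 lift_ord3.1.
ring.
Qed.

Lemma rhoZ e h : rho (e *: h) = (io e)%:P%:P * rho h.
Proof. by rewrite /rho mmapZ. Qed.

Lemma coef_rhoX m i j : (rho 'X_[m])`_i`_j =
  tau ^+ wt m * ('C(fd m, j) * 'C(pd m, i))%:R.
Proof.
rewrite rhoX -rmorphM coefCM coef_X1n [_ * 'C(pd m, i)%:R]mulr_natr coefMn coefCM coef_X1n.
by rewrite natrM mulrA mulr_natr.
Qed.

Lemma coef_rho h i j : (rho h)`_i`_j = \sum_(m <- msupp h)
  io h@_m * tau ^+ wt m * ('C(fd m, j) * 'C(pd m, i))%:R.
Proof.
rewrite {1}[h]mpolyE rmorph_sum /= !coef_sum; apply: eq_bigr => m _.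
by rewrite rhoZ !coefCM coef_rhoX mulrA.
Qed.

End Rho.

Definition rho1 := rho idfun (1 : K).

HB.instance Definition _ := GRing.RMorphism.copy rho1 (rho idfun (1 : K)).

Definition rhoT := rho polyC ('X : {poly K}).

HB.instance Definition _ := GRing.RMorphism.copy rhoT (rho polyC ('X : {poly K})).

(** In [rhoT] the powers of [tau] record the weighted degree, which [rho1] forgets by setting
    [tau = 1]. This is why orders can be tested on homogeneous components with [rho1]. *)
Lemma coef_rhoT h i j d :
  (rhoT h)`_i`_j`_d = (rho1 (pihomog (weighted_degree a b c) d h))`_i`_j.
Proof.
rewrite coef_rho coef_sum pihomogE rmorph_sum /= !coef_sum [RHS]big_mkcond /=.
apply: eq_bigr => m _; rewrite weighted_degreeE -mulrA coefCM mulr_natr coefMn coefXn.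
rewrite eq_sym; case: eqP => _; last by rewrite mul0rn mulr0.
by rewrite /rho1 rhoZ !coefCM coef_rhoX expr1n mul1r.
Qed.

Lemma ordge_rhoT n h : ordge n (rhoT h) <->
  forall d, ordge n (rho1 (pihomog (weighted_degree a b c) d h)).
Proof.
split=> [oh d i j lt|oh i j lt].
  by rewrite -coef_rhoT oh // coef0.
by apply/polyP=> d; rewrite coef_rhoT (oh d) // coef0.
Qed.

Lemma ordge_rhoT_homog n d h : h \is d.-homog for (weighted_degree a b c) ->
  ordge n (rhoT h) <-> ordge n (rho1 h).
Proof.
move=> hd; split=> [/ordge_rhoT/(_ d)|oh]; first by rewrite pihomog_dE.
apply/ordge_rhoT=> e; have [<-|ne] := eqVneq d e; first by rewrite pihomog_dE.
by rewrite (pihomog_ne0 ne hd) rmorph0; apply: ordge0.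
Qed.

Lemma rhoT00 h : (rhoT h)`_0`_0 = curve_morphism a b c h.
Proof.
rewrite coef_rho /curve_morphism /mmap; apply: eq_bigr => m _.
rewrite !bin0 mulr1; congr (_ * _).
rewrite /mmap1 !big_ord_recl big_ord0 !(tnth_nth 0%N) /= lift_ord3.2 lift_ord3.1.
by rewrite mulr1 -!exprM /lin !exprD mulrA ![(_ * m _)%N]mulnC.
Qed.

(* The restriction of [rho1] to [W = 0], written in the variable [1 + V]. *)
Definition pi0 : {mpoly K[3]} -> {poly K} :=
  mmap (@polyC K) (fun i => 'X^(tnth [tuple f1; f2; f3] i)).

HB.instance Definition _ := GRing.RMorphism.copy pi0
  (mmap (@polyC K) (fun i => 'X^(tnth [tuple f1; f2; f3] i))).

Lemma pi0X m : pi0 'X_[m] = 'X^(fd m).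
Proof.
rewrite /pi0 mmapX /mmap1 !big_ord_recl big_ord0 !(tnth_nth 0%N) /=.
rewrite lift_ord3.2 lift_ord3.1.
by rewrite mulr1 -!exprM /lin !exprD mulrA ![(_ * m _)%N]mulnC.
Qed.

Lemma pi0Z e h : pi0 (e *: h) = e *: pi0 h.
Proof. by rewrite /pi0 mmapZ mul_polyC. Qed.

Lemma pi0E h : pi0 h = \sum_(m <- msupp h) h@_m *: 'X^(fd m).
Proof.
by rewrite {1}[h]mpolyE rmorph_sum /=; apply: eq_bigr => m _; rewrite pi0Z pi0X.
Qed.

Lemma rho1_0 h : (rho1 h)`_0 = pi0 h \Po ('X + 1%:P).
Proof.
rewrite {1}[h]mpolyE rmorph_sum /= coef_sum pi0E rmorph_sum /=.
apply: eq_bigr => m _; rewrite /rho1 rhoZ coefCM rhoX /= comp_polyZ comp_Xn_poly.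
by rewrite expr1n !rmorph1 mul1r coefCM coef_X1n bin0 mulr1 mul_polyC.
Qed.

End LocalCoordinates.

(** * The negative curve *)

(* On [x, y, z] the functionals [f1, f2, f3] and [p1, p2, p3] form a dual basis of
   the degree-zero Laurent monomials [x^s / (y^t1 z^u1)] and
   [z^u / (x^s3 y^t3)]. *)
Record curve_data (a b c s t u t1 u1 s2 u2 s3 t3 f1 f2 f3 p1 p2 p3 : nat) : Prop :=
  CurveData {
    cd_a : (0 < a)%N; cd_b : (0 < b)%N; cd_c : (0 < c)%N; cd_u : (0 < u)%N;
    cd_t1 : (0 < t1)%N; cd_u1 : (0 < u1)%N; cd_s2 : (0 < s2)%N;
    cd_u2 : (0 < u2)%N; cd_s3 : (0 < s3)%N; cd_t3 : (0 < t3)%N;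
    cd_ab : coprime a b; cd_bc : coprime b c;
    cd_sa : (s * a = t1 * b + u1 * c)%N;
    cd_tb : (t * b = s2 * a + u2 * c)%N;
    cd_uc : (u * c = s3 * a + t3 * b)%N;
    cd_s : (s = s2 + s3)%N; cd_t : (t = t1 + t3)%N; cd_uE : (u = u1 + u2)%N;
    cd_aE : (a = t1 * u + u1 * t3)%N; cd_bE : (b = s2 * u + s3 * u2)%N;
    cd_f1s : (f1 * s = f2 * t1 + f3 * u1 + 1)%N;
    cd_f3u : (f3 * u = f1 * s3 + f2 * t3)%N;
    cd_p1s : (p1 * s = p2 * t1 + p3 * u1)%N;
    cd_p3u : (p3 * u = p1 * s3 + p2 * t3 + 1)%N;
    cd_neg : (u * u * c < a * b)%N }.

Section NegativeCurve.

Variables (K : fieldType).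
Variables (a b c s t u t1 u1 s2 u2 s3 t3 f1 f2 f3 p1 p2 p3 : nat).
Hypothesis E : curve_data a b c s t u t1 u1 s2 u2 s3 t3 f1 f2 f3 p1 p2 p3.

Local Notation wt := (lin a b c).
Local Notation fd := (lin f1 f2 f3).
Local Notation pd := (lin p1 p2 p3).
Local Notation wd := (weighted_degree a b c).
Local Notation pi0 := (@pi0 K f1 f2 f3).
Local Notation f := (varz ^+ u - varx ^+ s3 * vary ^+ t3 : {mpoly K[3]}).
Local Notation g1 := (varx ^+ s - vary ^+ t1 * varz ^+ u1 : {mpoly K[3]}).

(** In the dual basis, [x^b / y^a] has first coordinate [u]. So in degree [a b] the exponents [fd]
    of [y^a] and [x^b] are exactly [u] apart, the origin of the bound [d u / (a b)]. *)
Lemma cd_f1b : (f1 * b = f2 * a + u)%N.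
Proof.
have [e1 e2 e3 e4] := And4 (cd_aE E) (cd_bE E) (cd_f1s E) (cd_f3u E).
have e5 := cd_s E; have e6 := cd_uE E.
apply/eqP; rewrite -eqz_nat !(PoszD, PoszM); apply/eqP.
have E1 : a%:Z = t1%:Z * u%:Z + u1%:Z * t3%:Z by rewrite e1 PoszD !PoszM.
have E2 : b%:Z = s%:Z * u%:Z - s3%:Z * u1%:Z.
  by rewrite e2 e5 e6 !(PoszD, PoszM); ring.
have E3 : f1%:Z * s%:Z = f2%:Z * t1%:Z + f3%:Z * u1%:Z + 1.
  by rewrite -!PoszM e3.
have E4 : f3%:Z * u%:Z = f1%:Z * s3%:Z + f2%:Z * t3%:Z by rewrite -!PoszM e4.
rewrite E1 E2; transitivity (f1%:Z * s%:Z * u%:Z - f1%:Z * s3%:Z * u1%:Z); first by ring.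
rewrite E3; transitivity (f2%:Z * t1%:Z * u%:Z + (f3%:Z * u%:Z) * u1%:Z + u%:Z
  - f1%:Z * s3%:Z * u1%:Z); first by ring.
by rewrite E4; ring.
Qed.

Lemma cd_f3b : (f3 * b = f2 * c + s3)%N.
Proof.
have u0 := cd_u E; have e0 := cd_f1b.
have [e1 e2] := conj (cd_uc E) (cd_f3u E).
by apply/eqP; rewrite -(eqn_pmul2r u0); apply/eqP; nia.
Qed.

Lemma cd_f1c : (f1 * c = f3 * a + t3)%N.
Proof.
have u0 := cd_u E; have e0 := cd_f1b.
have [e1 e2] := conj (cd_uc E) (cd_f3u E).
by apply/eqP; rewrite -(eqn_pmul2r u0); apply/eqP; nia.
Qed.

(** At fixed weight, [fd] is least on powers of [y], and every [x] or [z] raises it; [lin_fd_x] is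
    the mirror image, with powers of [x] on top. *)
Lemma lin_fd_y m : (fd m * b = f2 * wt m + m 0%R * u + m 2%R * s3)%N.
Proof. by have [e1 e2] := conj cd_f1b cd_f3b; rewrite /lin; nia. Qed.

Lemma lin_fd_x m : (f1 * wt m = fd m * a + m 1%R * u + m 2%R * t3)%N.
Proof. by have [e1 e2] := conj cd_f1b cd_f1c; rewrite /lin; nia. Qed.

(** The difference of the exponent vectors has degree zero and is killed by the first functional, so
    it is a multiple of the vector of [f]. The entry of the latter at [z] is [u], too large for two
    exponents below [u]. *)
Lemma mon_eq_of_lin m m' : wt m = wt m' -> fd m = fd m' ->
  (m 2%R < u)%N -> (m' 2%R < u)%N -> m = m'.
Proof.
move=> ew ef lt lt'.
have := lin_fd_y m; have := lin_fd_x m; have := lin_fd_y m'; have := lin_fd_x m'.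
rewrite ew ef => ex' ey' ex ey.
have e2 : m 2%R = m' 2%R.
  have e := cd_p3u E.
  have : u%:Z * (m 0%R)%:Z - u%:Z * (m' 0%R)%:Z = (m' 2%R)%:Z * s3%:Z - (m 2%R)%:Z * s3%:Z by nia.
  have : u%:Z * (m 1%R)%:Z - u%:Z * (m' 1%R)%:Z = (m' 2%R)%:Z * t3%:Z - (m 2%R)%:Z * t3%:Z by nia.
  have E3 : p3%:Z * u%:Z = p1%:Z * s3%:Z + p2%:Z * t3%:Z + 1 by rewrite -!PoszM e.
  move=> I J; have {}e : (m 2%R)%:Z - (m' 2%R)%:Z =
     u%:Z * (p3%:Z * ((m 2%R)%:Z - (m' 2%R)%:Z) + p1%:Z * ((m 0%R)%:Z - (m' 0%R)%:Z)
       + p2%:Z * ((m 1%R)%:Z - (m' 1%R)%:Z)).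
    transitivity ((p3%:Z * u%:Z) * ((m 2%R)%:Z - (m' 2%R)%:Z)
      + p1%:Z * (u%:Z * (m 0%R)%:Z - u%:Z * (m' 0%R)%:Z)
      + p2%:Z * (u%:Z * (m 1%R)%:Z - u%:Z * (m' 1%R)%:Z)); last by ring.
    by rewrite E3 I J; ring.
  move: (_ + _ + _) e => q e; have [q0|q0] : q = 0 \/ `|q| >= 1 by lia.
    by move: e; rewrite q0 mulr0; lia.
  by clear - e q0 lt lt'; nia.
have u0 := cd_u E.
apply: eq_mon => //; apply/eqP; rewrite -(eqn_pmul2r u0); apply/eqP; rewrite e2 in ex ey; lia.
Qed.

Lemma fE : f = 'X_[mon 0 0 u] - 'X_[mon s3 t3 0].
Proof. by rewrite !mpolyX_mon !expr0 !mulr1 !mul1r. Qed.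

Lemma g1E : g1 = 'X_[mon s 0 0] - 'X_[mon 0 t1 u1].
Proof. by rewrite !mpolyX_mon !expr0 !mulr1 mul1r. Qed.

Lemma homogX d m : ('X_[m] : {mpoly K[3]}) \is d.-homog for wd = (wt m == d).
Proof. by rewrite dhomogX -weighted_degreeE. Qed.

Lemma f_homog : f \is (u * c)%N.-homog for wd.
Proof.
rewrite fE rpredB // homogX linE ?muln0 ?mul0n ?add0n ?addn0 //.
by rewrite (cd_uc E).
Qed.

Lemma pi0_f : pi0 f = 0.
Proof.
have v0 : fd (mon 0 0 u) = (f3 * u)%N by rewrite linE; lia.
have v1 : fd (mon s3 t3 0) = (f3 * u)%N by rewrite linE (cd_f3u E); lia.
by rewrite fE rmorphB /= (pi0X _ _ _ _ (mon 0 0 u)) (pi0X _ _ _ _ (mon s3 t3 0)) v0 v1 subrr.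
Qed.

Section RhoEq.

Variables (D : comNzRingType) (io : {rmorphism K -> D}) (tau : D).
Local Notation rho := (rho a b c f1 f2 f3 p1 p2 p3 io tau).

Lemma rho_f : rho f = (tau ^+ (u * c))%:P%:P * (('X + 1%:P) ^+ (f3 * u))%:P
  * ('X + 1%:P) ^+ (p1 * s3 + p2 * t3) * 'X.
Proof.
have w0 : wt (mon 0 0 u) = (u * c)%N by rewrite linE; lia.
have w1 : wt (mon s3 t3 0) = (u * c)%N by rewrite linE (cd_uc E); lia.
have v0 : fd (mon 0 0 u) = (f3 * u)%N by rewrite linE; lia.
have v1 : fd (mon s3 t3 0) = (f3 * u)%N by rewrite linE (cd_f3u E); lia.
have q0 : pd (mon 0 0 u) = (p1 * s3 + p2 * t3).+1.
  by rewrite linE -addn1 -(cd_p3u E); lia.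
have q1 : pd (mon s3 t3 0) = (p1 * s3 + p2 * t3)%N by rewrite linE; lia.
transitivity (rho 'X_[mon 0 0 u] - rho 'X_[mon s3 t3 0]).
  by rewrite fE; apply: rmorphB.
rewrite (rhoX a b c f1 f2 f3 p1 p2 p3 io tau (mon 0 0 u)).
rewrite (rhoX a b c f1 f2 f3 p1 p2 p3 io tau (mon s3 t3 0)) w0 w1 v0 v1 q0 q1.
by rewrite exprS -mulrBr mulrDl mul1r addrK mulrCA mulrC.
Qed.

Lemma rho_g1 : rho g1 = (tau ^+ (s * a))%:P%:P
  * (('X + 1%:P) ^+ (f2 * t1 + f3 * u1))%:P * ('X + 1%:P) ^+ (p1 * s) * ('X)%:P.
Proof.
have w0 : wt (mon s 0 0) = (s * a)%N by rewrite linE; lia.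
have w1 : wt (mon 0 t1 u1) = (s * a)%N by rewrite linE (cd_sa E); lia.
have v0 : fd (mon s 0 0) = (f2 * t1 + f3 * u1).+1.
  by rewrite linE -addn1 -(cd_f1s E); lia.
have v1 : fd (mon 0 t1 u1) = (f2 * t1 + f3 * u1)%N by rewrite linE; lia.
have q0 : pd (mon s 0 0) = (p1 * s)%N by rewrite linE; lia.
have q1 : pd (mon 0 t1 u1) = (p1 * s)%N by rewrite linE (cd_p1s E); lia.
transitivity (rho 'X_[mon s 0 0] - rho 'X_[mon 0 t1 u1]).
  by rewrite g1E; apply: rmorphB.
rewrite (rhoX a b c f1 f2 f3 p1 p2 p3 io tau (mon s 0 0)).
rewrite (rhoX a b c f1 f2 f3 p1 p2 p3 io tau (mon 0 t1 u1)) w0 w1 v0 v1 q0 q1.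
rewrite -mulrBl -mulrBr -rmorphB exprS mulrDl mul1r addrK rmorphM /=.
by rewrite mulrA [_ * 'X%:P * _]mulrAC [_ * 'X%:P * _]mulrAC.
Qed.

End RhoEq.

Definition z_reduced (h : {mpoly K[3]}) : Prop :=
  forall m : 'X_{1..3}, (u <= m 2%R)%N -> h@_m = 0.

Lemma z_reducedD h h' : z_reduced h -> z_reduced h' -> z_reduced (h + h').
Proof. by move=> zh zh' m le; rewrite mcoeffD zh ?zh' ?addr0. Qed.

Lemma z_reducedZ e h : z_reduced h -> z_reduced (e *: h).
Proof. by move=> zh m le; rewrite mcoeffZ zh ?mulr0. Qed.

Lemma z_reduced_supp h m : z_reduced h -> m \in msupp h -> (m 2%R < u)%N.
Proof.
by move=> zh; rewrite mcoeff_msupp; apply: contraR; rewrite -leqNgt => /zh ->.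
Qed.

(** Division by [f] through the rewriting [z^u -> x^s3 y^t3]. The degree of [g] is stated as
    [e + u c = d] to avoid a truncated subtraction when [d < u c]. *)
Lemma z_reduction d h : h \is d.-homog for wd -> exists g r,
  [/\ h = f * g + r, r \is d.-homog for wd, z_reduced r
    & forall e, (e + u * c = d)%N -> g \is e.-homog for wd].
Proof.
move=> hd; move: (hd); apply: (@mpoly_linear_ind _ (fun h' => h \is d.-homog for wd ->
   exists g r, [/\ h' = f * g + r, r \is d.-homog for wd, z_reduced r
    & forall e, (e + u * c = d)%N -> g \is e.-homog for wd])).
- move=> _; exists 0, 0; split; rewrite ?mulr0 ?addr0 ?rpred0 //.
    by move=> m _; rewrite mcoeff0.
  by move=> e _; rewrite rpred0.
- move=> h1 h2 IH1 IH2 _; have [g [r [-> rd rz gd]]] := IH1 hd.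
  have [g' [r' [-> r'd r'z g'd]]] := IH2 hd.
  exists (g + g'), (r + r'); split; first by rewrite mulrDr addrACA.
  + by rewrite rpredD.
  + exact: z_reducedD.
  + by move=> e ee; rewrite rpredD ?gd ?g'd.
- move=> e h1 IH _; have [g [r [-> rd rz gd]]] := IH hd.
  exists (e *: g), (e *: r); split; first by rewrite scalerDr scalerAr.
  + by rewrite dhomogZ.
  + exact: z_reducedZ.
  + by move=> e' ee; rewrite dhomogZ ?gd.
move=> m mh _; have wm : wt m = d by rewrite -weighted_degreeE; apply: (dhomog_mf hd).
have [n] := ubnP (m 2%R); elim: n m wm {mh} => // n IH m wm ltm.
have [lt|le] := ltnP (m 2%R) u.
  exists 0, 'X_[m]; split; rewrite ?mulr0 ?add0r //.
  + by rewrite homogX wm.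
  + move=> k le; rewrite mcoeffX; case: eqP => // e.
    by move: le; rewrite -e leqNgt lt.
  + by move=> e _; rewrite rpred0.
pose m1 := (m - mon 0 0 u)%MM; pose m2 := (mon s3 t3 0 + m1)%MM.
have lem : (mon 0 0 u <= m)%MM by rewrite mon_lem.
have em : m = (mon 0 0 u + m1)%MM by rewrite addmC submK.
have wm1 : (wt m1 + u * c = d)%N by rewrite -wm em linD linE; lia.
have wm2 : wt m2 = d.
  by rewrite linD linE -wm1 (cd_uc E); lia.
have u0 := cd_u E.
have [|g [r [e rd rz gd]]] := IH m2 wm2.
  by move: ltm; rewrite /m2 em !mnmDE !monE; lia.
exists ('X_[m1] + g), r; split=> //.
  by rewrite mulrDr -addrA -e fE mulrBl -!mpolyXD -em subrK.
move=> e' ee; rewrite rpredD ?gd // homogX; lia.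
Qed.

(** By [mon_eq_of_lin], distinct reduced monomials of one degree have distinct images, so no
    cancellation occurs under [pi0]. *)
Lemma pi0_coef d h m : h \is d.-homog for wd -> z_reduced h ->
  wt m = d -> (m 2%R < u)%N -> (pi0 h)`_(fd m) = h@_m.
Proof.
move=> hd hz wm ltm; rewrite pi0E coef_sum.
have other m' : m' \in msupp h -> m' != m -> (h@_m' *: 'X^(fd m'))`_(fd m) = 0.
  move=> m'h ne; rewrite coefZ coefXn; case: eqP => [ef|]; last by rewrite mulr0.
  case/eqP: ne; apply: mon_eq_of_lin => //; last exact: z_reduced_supp m'h.
  by rewrite wm -weighted_degreeE (dhomog_mf hd).
have [mh|mh] := boolP (m \in msupp h).
  rewrite (bigD1_seq m) ?msupp_uniq //= coefZ coefXn eqxx mulr1 big_seq_cond big1 ?addr0 //.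
  by move=> m' /andP[]; apply: other.
rewrite big_seq big1 ?(memN_msupp_eq0 mh) // => m' m'h.
by apply: other => //; apply: contraNneq mh => <-.
Qed.

Lemma pi0_inj d h : h \is d.-homog for wd -> z_reduced h -> pi0 h = 0 -> h = 0.
Proof.
move=> hd hz h0; apply/mpolyP=> m; rewrite mcoeff0.
have [mh|] := boolP (m \in msupp h); last exact: memN_msupp_eq0.
rewrite -(pi0_coef hd hz) ?h0 ?coef0 //; last exact: z_reduced_supp mh.
by rewrite -weighted_degreeE (dhomog_mf hd).
Qed.

Lemma dvd_f_of_pi0 d h : h \is d.-homog for wd -> pi0 h = 0 ->
  exists2 g, h = f * g & forall e, (e + u * c = d)%N -> g \is e.-homog for wd.
Proof.
move=> hd h0; have [g [r [e rd rz gd]]] := z_reduction hd.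
exists g => //; rewrite e [r](pi0_inj rd rz) ?addr0 //.
by move: h0; rewrite e rmorphD rmorphM /= pi0_f mul0r add0r.
Qed.

End NegativeCurve.

(** * Symbolic powers as orders of vanishing *)

Lemma is_ideal_pow (R : comNzRingType) (I : {pred R}) n : is_ideal (ideal_pow I n).
Proof. exact: is_ideal_gen. Qed.

Lemma ideal_pow0 (R : comNzRingType) (I : {pred R}) h : h \in ideal_pow I 0.
Proof.
rewrite -[h]mulr1; apply: ideal_genM; apply: mem_ideal_gen; apply/asboolP.
by exists [::]; rewrite ?big_nil.
Qed.

Lemma ideal_pow1 (R : comNzRingType) (I : {pred R}) h : h \in I -> h \in ideal_pow I 1.
Proof.
move=> hI; apply: mem_ideal_gen; apply/asboolP; exists [:: h]; rewrite ?big_seq1 //.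
by split=> // g; rewrite inE => /eqP ->.
Qed.

Lemma ideal_powX (R : comNzRingType) (I : {pred R}) h n :
  h \in I -> h ^+ n \in ideal_pow I n.
Proof.
move=> hI; elim: n => [|n IH]; first exact: ideal_pow0.
by rewrite exprS -add1n; apply: ideal_powM => //; apply: ideal_pow1.
Qed.

Lemma symbolic_powerP (R : idomainType) (P : prime_idealr R) n h :
  h \in symbolic_power P n <-> exists2 v, v \notin P & v * h \in ideal_pow P n.
Proof.
have [_ powD powM] := is_ideal_pow P n.
rewrite /symbolic_power unfold_in; split=> [/asboolP[w wP e]|[v vP vh]].
  suff [v vP [i iP ei]] : exists2 v, v \notin P & exists2 i, i \in ideal_pow P n &
      tofrac v * \sum_(z <- w) z.1 * tofrac z.2 = tofrac i :> {fraction R}.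
    exists v => //; rewrite (_ : v * h = i) //.
    by apply/eqP; rewrite -tofrac_eq tofracM e ei.
  elim: w wP {e} => [|z w IH] wP.
    exists 1; first by rewrite idealr1.
    by exists 0; [exact: ideal_gen0|rewrite big_nil mulr0 tofrac0].
  have [|v vP [i iP ei]] := IH; first by move=> y yw; apply: wP; rewrite inE yw orbT.
  have [/asboolP[x [y [yP ez]]] z2] := wP z (mem_head _ _).
  exists (y * v); first by rewrite prime_idealrM negb_or yP.
  exists (v * x * z.2 + y * i); first by apply: powD; apply: powM.
  have y0 : tofrac y != 0 :> {fraction R}.
    by rewrite tofrac_eq0; apply: contraNneq yP => ->; rewrite rpred0.
  rewrite big_cons mulrDr tofracM -[X in _ + X]mulrA ei ez tofracD !tofracM; congr (_ + _).
  rewrite mulrA; congr (_ * _); rewrite [tofrac y * _]mulrC -mulrA; congr (_ * _).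
  by rewrite mulrCA divff // mulr1.
have v0 : tofrac v != 0 :> {fraction R}.
  by rewrite tofrac_eq0; apply: contraNneq vP => ->; rewrite rpred0.
rewrite -[tofrac h](mulKf v0) -tofracM; apply: localized_idealM.
  by apply/asboolP; exists 1, v; rewrite tofrac1 div1r.
exact: localized_ideal_gen.
Qed.

Section SymbolicPower.

Variables (K : fieldType).
Variables (a b c s t u t1 u1 s2 u2 s3 t3 f1 f2 f3 p1 p2 p3 : nat).
Hypothesis E : curve_data a b c s t u t1 u1 s2 u2 s3 t3 f1 f2 f3 p1 p2 p3.

Local Notation rhoT := (@rhoT K a b c f1 f2 f3 p1 p2 p3).
Local Notation P := (monomial_prime K a b c).
Local Notation f := (varz ^+ u - varx ^+ s3 * vary ^+ t3 : {mpoly K[3]}).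
Local Notation g1 := (varx ^+ s - vary ^+ t1 * varz ^+ u1 : {mpoly K[3]}).
Local Notation g2 := (vary ^+ t - varx ^+ s2 * varz ^+ u2 : {mpoly K[3]}).

Hypothesis genP : ideal_gen (mem [:: g1; g2; f]) =i P.

Lemma mem_prime_rhoT h : (h \in P) = ((rhoT h)`_0`_0 == 0).
Proof. by rewrite unfold_in rhoT00. Qed.

Lemma prime_ordge h : h \in P -> ordge 1 (rhoT h).
Proof. by rewrite mem_prime_rhoT => /eqP h0 [|i] [|j]. Qed.

Lemma varx_notin_prime n : varx ^+ n \notin P.
Proof.
have [ex _ _] := curve_morphism_var K a b c.
by rewrite unfold_in rmorphXn /= ex expf_neq0 // expf_neq0 // polyX_eq0.
Qed.

(* The Hilbert-Burch relation [z^u2 g1 + x^s3 g2 + y^t1 f = 0] eliminates [g2]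
   away from [x = 0]. *)
Lemma prime_local_gen q : q \in P -> exists A B, varx ^+ s3 * q = A * g1 + B * f.
Proof.
rewrite -genP => /ideal_gen3P[x1 [x2 [x3 ->]]].
exists (x1 * varx ^+ s3 - x2 * varz ^+ u2), (x3 * varx ^+ s3 - x2 * vary ^+ t1).
by rewrite (cd_s E) (cd_t E) (cd_uE E) !exprD; ring.
Qed.

(** Each factor of a product of [n] elements of [P] absorbs one [x^s3] and becomes a combination of
    [g1] and [f]. Away from [x = 0] the powers of [P] are thus those of a two-generated ideal. *)
Lemma ideal_pow_local_gen n h : h \in ideal_pow P n ->
  exists N (C : nat -> {mpoly K[3]}),
    varx ^+ N * h = \sum_(i < n.+1) C i * g1 ^+ (n - i) * f ^+ i.
Proof.
move=> hP.
suff : exists N, exists C : nat -> {mpoly K[3]},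
    varx ^+ N * h = \sum_(i < n.+1) C i * g1 ^+ (n - i) * f ^+ i by [].
exists (s3 * n)%N.
pose Q k h := exists C : nat -> {mpoly K[3]},
    varx ^+ (s3 * k) * h = \sum_(i < k.+1) C i * g1 ^+ (k - i) * f ^+ i.
rewrite -/(Q n h).
have Q0 k : Q k 0.
  by exists (fun=> 0); rewrite mulr0 big1 // => i _; rewrite !mul0r.
have QD k h1 h2 : Q k h1 -> Q k h2 -> Q k (h1 + h2).
  move=> [C1 e1] [C2 e2]; exists (fun i => C1 i + C2 i).
  by rewrite mulrDr e1 e2 -big_split; apply: eq_bigr => i _; rewrite !mulrDl.
have QM k e h1 : Q k h1 -> Q k (e * h1).
  move=> [C1 e1]; exists (fun i => e * C1 i).
  by rewrite mulrCA e1 mulr_sumr; apply: eq_bigr => i _; rewrite !mulrA.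
case/ideal_genP: hP => w wP ->.
rewrite big_seq; apply: (big_ind (Q n)); first exact: Q0; first exact: QD.
move=> z /wP /asboolP[l [sl lP] ->]; apply: QM.
elim: l n sl lP {w wP h} => [|q l IH] n <- lP.
  by exists (fun=> 1); rewrite big_nil muln0 expr0 big_ord_recl big_ord0 !expr0 !mulr1 addr0.
have [|C e] := IH (size l) erefl; first by move=> y yl; apply: lP; rewrite inE yl orbT.
have [A [B eq]] := prime_local_gen (lP q (mem_head _ _)).
rewrite big_cons /=.
(* Multiplication by [A g1 + B f]: the part with [A] keeps the exponent of [f], and the part with
   [B] raises it by one. *)
exists (fun i => (if (i <= size l)%N then A * C i else 0) +
                 (if i is j.+1 then B * C j else 0)).
rewrite mulnS exprD mulrACA eq e mulrDl.
under [RHS]eq_bigr do rewrite !mulrDl.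
rewrite big_split /=; congr (_ + _).
  rewrite [RHS]big_ord_recr /= ltnn !mul0r addr0 mulr_sumr; apply: eq_bigr => i _.
  have lei : (i <= size l)%N by rewrite -ltnS.
  by rewrite lei subSn // exprS; ring.
rewrite [RHS]big_ord_recl /= !mul0r add0r mulr_sumr; apply: eq_bigr => i _.
by rewrite /bump /= add1n subSS exprS; ring.
Qed.

(** For the converse, induct on [n] and expand a multiple of [h] in products of degree [n] in [g1]
    and [f]. These are [V] and [W] times factors with nonzero constant term, so order [n + 1] forces
    the constant term of each coefficient [C i] to vanish, which puts [C i] in [P]. *)
Lemma symbolic_power_ordge n h : h \in symbolic_power P n <-> ordge n (rhoT h).
Proof.
split=> [/symbolic_powerP[v vP vh]|].
  have v0 : (rhoT v)`_0`_0 != 0 by rewrite -mem_prime_rhoT.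
  apply: (ordge_mulKl v0); rewrite -rmorphM.
  case/ideal_genP: vh => w wP ->; rewrite rmorph_sum big_seq.
  apply: ordge_sum => z /wP /asboolP[l [<- lP] e].
  rewrite rmorphM -[size l]add0n; apply: ordgeM => //; rewrite {}e.
  elim: l lP => [|q l IH] lP; first by rewrite big_nil.
  rewrite big_cons rmorphM -[size _]/(1 + size l)%N; apply: ordgeM.
    by apply: prime_ordge; apply: lP; apply: mem_head.
  by apply: IH => y yl; apply: lP; rewrite inE yl orbT.
have [g1P _ fP] := mem_ideal_gen3 g1 g2 f; rewrite !genP in g1P fP.
elim: n => [_|n IH on].
  apply/symbolic_powerP; exists 1; first by rewrite idealr1.
  exact: ideal_pow0.
have /symbolic_powerP[v vP vh] := IH (ordge_le (leqnSn n) on).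
have [N [C e]] := ideal_pow_local_gen vh.
have rM x y : rhoT (x * y) = rhoT x * rhoT y by exact: rmorphM.
have rX x k : rhoT (x ^+ k) = rhoT x ^+ k by exact: rmorphXn.
pose U1 := ('X ^+ (s * a))%:P%:P
  * (('X + 1%:P) ^+ (f2 * t1 + f3 * u1))%:P * ('X + 1%:P) ^+ (p1 * s)
  : {poly {poly {poly K}}}.
pose U3 := ('X ^+ (u * c))%:P%:P * (('X + 1%:P) ^+ (f3 * u))%:P
  * ('X + 1%:P) ^+ (p1 * s3 + p2 * t3) : {poly {poly {poly K}}}.
have e1 : rhoT g1 = U1 * 'X%:P by exact: (rho_g1 E).
have e3 : rhoT f = U3 * 'X by exact: (rho_f E).
have U10 : U1`_0`_0 != 0.
  rewrite /U1 !(coef0M, coefC) /= !coef_X1n !bin0 !mulr1.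
  by rewrite ?(coef0M, coefC, coef1) /= ?mulr1 expf_neq0 // polyX_eq0.
have U30 : U3`_0`_0 != 0.
  rewrite /U3 !(coef0M, coefC) /= !coef_X1n !bin0 !mulr1.
  by rewrite ?(coef0M, coefC, coef1) /= ?mulr1 expf_neq0 // polyX_eq0.
have CP i : (i < n.+1)%N -> C i \in P.
  move=> lt; rewrite mem_prime_rhoT; set w := (rhoT (C i))`_0`_0.
  have oh : ordge n.+1 (rhoT (varx ^+ N * (v * h))).
    have -> : rhoT (varx ^+ N * (v * h)) = rhoT (varx ^+ N * v) * rhoT h.
      by rewrite -rM mulrA.
    by apply: (@ordgeM _ 0 n.+1) on.
  pose G k := rhoT (C k) * U1 ^+ (n - k) * U3 ^+ k.
  have eG : rhoT (varx ^+ N * (v * h)) =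
      \sum_(k < n.+1) G k * ('X^(n - k))%:P * 'X^k.
    rewrite e rmorph_sum; apply: eq_bigr => k _.
    transitivity (rhoT (C k) * rhoT g1 ^+ (n - k) * rhoT f ^+ k).
      by rewrite -[LHS]/(rhoT (C k * g1 ^+ (n - k) * f ^+ k)) 2!rM 2!rX.
    rewrite e1 e3 (exprMn _ U1) (exprMn _ U3) -polyC_exp 2!mulrA /G.
    by rewrite [_ * ('X^(n - k))%:P * _]mulrAC.
  (* The coefficient of [V^(n - i) W^i] sees only the summand [i]: every other summand is divisible
     by a different monomial of total degree [n]. *)
  have := oh i (n - i)%N; rewrite subnKC // ltnSn => /(_ isT).
  rewrite eG !coef_sum (bigD1 (Ordinal lt)) //= big1 => [|k ki]; last first.
    rewrite coef_mulXX ifT //.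
    move: ki; rewrite -val_eqE /= neq_ltn; have := ltn_ord k; lia.
  rewrite addr0 coef_mulXX /= !ltnn /= !subnn /G !coef0M.
  have U0X (U : {poly {poly {poly K}}}) k : U`_0`_0 != 0 -> (U ^+ k)`_0`_0 != 0.
    move=> U0; elim: k => [|k IHk]; first by rewrite expr0 !coef1 /= oner_eq0.
    by rewrite exprS !coef0M mulf_neq0.
  by rewrite -/w => /eqP; rewrite !mulf_eq0 (negPf (U0X _ _ U10)) (negPf (U0X _ _ U30)) !orbF.
apply/symbolic_powerP; exists (varx ^+ N * v).
  by rewrite prime_idealrM negb_or vP varx_notin_prime.
rewrite -mulrA e; apply: (is_ideal_sum (is_ideal_pow _ _)) => i _.
case: i => i lt /=.
have -> : n.+1 = (1 + ((n - i) + i))%N by rewrite subnK ?add1n // -ltnS.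
rewrite -mulrA; apply: ideal_powM; first by apply: ideal_pow1; apply: CP.
by apply: ideal_powM; apply: ideal_powX.
Qed.

End SymbolicPower.

(** * Restriction to the negative curve *)

Lemma coprime_residue (a b x y x' y' : nat) : coprime a b ->
  (x * a + y * b = x' * a + y' * b)%N -> (y < a)%N -> (y' < a)%N -> y = y'.
Proof.
move=> cab; wlog le : x y x' y' / (y <= y')%N => [W|e lty lty'].
  move=> e lt lt'; have [le|/ltnW le] := leqP y y'; first exact: (W x y x' y').
  by apply/esym; apply: (W x' y' x y).
apply/eqP; rewrite eqn_leq le /= leqNgt; apply/negP => lt.
have : (a %| (y' - y) * b)%N by apply/dvdnP; exists (x - x')%N; rewrite !mulnBl; lia.
by rewrite Gauss_dvdl // => /dvdn_leq; lia.
Qed.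

Section Restriction.

Variables (K : fieldType) (hK : [pchar K] =i pred0).
Variables (a b c s t u t1 u1 s2 u2 s3 t3 f1 f2 f3 p1 p2 p3 : nat).
Hypothesis E : curve_data a b c s t u t1 u1 s2 u2 s3 t3 f1 f2 f3 p1 p2 p3.

Local Notation wt := (lin a b c).
Local Notation fd := (lin f1 f2 f3).
Local Notation wd := (weighted_degree a b c).
Local Notation pi0 := (@pi0 K f1 f2 f3).
Local Notation f := (varz ^+ u - varx ^+ s3 * vary ^+ t3 : {mpoly K[3]}).

Lemma homog_wt d (h : {mpoly K[3]}) m :
  h \is d.-homog for wd -> m \in msupp h -> wt m = d.
Proof. by move=> hd mh; rewrite -weighted_degreeE (dhomog_mf hd). Qed.

Lemma pi0_supp (h : {mpoly K[3]}) e : (pi0 h)`_e != 0 ->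
  exists2 m, m \in msupp h & fd m = e.
Proof.
move=> nz; have [[m mh me]|no] := pselect (exists2 m, m \in msupp h & fd m = e).
  by exists m.
case/eqP: nz; rewrite pi0E coef_sum big_seq big1 // => m mh.
rewrite coefZ coefXn; case: eqP => [em|]; last by rewrite mulr0.
by case: no; exists m.
Qed.

Lemma poly_low_factor (p : {poly K}) : p != 0 -> exists e q,
  [/\ p = q * 'X^e, q`_0 != 0 & p`_e != 0].
Proof.
move=> p0; have ex : exists k, p`_k != 0.
  by exists (size p).-1; rewrite -lead_coefE lead_coef_eq0.
case: (ex_minnP ex) => e pe min; exists e, (drop_poly e p).
rewrite coef_drop_poly add0n; split=> //.
rewrite -[LHS](poly_take_drop e) [take_poly e p](_ : _ = 0) ?add0r //.
apply/polyP=> i; rewrite coef_take_poly coef0; case: ltnP => // lt.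
by apply: contraTeq lt => /min; rewrite -leqNgt.
Qed.

(* The exponents occurring in [pi0 h] fill an interval of length at most
   [d u / (a b)]. *)
Lemma pi0_range d n (h : {mpoly K[3]}) : h \is d.-homog for wd -> pi0 h != 0 ->
  ('X - 1%:P) ^+ n %| pi0 h -> exists e q (m m' : 'X_{1..3}),
  [/\ pi0 h = q * 'X^e, ('X - 1%:P) ^+ n %| q, wt m = d, wt m' = d
    & [/\ fd m = e, fd m' = (e + (size q).-1)%N & (n < size q)%N]].
Proof.
move=> hd h0 dvd; have [e [q [ep q0 pe]]] := poly_low_factor h0.
have dq : ('X - 1%:P) ^+ n %| q.
  by move: dvd; rewrite ep Gauss_dvdpl // coprime_Xsub1.
have qn0 : q != 0 by apply: contraNneq q0 => ->; rewrite coef0.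
have [m mh em] := pi0_supp pe.
have [|m' m'h em'] := @pi0_supp h (e + (size q).-1)%N.
  by rewrite ep coefMXn ltnNge leq_addr /= addKn -lead_coefE lead_coef_eq0.
exists e, q, m, m'; split=> //; [exact: homog_wt hd mh|exact: homog_wt hd m'h|].
by split=> //; have := dvdp_leq qn0 dq; rewrite size_exp_XsubC.
Qed.

Lemma order_bound d n (h : {mpoly K[3]}) : h \is d.-homog for wd -> pi0 h != 0 ->
  ('X - 1%:P) ^+ n %| pi0 h -> (n * (a * b) <= d * u)%N.
Proof.
move=> hd h0 dvd.
have [e [q [m [m' [_ _ wm wm' [em em' lt]]]]]] := pi0_range hd h0 dvd.
have := lin_fd_y E m; have := lin_fd_x E m'; rewrite wm wm' em em' => e1 e2.
have e3 := cd_f1b E.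
have : ((e + (size q).-1) * (a * b) <= f1 * d * b)%N by rewrite e1; nia.
have : (f2 * d * a <= e * (a * b))%N by nia.
have : (n * (a * b) <= (size q).-1 * (a * b))%N by rewrite leq_mul2r; lia.
by nia.
Qed.

(** Equality in [order_bound] forces the two extreme monomials to be pure powers of [y] and of [x],
    so [a b] divides [d]. It also leaves no room for a further factor besides [(X - 1)^n] and a
    power of [X]. *)
Lemma order_exact d n (h : {mpoly K[3]}) : h \is d.-homog for wd -> pi0 h != 0 ->
  ('X - 1%:P) ^+ n %| pi0 h -> (d * u = n * (a * b))%N -> exists m lambda,
  [/\ d = (a * b * m)%N, n = (u * m)%N, lambda != 0
    & pi0 h = lambda *: ('X^(f2 * (a * m)) * ('X - 1%:P) ^+ (u * m))].
Proof.
move=> hd h0 dvd edn.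
have [e [q [m [m' [eh dq wm wm' [em em' lt]]]]]] := pi0_range hd h0 dvd.
have := lin_fd_y E m; have := lin_fd_x E m'; rewrite wm wm' em em' => e1 e2.
have e3 := cd_f1b E; have [u0 s0 t0 a0] := And4 (cd_u E) (cd_s3 E) (cd_t3 E) (cd_a E).
have b0 := cd_b E.
(* The two extra terms are the slacks of [lin_fd_x] at the top monomial and of [lin_fd_y] at the
   bottom one; equality makes both zero. *)
have key : ((size q).-1 * (a * b) + b * (m' 1%R * u + m' 2%R * t3)
   + a * (m 0%R * u + m 2%R * s3) = d * u)%N.
  by apply: (@addnI (e * (a * b) + f2 * d * a)%N); nia.
have le : (n * (a * b) <= (size q).-1 * (a * b))%N by rewrite leq_mul2r; lia.
have [z1 z2] : (b * (m' 1%R * u + m' 2%R * t3) = 0 /\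
   a * (m 0%R * u + m 2%R * s3) = 0)%N by lia.
have sq : (size q).-1 = n.
  have ab0 : (0 < a * b)%N by rewrite muln_gt0 a0.
  by apply/eqP; rewrite -(eqn_pmul2r ab0); apply/eqP; lia.
move: z1 z2 => /eqP + /eqP.
rewrite !muln_eq0 !addn_eq0 !muln_eq0 -!leqn0 ![(_ <= 0)%N]leqNgt a0 b0 u0 s0 t0 /= !orbF.
rewrite -!leqNgt !leqn0 => /andP[/eqP z1 /eqP z2] /andP[/eqP z3 /eqP z4].
have ex : (m' 0%R * a = d)%N by rewrite -wm' /lin z1 z2; lia.
have ey : (m 1%R * b = d)%N by rewrite -wm /lin z3 z4; lia.
have [k ek] : exists k, (m 1%R = a * k)%N.
  have : (a %| m 1%R * b)%N by rewrite ey -ex dvdn_mull.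
  by rewrite Gauss_dvdl ?(cd_ab E) // => /dvdnP[k ->]; exists k; rewrite mulnC.
have ed : d = (a * b * k)%N by rewrite -ey ek; lia.
have en : n = (u * k)%N.
  have ab0 : (0 < a * b)%N by rewrite muln_gt0 a0.
  by apply/eqP; rewrite -(eqn_pmul2r ab0) -edn ed; apply/eqP; lia.
have ee : e = (f2 * (a * k))%N by rewrite -em /lin z3 z4 ek; lia.
have q0 : q != 0 by rewrite -size_poly_gt0; lia.
case/dvdpP: dq => r er.
have r0 : r != 0 by apply: contraNneq q0 => r0; rewrite er r0 mul0r.
have : size q = (size r + n)%N.
  by rewrite er size_Mmonic ?monic_exp ?monicXsubC // size_exp_XsubC addnS.
move=> sqr; have /eqP/size_poly1P[l l0 el] : size r = 1%N by lia.
exists k, l; split=> //; rewrite eh er el ee -en mul_polyC -scalerAl.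
by rewrite mulrC.
Qed.

(** By [lin_fd_y], the power of [y] is the only monomial of its degree with the least exponent.
    Hence [pi0] detects whether it occurs. *)
Lemma pi0_lowcoef n (h : {mpoly K[3]}) : h \is (a * b * n)%N.-homog for wd ->
  (pi0 h)`_(f2 * (a * n)) = h@_(mon 0 (a * n) 0).
Proof.
move=> hd; set m0 := mon 0 (a * n) 0.
have other m : m \in msupp h -> m != m0 -> (h@_m *: 'X^(fd m))`_(f2 * (a * n)) = 0.
  move=> mh ne; rewrite coefZ coefXn; case: eqP => [ef|]; last by rewrite mulr0.
  have wm := homog_wt hd mh; have := lin_fd_y E m; rewrite wm -ef.
  have [u0 s0 b0] := And3 (cd_u E) (cd_s3 E) (cd_b E).
  move=> e; have e0 : (m 0%R * u + m 2%R * s3 = 0)%N by lia.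
  have m0_0 : m 0%R = 0%N by nia.
  have m2_0 : m 2%R = 0%N by nia.
  case/eqP: ne; apply: eq_mon; rewrite monE //.
  apply/eqP; rewrite -(eqn_pmul2r b0); apply/eqP.
  by move: wm; rewrite /lin m0_0 m2_0; lia.
have fm0 : fd m0 = (f2 * (a * n))%N by rewrite linE; lia.
rewrite pi0E coef_sum; have [mh|mh] := boolP (m0 \in msupp h).
  rewrite (bigD1_seq m0) ?msupp_uniq //= coefZ coefXn fm0 eqxx mulr1.
  by rewrite big_seq_cond big1 ?addr0 // => m /andP[]; apply: other.
rewrite big_seq big1 ?(memN_msupp_eq0 mh) // => m mh'.
by apply: other => //; apply: contraNneq mh => <-.
Qed.

Lemma coef_fM_y j (g : {mpoly K[3]}) : (f * g)@_(mon 0 j 0) = 0.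
Proof.
have [u0 s0] := conj (cd_u E) (cd_s3 E).
rewrite fE mulrBl mcoeffB !mcoeffXM !mon_lem !monE.
by rewrite [(u <= 0)%N]leqNgt u0 [(s3 <= 0)%N]leqNgt s0 /= subrr.
Qed.

Lemma b_ge_u : (u <= b)%N.
Proof.
rewrite (cd_bE E); have := cd_s2 E; have := cd_u E.
by move=> u0 s20; apply: leq_trans (leq_addr _ _); rewrite leq_pmull.
Qed.

(** * Division by [eta] modulo [f] *)

Section Division.

Variable eta : {mpoly K[3]}.
Hypothesis eta_homog : eta \is (a * b)%N.-homog for wd.
Hypothesis eta_y : eta@_(mon 0 a 0) != 0.
Hypothesis eta_order : ('X - 1%:P) ^+ u %| pi0 eta.

(* Modulo [f] and [x], [eta] is a nonzero multiple of [y^a]. *)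
Let eta_reduced : exists r : {mpoly K[3]}, [/\ pi0 eta = pi0 r,
  r \is (a * b)%N.-homog for wd, r@_(mon 0 a 0) != 0
  & forall m, m \in msupp r -> m != mon 0 a 0 -> (0 < m 0%R)%N].
Proof.
have [g [r [e rd rz _]]] := z_reduction E eta_homog.
exists r; split=> //.
- by rewrite e rmorphD rmorphM /= (pi0_f K E) mul0r add0r.
- by move: eta_y; rewrite e mcoeffD coef_fM_y add0r.
move=> m mr; rewrite lt0n; apply: contraNneq => m00.
have lt := z_reduced_supp rz mr; have wm := homog_wt rd mr.
have eq : (m 1%R * b + m 2%R * c = a * b)%N by rewrite -wm /lin m00; lia.
have dvdb : (b %| m 2%R)%N.
  rewrite -(@Gauss_dvdl b (m 2%R) c) ?(cd_bc E) //.
  by rewrite -(@dvdn_addr (m 1%R * b)) ?dvdn_mull // eq dvdn_mull.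
have m20 : m 2%R = 0%N.
  by case: (posnP (m 2%R)) => // m2; have := dvdn_leq m2 dvdb; have := b_ge_u; lia.
apply/eqP; apply: eq_mon; rewrite monE //.
have b0 := cd_b E; apply/eqP; rewrite -(eqn_pmul2r b0); apply/eqP; lia.
Qed.

(** Two rewritings are applied: [z^u] by [f], and [y^a] by the reduced form of [eta], all of whose
    other terms contain [x]. Both raise the exponent of [x], which is at most [d] in degree [d], so
    the process stops. *)
Lemma eta_remainder d (h : {mpoly K[3]}) : h \is d.-homog for wd -> exists G R,
  [/\ pi0 h = pi0 eta * pi0 G + pi0 R, G \is (d - a * b)%N.-homog for wd,
      R \is d.-homog for wd, z_reduced u R
    & forall m, m \in msupp R -> (m 1%R < a)%N].
Proof.
have [r [er rd ry rx]] := eta_reduced.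
pose Red (h : {mpoly K[3]}) := exists G R,
  [/\ pi0 h = pi0 eta * pi0 G + pi0 R, G \is (d - a * b)%N.-homog for wd,
      R \is d.-homog for wd, z_reduced u R
    & forall m : 'X_{1..3}, (a <= m 1%R)%N -> R@_m = 0].
move=> hd; suff: Red h.
  move=> [G [R [e Gd Rd Rz Ry]]]; exists G, R; split=> // m.
  by rewrite mcoeff_msupp ltnNge; apply: contraNN => /Ry ->.
have Red0 : Red 0.
  exists 0, 0; split; rewrite ?rpred0 ?rmorph0 ?mulr0 ?addr0 //.
    by move=> m _; rewrite mcoeff0.
  by move=> m _; rewrite mcoeff0.
have RedD h1 h2 : Red h1 -> Red h2 -> Red (h1 + h2).
  move=> [G1 [R1 [e1 Gd1 Rd1 Rz1 Ry1]]] [G2 [R2 [e2 Gd2 Rd2 Rz2 Ry2]]].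
  exists (G1 + G2), (R1 + R2); split; rewrite ?rpredD //.
  - by rewrite !rmorphD /= e1 e2 mulrDr addrACA.
  - exact: z_reducedD.
  - by move=> m le; rewrite mcoeffD Ry1 // Ry2 // addr0.
have RedZ k h1 : Red h1 -> Red (k *: h1).
  move=> [G1 [R1 [e1 Gd1 Rd1 Rz1 Ry1]]].
  exists (k *: G1), (k *: R1); split; rewrite ?dhomogZ //.
  - by rewrite !pi0Z e1 scalerDr scalerAr.
  - exact: z_reducedZ.
  - by move=> m le; rewrite mcoeffZ Ry1 // mulr0.
have RedX m : wt m = d -> Red 'X_[m].
  have [n] := ubnP (d - m 0%R)%N; elim: n m => // n IH m lt wm.
  have [a0 s0 u0] := And3 (cd_a E) (cd_s3 E) (cd_u E).
  have le0 (k : 'X_{1..3}) : wt k = d -> (k 0%R <= d)%N.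
    by rewrite /lin => <-; rewrite -!addnA (leq_trans _ (leq_addr _ _)) ?leq_pmulr.
  have [le2|lt2] := leqP u (m 2%R).
    pose m1 := (m - mon 0 0 u)%MM; pose m2 := (mon s3 t3 0 + m1)%MM.
    have em : m = (mon 0 0 u + m1)%MM by rewrite addmC submK // mon_lem.
    have wm2 : wt m2 = d by rewrite -wm em !linD !linE !mul0n (cd_uc E); lia.
    have [|G [R [e Gd Rd Rz Ry]]] := IH m2 _ wm2.
      have := le0 _ wm2; move: lt; rewrite em !mnmDE !monE; lia.
    exists G, R; split=> //; rewrite -e !pi0X; congr ('X^_).
    have e3 := cd_f3u E.
    by rewrite em !linD !linE; lia.
  have [le1|lt1] := leqP a (m 1%R); last first.
    exists 0, 'X_[m]; split; rewrite ?rpred0 ?rmorph0 ?mulr0 ?add0r //.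
    - by rewrite homogX wm.
    - by move=> k le; rewrite mcoeffX; case: eqP => // ek; move: le; rewrite -ek leqNgt lt2.
    - by move=> k le; rewrite mcoeffX; case: eqP => // ek; move: le; rewrite -ek leqNgt lt1.
  pose m1 := (m - mon 0 a 0)%MM.
  have em : m = (mon 0 a 0 + m1)%MM by rewrite addmC submK // mon_lem le1.
  have wm1 : wt m1 = (d - a * b)%N by rewrite -wm em linD linE; lia.
  have leab : (a * b <= d)%N by rewrite -wm em linD linE; lia.
  pose l := r@_(mon 0 a 0); pose r' := r - l *: 'X_[mon 0 a 0].
  have Red' : Red ('X_[m1] * r').
    have r'd : r' \is (a * b)%N.-homog for wd.
      by rewrite rpredB // dhomogZ // homogX linE; apply/eqP; lia.
    apply: (@mpoly_linear_ind _ (fun g => Red ('X_[m1] * g))) => /=.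
    - by rewrite mulr0.
    - by move=> g g' Rg Rg'; rewrite mulrDr; apply: RedD.
    - by move=> k g Rg; rewrite -scalerAr; apply: RedZ.
    move=> k kr; rewrite -mpolyXD.
    have wk : wt (m1 + k)%MM = d by rewrite linD (homog_wt r'd kr) wm1 subnK.
    apply: (IH _ _ wk); have k0 : (0 < k 0%R)%N.
      apply: rx; last first.
        apply: contraTneq kr => ->; rewrite mcoeff_msupp /r' mcoeffB mcoeffZ mcoeffX eqxx.
        by rewrite mulr1 subrr eqxx.
      move: kr; rewrite !mcoeff_msupp /r' mcoeffB mcoeffZ mcoeffX.
      by have [<-|_] := eqVneq (mon 0 a 0) k;
         [rewrite mulr1 subrr eqxx|rewrite mulr0 subr0].
    have := le0 _ wk; move: lt; rewrite em !mnmDE !monE; lia.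
  have eX : pi0 'X_[m] = pi0 eta * pi0 (l^-1 *: 'X_[m1]) + pi0 ((- l^-1) *: ('X_[m1] * r')).
    rewrite er -rmorphM -rmorphD /=; congr (pi0 _).
    rewrite -scalerAr scaleNr -scalerBr [r * _]mulrC -mulrBr opprB addrC subrK.
    by rewrite -scalerAr scalerA mulVf // scale1r -mpolyXD addmC -em.
  have [G [R [e Gd Rd Rz Ry]]] := RedZ (- l^-1) _ Red'.
  exists (l^-1 *: 'X_[m1] + G), R; split=> //.
    by rewrite eX e addrA rmorphD /= mulrDr.
  by rewrite rpredD // dhomogZ // homogX wm1.
apply: mpoly_linear_ind => // m mh; apply: RedX; exact: homog_wt mh.
Qed.

(* The remainder [R] has at most one monomial for each exponent [< u] of [z], too
   few to vanish to order [u] at 1. *)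
Lemma eta_division d (h : {mpoly K[3]}) : h \is d.-homog for wd ->
  ('X - 1%:P) ^+ u %| pi0 h ->
  exists2 G, pi0 h = pi0 eta * pi0 G & G \is (d - a * b)%N.-homog for wd.
Proof.
move=> hd dvd; have [G [R [e Gd Rd Rz Ry]]] := eta_remainder hd.
exists G => //; suff R0 : pi0 R = 0 by rewrite e R0 addr0.
have dvdR : ('X - 1%:P) ^+ u %| pi0 R.
  by rewrite -(dvdp_addr _ (dvdp_mulr (pi0 G) eta_order)) -e.
(* Once degree and [z]-exponent are given, the [y]-exponent is known modulo [a], hence known since
   it is below [a]. *)
have inj2 : {in msupp R &, injective (fun m : 'X_{1..3} => m 2%R)}.
  move=> m m' mR m'R /= e2; have := homog_wt Rd mR; rewrite -(homog_wt Rd m'R).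
  rewrite /lin e2 => /addIn ew; have lt := Ry _ mR; have lt' := Ry _ m'R.
  have e1 := coprime_residue (cd_ab E) ew lt lt'.
  have a0 := cd_a E; move: ew; rewrite e1 => /addIn/eqP; rewrite eqn_pmul2r // => /eqP e0.
  exact: eq_mon.
have szR : (size (msupp R) <= u)%N.
  rewrite -(size_map (fun m : 'X_{1..3} => m 2%R)) -[X in (_ <= X)%N](size_iota 0).
  apply: uniq_leq_size; first by rewrite map_inj_in_uniq ?msupp_uniq.
  move=> _ /mapP[m mR ->]; rewrite mem_iota; exact: z_reduced_supp mR.
apply: (sparse_poly_eq0 hK (l := [seq fd m | m <- msupp R])).
  by move=> i /pi0_supp[m mR <-]; apply: map_f.
by rewrite size_map; apply: dvdp_trans dvdR; apply: dvdp_exp2l.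
Qed.

Lemma pi0_eta_neq0 : pi0 eta != 0.
Proof.
apply: contraNneq eta_y => e0; have := @pi0_lowcoef 1 eta.
by rewrite !muln1 e0 coef0 => ->.
Qed.

Lemma pi0_eta : exists2 lambda, lambda != 0 &
  pi0 eta = lambda *: ('X^(f2 * a) * ('X - 1%:P) ^+ u).
Proof.
have [|m [l [e1 _ l0 e2]]] := order_exact eta_homog pi0_eta_neq0 eta_order.
  by rewrite mulnC.
have m1 : m = 1%N.
  apply/eqP; rewrite -(eqn_pmul2l (cd_a E)) -(eqn_pmul2l (cd_b E)); apply/eqP; lia.
by exists l => //; rewrite e2 m1 !muln1.
Qed.

(** Up to a scalar and a power of [X], [pi0 eta] is exactly [(X - 1)^u], so cancelling it lowers the
    order at 1 by [u] and no more. This lets the division be iterated. *)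
Lemma pi0_eta_dvd j n (q : {poly K}) : (j * u <= n)%N ->
  ('X - 1%:P) ^+ n %| pi0 eta ^+ j * q -> ('X - 1%:P) ^+ (n - j * u) %| q.
Proof.
have [l l0 ->] := pi0_eta => le.
rewrite -{1}(subnK le) exprZn exprMn -exprM -scalerAl dvdpZr ?expf_neq0 //.
rewrite -!exprM [(u * j)%N]mulnC -mulrA mulrC -mulrA exprD.
rewrite [('X - 1%:P) ^+ (n - _) * _]mulrC dvdp_mul2l; last first.
  by rewrite expf_neq0 // polyXsubC_eq0.
by rewrite Gauss_dvdpl // coprime_Xsub1.
Qed.

Lemma eta_pow_division j d (h : {mpoly K[3]}) : h \is d.-homog for wd ->
  ('X - 1%:P) ^+ (j * u) %| pi0 h ->
  exists2 G, pi0 h = pi0 eta ^+ j * pi0 G & G \is (d - j * (a * b))%N.-homog for wd.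
Proof.
elim: j d h => [|j IH] d h hd dvd.
  by exists h; rewrite ?expr0 ?mul1r ?mul0n ?subn0.
have [|G e Gd] := eta_division hd.
  by apply: dvdp_trans dvd; apply: dvdp_exp2l; rewrite mulSn leq_addr.
have [|G' e' G'd] := IH _ G Gd.
  have le : (1 * u <= j.+1 * u)%N by rewrite leq_mul2r orbT.
  have := @pi0_eta_dvd 1 (j.+1 * u) (pi0 G) le.
  by rewrite mulSn mul1n addKn expr1 -e -mulSn; apply.
exists G'; first by rewrite e e' exprS mulrA.
by move: G'd; rewrite -subnDA mulSn.
Qed.

End Division.
End Restriction.

(** * Lengths of monomial quotients *)

Lemma module_lengthE (R : nzRingType) (V : lmodType R) D :
  has_submodule_chain V D ->
  (forall n, has_submodule_chain V n -> (n <= D)%N) -> module_length V = Some D.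
Proof.
move=> chD maxD; rewrite /module_length; case: pselect => [ex|]; last first.
  by case; exists D.
congr Some; case: (cid ex) => n /= [chn maxn]; apply/eqP.
by rewrite eqn_leq maxn // maxD.
Qed.

Lemma module_length_leq (R : nzRingType) (V : lmodType R) D n :
  module_length V = Some D -> has_submodule_chain V n -> (n <= D)%N.
Proof.
rewrite /module_length; case: pselect => // ex [<-].
by case: (cid ex) => k /= [_ maxk]; apply: maxk.
Qed.

Lemma submod_closed_sum (R : nzRingType) (V : lmodType R) (N : {pred V})
    (I : Type) (r : seq I) (P : pred I) (F : I -> V) :
  submod_closed N -> (forall i, P i -> F i \in N) -> \sum_(i <- r | P i) F i \in N.
Proof.
move=> [N0 NL] FN; apply: (big_ind (fun x => x \in N)) => // x y xN yN.
by have := NL 1 x y xN yN; rewrite scale1r.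
Qed.

Lemma submod_closed_scale (R : nzRingType) (V : lmodType R) (N : {pred V}) e x :
  submod_closed N -> x \in N -> e *: x \in N.
Proof. by move=> [N0 NL] xN; have := NL e x 0 xN N0; rewrite addr0. Qed.

Section IdealQuotient.

Local Open Scope quotient_scope.

Variables (R : comNzRingType) (A : {pred R}).

Local Notation Q := (ideal_quotient A).
Local Notation pi := (\pi_(ideal_quotient A)).

Lemma ideal_quotient_eq f g : (pi f = pi g) <-> (f - g \in ideal_gen A).
Proof. by rewrite Quotient.idealrBE; split=> [->//|/eqP]. Qed.

Lemma ideal_quotient_repr f : repr (pi f) - f \in ideal_gen A.
Proof. by apply/ideal_quotient_eq; rewrite reprK. Qed.

Lemma ideal_quotient_piD f g : pi (f + g) = pi f + pi g.
Proof. exact: (raddfD (\pi_({ideal_quot (ideal_gen A)}))). Qed.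

Lemma ideal_quotient_pi0 : pi 0 = 0.
Proof. exact: (raddf0 (\pi_({ideal_quot (ideal_gen A)}))). Qed.

Lemma ideal_quotient_piZ f g : pi (f * g) = f *: pi g.
Proof. by symmetry; apply: quotient_scale_pi. Qed.

Lemma ideal_quotient_pi_sum (I : Type) (r : seq I) (F : I -> R) :
  pi (\sum_(i <- r) F i) = \sum_(i <- r) pi (F i).
Proof.
elim: r => [|i r IH]; first by rewrite !big_nil ideal_quotient_pi0.
by rewrite !big_cons ideal_quotient_piD IH.
Qed.

(** Tests the chosen representative; for an ideal [J] containing the one generated by [A], the
    choice is immaterial. *)
Definition ideal_submodule (J : {pred R}) : {pred Q} := fun x => repr x \in J.

Lemma mem_ideal_submodule (J : {pred R}) f :
  is_ideal J -> {subset ideal_gen A <= J} ->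
  (pi f \in ideal_submodule J) = (f \in J).
Proof.
move=> idJ AJ; rewrite unfold_in; have /AJ rf := ideal_quotient_repr f.
have [_ JD _] := idJ; apply/idP/idP=> h; last by rewrite -[repr _](subrK f) JD.
by rewrite -[f](subKr (repr (pi f))) is_idealB.
Qed.

Lemma ideal_submodule_closed (J : {pred R}) :
  is_ideal J -> {subset ideal_gen A <= J} -> submod_closed (ideal_submodule J).
Proof.
move=> idJ AJ; have [J0 JD JM] := idJ; have memJ := mem_ideal_submodule _ idJ AJ.
split=> [|f x y xJ yJ]; first by rewrite -ideal_quotient_pi0 memJ.
rewrite -[x]reprK -[y]reprK -ideal_quotient_piZ -ideal_quotient_piD memJ.
by apply: JD => //; apply: JM.
Qed.

End IdealQuotient.

Section MonomialQuotient.

Local Open Scope quotient_scope.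

Variables (K : fieldType) (n : nat) (A : {pred {mpoly K[n]}}).
Implicit Types (f g : {mpoly K[n]}) (m : 'X_{1..n}) (B : seq 'X_{1..n}).

Definition vanishes_on B f : Prop := {in B, forall m, f@_m = 0}.

Definition mdown_closed B : Prop :=
  {in B, forall m m', (m' <= m)%MM -> m' \in B}.

Lemma vanishes_on_ideal B : mdown_closed B ->
  is_ideal (fun f => `[< vanishes_on B f >]).
Proof.
move=> dB; split=> [|f g /asboolP f0 /asboolP g0|e f /asboolP f0]; apply/asboolP=> m mB.
- by rewrite mcoeff0.
- by rewrite mcoeffD f0 ?g0 ?addr0.
rewrite mcoeffM big1 // => k /eqP e'; rewrite f0 ?mulr0 //.
by apply: (dB m) => //; rewrite [X in (_ <= X)%MM]e' lem_addl.
Qed.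

Lemma mdeg_lt_of_lem m m' : (m' <= m)%MM -> m' != m -> (mdeg m' < mdeg m)%N.
Proof.
move=> le ne; rewrite -(submK le) mdegD -[X in (X < _)%N]add0n ltn_add2r lt0n mdeg_eq0.
by apply: contraNneq ne => e; rewrite -[X in _ == X](submK le) e add0m.
Qed.

(** Sorted by total degree, every prefix of [B] is still closed under divisors. The ideals of
    polynomials vanishing on shorter and shorter prefixes form the chain. *)
Lemma monomial_chain B : uniq B -> mdown_closed B ->
  (forall f, f \in ideal_gen A -> vanishes_on B f) ->
  has_submodule_chain (ideal_quotient A) (size B).
Proof.
move=> uB dB vB; pose leB := fun m m' => (mdeg m <= mdeg m')%N.
pose Bs := sort leB B.
have sBs : size Bs = size B by rewrite size_sort.
have mBs : Bs =i B by move=> m; rewrite mem_sort.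
have uBs : uniq Bs by rewrite sort_uniq.
have sorted_Bs : sorted leB Bs by apply: sort_sorted => m m'; apply: leq_total.
have dBk k : mdown_closed (take k Bs).
  move=> m mk m' le; have [->//|ne] := eqVneq m' m.
  have mB : m \in B by rewrite -mBs (mem_take mk).
  have m'B : m' \in Bs by rewrite mBs (dB m).
  rewrite in_take //; rewrite ltnNge; apply/negP => lek.
  have ltk : (index m Bs < k)%N by rewrite -in_take // ?mBs.
  have tr : transitive leB by move=> x y z; apply: leq_trans.
  have rf : reflexive leB by move=> x; apply: leqnn.
  have := sorted_leq_nth tr rf m sorted_Bs (index m Bs) (index m' Bs).
  rewrite !inE !index_mem mBs mB m'B => /(_ isT isT (ltnW (leq_trans ltk lek))).
  by rewrite (nth_index _ m'B) nth_index ?mBs // /leB leqNgt (mdeg_lt_of_lem le ne).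
pose J i : {pred {mpoly K[n]}} := fun f => `[< vanishes_on (take (size B - i) Bs) f >].
have idJ i : is_ideal (J i) by apply: vanishes_on_ideal; apply: dBk.
have AJ i : {subset ideal_gen A <= J i}.
  move=> f fA; apply/asboolP=> m mk; apply: (vB f fA); rewrite -mBs; exact: mem_take mk.
exists (fun i => ideal_submodule (J i)).
  by move=> i; apply: ideal_submodule_closed.
move=> i lt; split.
  move=> x; rewrite !unfold_in => /asboolP v; apply/asboolP=> m mk; apply: v.
  have le : (size B - i.+1 <= size B - i)%N by lia.
  by have mB := mem_take mk; move: mk; rewrite !in_take // => lt'; apply: leq_trans le.
pose k := (size B - i.+1)%N; pose m0 := nth 0%MM Bs k.
have ltk : (k < size Bs)%N by rewrite sBs /k; lia.
have ek : (size B - i = k.+1)%N by rewrite /k; lia.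
have m0k : m0 \notin take k Bs by rewrite in_take ?mem_nth // index_uniq // ltnn.
exists (\pi_(ideal_quotient A) 'X_[m0]); rewrite mem_ideal_submodule //.
  apply/asboolP=> m mk; rewrite mcoeffX; case: eqP => // e.
  by case/negP: m0k; rewrite e.
apply/negP => /asboolP/(_ m0); rewrite ek mcoeffX eqxx => v.
have /eqP : 1 = 0 :> K.
  apply: v; rewrite in_take ?mem_nth // index_uniq //.
by rewrite oner_eq0.
Qed.

(** Choose one new vector at each step of the chain. They are independent over [K], while the
    coefficients on [B] embed the quotient in a space of dimension [size B]. *)
Lemma monomial_chain_bound B D :
  (forall f, vanishes_on B f -> f \in ideal_gen A) ->
  has_submodule_chain (ideal_quotient A) D -> (D <= size B)%N.
Proof.
move=> vB [N subN strictN].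
have /choice[v vP] : forall i : 'I_D, exists v, v \in N i.+1 /\ v \notin N i.
  by move=> i; have [_ [v v1 v2]] := strictN i (ltn_ord i); exists v.
have monoN i j : (i <= j)%N -> (j <= D)%N -> {subset N i <= N j}.
  move=> /subnK <-; elim: (j - i)%N => [|d IH] le x xN; first by [].
  by have [+ _] := strictN (d + i)%N le; apply; apply: IH xN; apply: ltnW.
pose M : 'M[K]_(D, size B) := \matrix_(i, j) (repr (v i))@_(nth 0%MM B j).
suff: row_free M by move=> /eqP <-; apply: rank_leq_col.
apply: inj_row_free => e eM; apply/rowP=> i; rewrite mxE.
have sum0 : \sum_j (e 0 j)%:MP *: v j = 0.
  transitivity (\pi_(ideal_quotient A) (\sum_j (e 0 j)%:MP * repr (v j))).
    rewrite ideal_quotient_pi_sum; apply: eq_bigr => j _.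
    by rewrite ideal_quotient_piZ reprK.
  rewrite -ideal_quotient_pi0; apply/ideal_quotient_eq; rewrite subr0.
  apply: vB => m mB; have lt : (index m B < size B)%N by rewrite index_mem.
  have := congr1 (fun r : 'rV_(size B) => r 0 (Ordinal lt)) eM; rewrite !mxE => E0.
  rewrite raddf_sum /= -[RHS]E0; apply: eq_bigr => j _.
  by rewrite mcoeffCM mxE /= nth_index.
(* Induction from the last index down: the last [v i] with a nonzero coefficient would be a
   combination of earlier ones, hence lie in [N i]. *)
have [k] := ubnP (D - i)%N; elim: k i => // k IH i ltk.
have [//|ei] := eqVneq (e 0 i) 0.
have [vi1 /negP []] := vP i.
have := sum0; rewrite (bigD1 i) //= => /eqP; rewrite addr_eq0 => /eqP ev.
have -> : v i = (- (e 0 i)^-1)%:MP *: \sum_(j | j != i) (e 0 j)%:MP *: v j.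
  rewrite mpolyCN scaleNr -scalerN -ev scalerA -mpolyCM mulVf // mpolyC1 scale1r //.
apply: submod_closed_scale => //; apply: submod_closed_sum => // j ji.
have [ltji|leij] := ltnP j i.
  apply: submod_closed_scale => //; have [vj _] := vP j.
  by apply: monoN vj => //; apply: ltnW.
rewrite IH ?mpolyC0 ?scale0r; first by case: (subN i).
have : (i < j)%N by rewrite ltn_neqAle eq_sym (inj_eq val_inj) ji.
have := ltn_ord j; lia.
Qed.

Lemma monomial_length B : uniq B -> mdown_closed B ->
  (forall f, f \in ideal_gen A <-> vanishes_on B f) ->
  module_length (ideal_quotient A) = Some (size B).
Proof.
move=> uB dB vB; apply: module_lengthE.
  by apply: monomial_chain => // f /vB.
by move=> D; apply: monomial_chain_bound => f /vB.
Qed.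

End MonomialQuotient.

(** * The two lengths and the coefficient of [y^a] *)

Section LengthCriterion.

Variables (K : fieldType).
Variables (a b c s t u t1 u1 s2 u2 s3 t3 f1 f2 f3 p1 p2 p3 : nat).
Hypothesis E : curve_data a b c s t u t1 u1 s2 u2 s3 t3 f1 f2 f3 p1 p2 p3.

Local Notation wd := (weighted_degree a b c).
Local Notation P := (monomial_prime K a b c).
Local Notation f := (varz ^+ u - varx ^+ s3 * vary ^+ t3 : {mpoly K[3]}).
Local Notation g1 := (varx ^+ s - vary ^+ t1 * varz ^+ u1 : {mpoly K[3]}).
Local Notation g2 := (vary ^+ t - varx ^+ s2 * varz ^+ u2 : {mpoly K[3]}).

Hypothesis genP : ideal_gen (mem [:: g1; g2; f]) =i P.

Definition box (j0 j1 k1 : nat) : seq 'X_{1..3} :=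
  [seq mon 0 j k | j <- iota j0 j1, k <- iota 0 k1].

Lemma mem_box j0 j1 k1 (m : 'X_{1..3}) : (m \in box j0 j1 k1) =
  [&& m 0%R == 0%N, j0 <= m 1%R, m 1%R < j0 + j1 & m 2%R < k1]%N.
Proof.
apply/allpairsP/idP => [[[j k] /= [+ + ->]]|].
  by rewrite !mem_iota !monE /= => /andP[-> ->] ->.
move=> /and4P[/eqP m0 l1 l2 l3]; exists (m 1%R, m 2%R) => /=.
by rewrite !mem_iota l1 l2 l3; split=> //; apply: eq_mon; rewrite monE.
Qed.

Lemma box_uniq j0 j1 k1 : uniq (box j0 j1 k1).
Proof.
apply: allpairs_uniq; try exact: iota_uniq.
move=> [j k] [j' k'] _ _ /= e.
have := congr1 (fun m : 'X_{1..3} => m 1%R) e; have := congr1 (fun m : 'X_{1..3} => m 2%R) e.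
by rewrite !monE => -> ->.
Qed.

Lemma size_box j0 j1 k1 : size (box j0 j1 k1) = (j1 * k1)%N.
Proof. by rewrite size_allpairs !size_iota. Qed.

Lemma le_mon (m m' : 'X_{1..3}) : (m' <= m)%MM ->
  [/\ m' 0%R <= m 0%R, m' 1%R <= m 1%R & m' 2%R <= m 2%R]%N.
Proof. by move=> /mnm_lepP le; split; apply: le. Qed.

Lemma mem_ideal_mon (J : {pred {mpoly K[3]}}) (k m : 'X_{1..3}) :
  is_ideal J -> 'X_[k] \in J -> (k <= m)%MM -> 'X_[m] \in J.
Proof. by move=> [_ _ JM] kJ le; rewrite -(submK le) mpolyXD; apply: JM. Qed.

Lemma mem_ideal_of_supp (J : {pred {mpoly K[3]}}) (h : {mpoly K[3]}) : is_ideal J ->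
  (forall m, m \in msupp h -> 'X_[m] \in J) -> h \in J.
Proof.
move=> [J0 JD JM] hJ; apply: (@mpoly_linear_ind _ (fun h => h \in J)) hJ; first exact: J0.
- by move=> g g' gJ g'J; exact: JD.
- by move=> e g gJ; rewrite -mul_mpolyC; apply: JM.
Qed.

Lemma varxE : varx = 'X_[mon 1 0 0] :> {mpoly K[3]}.
Proof. by rewrite mpolyX_mon !expr0 !mulr1 expr1. Qed.

Lemma mcoeff_varxM (g : {mpoly K[3]}) (m : 'X_{1..3}) : m 0%R = 0%N -> (varx * g)@_m = 0.
Proof.
by move=> m0; rewrite varxE mcoeffXM mon_lem m0.
Qed.

Lemma vanishes_varx (B : seq 'X_{1..3}) :
  {in B, forall m : 'X_{1..3}, m 0%R = 0%N} -> vanishes_on B (varx : {mpoly K[3]}).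
Proof. by move=> B0 m /B0; rewrite -[varx]mulr1; apply: mcoeff_varxM. Qed.

Lemma vanishes_binomial (B : seq 'X_{1..3}) k k' :
  k \notin B -> k' \notin B -> vanishes_on B ('X_[k] - 'X_[k'] : {mpoly K[3]}).
Proof.
move=> kB k'B m mB; rewrite mcoeffB !mcoeffX.
case: eqP => [e|_]; first by rewrite e mB in kB.
by case: eqP => [e|_]; rewrite ?subr0 //; rewrite e mB in k'B.
Qed.

Lemma g2E : g2 = 'X_[mon 0 t 0] - 'X_[mon s2 0 u2].
Proof. by rewrite !mpolyX_mon !expr0 !mulr1 !mul1r. Qed.

Lemma mon_mem_ideal (J : {pred {mpoly K[3]}}) (k k' : 'X_{1..3}) :
  is_ideal J -> 'X_[k] - 'X_[k'] \in J -> 'X_[k'] \in J -> 'X_[k] \in J.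
Proof. by move=> [_ JD _] d k'J; rewrite -['X_[k]](subrK 'X_[k']); apply: JD. Qed.

(** Modulo [x] the three generators become [y^t1 z^u1], [y^t], [z^u] up to sign. The monomials under
    this staircase form two boxes with [t1 u + t3 u1 = a] elements. *)
Lemma length_curve_section :
  module_length (ideal_quotient [predU1 varx & P]) = Some a.
Proof.
pose B := box 0 t1 u ++ box t1 t3 u1.
have [t10 u10 s20 s30] := And4 (cd_t1 E) (cd_u1 E) (cd_s2 E) (cd_s3 E).
have [es et eu] := And3 (cd_s E) (cd_t E) (cd_uE E).
have mB (m : 'X_{1..3}) : (m \in B) = (m 0%R == 0%N) &&
    ((m 1%R < t1)%N && (m 2%R < u)%N ||
     [&& t1 <= m 1%R, m 1%R < t & m 2%R < u1]%N).
  by rewrite mem_cat !mem_box -et; case: (m 0%R == 0%N).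
rewrite [X in Some X](_ : a = size B); last first.
  by rewrite size_cat !size_box (cd_aE E) mulnC [(u1 * _)%N]mulnC; lia.
have dB : mdown_closed B.
  by move=> m; rewrite mB => mm m' /le_mon[l0 l1 l2]; rewrite mB; lia.
set A := (X in ideal_quotient X).
have mA h : (h \in A) = (h == varx) || (h \in P) by [].
have idI := is_ideal_gen A; set I := ideal_gen A in idI *.
have xI : 'X_[mon 1 0 0] \in I by rewrite -varxE; apply: mem_ideal_gen; rewrite mA eqxx.
have PI h : h \in P -> h \in I by move=> hP; apply: mem_ideal_gen; rewrite mA hP orbT.
have [g1I g2I fI] : [/\ g1 \in I, g2 \in I & f \in I].
  by have [? ? ?] := mem_ideal_gen3 g1 g2 f; split; apply: PI; rewrite -genP.
have yI : 'X_[mon 0 t 0] \in I.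
  apply: (mon_mem_ideal (k' := mon s2 0 u2) idI).
    by rewrite -g2E.
  by apply: (mem_ideal_mon idI xI); rewrite mon_lem monE s20.
have zI : 'X_[mon 0 0 u] \in I.
  apply: (mon_mem_ideal (k' := mon s3 t3 0) idI).
    by rewrite -fE.
  by apply: (mem_ideal_mon idI xI); rewrite mon_lem monE s30.
have yzI : 'X_[mon 0 t1 u1] \in I.
  apply: (mon_mem_ideal (k' := mon s 0 0) idI).
    have [_ _ JM] := idI; rewrite -opprB -mulN1r; apply: JM.
    by rewrite -g1E.
  by apply: (mem_ideal_mon idI xI); rewrite mon_lem monE es; lia.
apply: monomial_length; [|exact: dB|].
  rewrite cat_uniq !box_uniq /= andbT; apply/hasPn=> m.
  by rewrite !mem_box; lia.
move=> h; split=> [|hB].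
  have idV := @vanishes_on_ideal K 3 B dB.
  pose V : {pred {mpoly K[3]}} := fun h => `[< vanishes_on B h >].
  suff sub : {subset I <= V} by move=> /sub hV; apply/asboolP; exact: hV.
  apply: (ideal_gen_subP idV) => g; rewrite mA => /predU1P[->|].
    by apply/asboolP; apply: vanishes_varx => m; rewrite mB => /andP[/eqP].
  rewrite -(genP g); move: g; apply: (ideal_gen3_subP idV); apply/asboolP.
  - by rewrite g1E; apply: vanishes_binomial; rewrite mB !monE; lia.
  - by rewrite g2E; apply: vanishes_binomial; rewrite mB !monE; lia.
  by rewrite fE; apply: vanishes_binomial; rewrite mB !monE; lia.
apply: mem_ideal_of_supp => // m; rewrite mcoeff_msupp => nz.
have : m \notin B by apply: contraNN nz => /hB ->.
rewrite mB; have [m0|m0] := posnP (m 0%R); last first.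
  by move=> _; apply: (mem_ideal_mon idI xI); rewrite mon_lem m0.
have [lt|lt] := ltnP (m 1%R) t1.
  move=> nB; apply: (mem_ideal_mon idI zI); rewrite mon_lem; lia.
have [lt'|lt'] := ltnP (m 1%R) t.
  move=> nB; apply: (mem_ideal_mon idI yzI); rewrite mon_lem; lia.
by move=> nB; apply: (mem_ideal_mon idI yI); rewrite mon_lem; lia.
Qed.

Variable eta : {mpoly K[3]}.
Hypothesis eta_homog : eta \is (a * b)%N.-homog for wd.

Lemma eta_supp (m : 'X_{1..3}) : m \in msupp eta -> m 0%R = 0%N -> (m 2%R < u)%N ->
  m = mon 0 a 0.
Proof.
move=> mh m00 lt; have wm := homog_wt eta_homog mh.
have eq : (m 1%R * b + m 2%R * c = a * b)%N by rewrite -wm /lin m00; lia.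
have dvdb : (b %| m 2%R)%N.
  rewrite -(@Gauss_dvdl b (m 2%R) c) ?(cd_bc E) //.
  by rewrite -(@dvdn_addr (m 1%R * b)) ?dvdn_mull // eq dvdn_mull.
have m20 : m 2%R = 0%N.
  by case: (posnP (m 2%R)) => // m2; have := dvdn_leq m2 dvdb; have := b_ge_u E; lia.
apply: eq_mon; rewrite monE //.
have b0 := cd_b E; apply/eqP; rewrite -(eqn_pmul2r b0); apply/eqP; lia.
Qed.

(** Modulo [x] and [z^u], [eta] is a nonzero multiple of [y^a], so an [a] by [u] box of monomials
    remains. *)
Lemma length_eta : eta@_(mon 0 a 0) != 0 ->
  module_length (ideal_quotient (mem [:: varx; f; eta])) = Some (u * a)%N.
Proof.
move=> eta_y; pose B := box 0 a u.
have [s30 u0] := conj (cd_s3 E) (cd_u E).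
have -> : (u * a)%N = size B by rewrite size_box mulnC.
have mB (m : 'X_{1..3}) : (m \in B) = [&& m 0%R == 0%N, m 1%R < a & m 2%R < u]%N.
  by rewrite mem_box.
have dB : mdown_closed B.
  by move=> m; rewrite mB => mm m' /le_mon[l0 l1 l2]; rewrite mB; lia.
have idI := is_ideal_gen (mem [:: varx; f; eta]); set I := ideal_gen _ in idI *.
have [xI' fI etaI] : [/\ varx \in I, f \in I & eta \in I] by exact: mem_ideal_gen3.
have xI : 'X_[mon 1 0 0] \in I by rewrite -varxE.
have zI : 'X_[mon 0 0 u] \in I.
  apply: (mon_mem_ideal (k' := mon s3 t3 0) idI).
    by rewrite -fE.
  by apply: (mem_ideal_mon idI xI); rewrite mon_lem monE s30.
have yI : 'X_[mon 0 a 0] \in I.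
  have [_ _ IM] := idI.
  rewrite -['X_[_]]scale1r -(mulVf eta_y) -scalerA -mul_mpolyC; apply: IM.
  rewrite -[_ *: _](subKr eta); apply: is_idealB => //.
  apply: mem_ideal_of_supp => // m; rewrite mcoeff_msupp mcoeffB mcoeffZ mcoeffX.
  have [<-|ne] := eqVneq (mon 0 a 0) m; first by rewrite mulr1 subrr eqxx.
  rewrite mulr0 subr0 -mcoeff_msupp => mh.
  have [m0|m0] := posnP (m 0%R); last first.
    by apply: (mem_ideal_mon idI xI); rewrite mon_lem m0.
  have [lt|le] := ltnP (m 2%R) u; first by case/eqP: ne; rewrite (eta_supp mh).
  by apply: (mem_ideal_mon idI zI); rewrite mon_lem.
apply: monomial_length; [exact: box_uniq|exact: dB|].
move=> h; split=> [|hB].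
  have idV := @vanishes_on_ideal K 3 B dB.
  pose V : {pred {mpoly K[3]}} := fun h => `[< vanishes_on B h >].
  suff sub : {subset I <= V} by move=> /sub hV; apply/asboolP; exact: hV.
  apply: (ideal_gen3_subP idV); apply/asboolP.
  - by apply: vanishes_varx => m; rewrite mB => /and3P[/eqP].
  - by rewrite fE; apply: vanishes_binomial; rewrite mB !monE; lia.
  move=> m; rewrite mB => /and3P[/eqP m0 lt1 lt2].
  have [mh|] := boolP (m \in msupp eta); last exact: memN_msupp_eq0.
  by move: lt1; rewrite (eta_supp mh) // monE ltnn.
apply: mem_ideal_of_supp => // m; rewrite mcoeff_msupp => nz.
have : m \notin B by apply: contraNN nz => /hB ->.
rewrite mB; have [m0|m0] := posnP (m 0%R); last first.
  by move=> _; apply: (mem_ideal_mon idI xI); rewrite mon_lem m0.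
have [lt|lt] := ltnP (m 1%R) a => nB.
  by apply: (mem_ideal_mon idI zI); rewrite mon_lem; lia.
by apply: (mem_ideal_mon idI yI); rewrite mon_lem; lia.
Qed.

(* Otherwise all the powers of [y] survive and the length is infinite. *)
Lemma length_criterion :
  module_length (ideal_quotient (mem [:: varx; f; eta])) =
    omap (muln u) (module_length (ideal_quotient [predU1 varx & P]))
  <-> eta@_(mon 0 a 0) != 0.
Proof.
rewrite length_curve_section /=; split; last exact: length_eta.
move=> len; apply/negP => /eqP eta_y; pose n := (u * a).+1; pose B := box 0 n 1.
have [s30 u0] := conj (cd_s3 E) (cd_u E).
have mB (m : 'X_{1..3}) : (m \in B) = [&& m 0%R == 0%N, m 1%R < n & m 2%R < 1]%N.
  by rewrite mem_box.
have dB : mdown_closed B.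
  by move=> m; rewrite mB => mm m' /le_mon[l0 l1 l2]; rewrite mB; lia.
have : has_submodule_chain (ideal_quotient (mem [:: varx; f; eta])) (size B).
  apply: monomial_chain; [exact: box_uniq|exact: dB|].
  move=> h; have idV := @vanishes_on_ideal K 3 B dB.
  pose V : {pred {mpoly K[3]}} := fun h => `[< vanishes_on B h >].
  suff sub : {subset ideal_gen (mem [:: varx; f; eta]) <= V}.
    by move=> /sub hV; apply/asboolP; exact: hV.
  apply: (ideal_gen3_subP idV); apply/asboolP.
  - by apply: vanishes_varx => m; rewrite mB => /and3P[/eqP].
  - by rewrite fE; apply: vanishes_binomial; rewrite mB !monE; lia.
  move=> m; rewrite mB => /and3P[/eqP m0 lt1 lt2].
  have [mh|] := boolP (m \in msupp eta); last exact: memN_msupp_eq0.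
  by rewrite (eta_supp mh) //; lia.
by move=> /(module_length_leq len); rewrite size_box muln1 ltnn.
Qed.

End LengthCriterion.

(** * Sufficiency *)

Lemma mpoly_in_subring (B : comNzRingType) (K : fieldType)
    (phi : {mpoly K[3]} -> B) (Z : {pred B}) :
  {morph phi : g h / g + h} -> {morph phi : g h / g * h} -> phi 0 = 0 ->
  0 \in Z -> {in Z &, forall x y, x + y \in Z} ->
  {in Z &, forall x y, x * y \in Z} -> (forall e, phi e%:MP \in Z) ->
  phi varx \in Z -> phi vary \in Z -> phi varz \in Z -> forall h, phi h \in Z.
Proof.
move=> phiD phiM phi0 Z0 ZD ZM ZC Zx Zy Zz h.
have ZX v n : phi v \in Z -> phi (v ^+ n) \in Z.
  move=> vZ; elim: n => [|n IH]; first by rewrite expr0 -mpolyC1 ZC.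
  by rewrite exprS phiM ZM.
apply: (@mpoly_linear_ind _ (fun h => phi h \in Z)).
- by rewrite phi0.
- by move=> g g' gZ g'Z; rewrite phiD ZD.
- by move=> e g gZ; rewrite -mul_mpolyC phiM ZM.
by move=> m _; rewrite (monP m) mpolyX_mon !phiM !ZM ?ZX.
Qed.

Lemma noetherian_mpoly (K : fieldType) : noetherian {mpoly K[3]}.
Proof.
have [|||R [phi [noeR _ phiC phiX]]] := @noetherian_cover K {mpoly K[3]}
   (@mpolyC 3 K) predT [:: varx; vary; varz] => //.
apply: (noetherian_image (phi := phi) (v := idfun) _ _ _ noeR) => //.
  by move=> r; exists (phi r).
move=> h; pose Z : {pred {mpoly K[3]}} := fun h => `[< exists r, phi r = h >].
suff : idfun h \in Z by move=> /asboolP.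
apply: mpoly_in_subring => //=.
- by apply/asboolP; exists 0; rewrite rmorph0.
- move=> _ _ /asboolP[r <-] /asboolP[r' <-]; apply/asboolP.
  by exists (r + r'); rewrite rmorphD.
- move=> _ _ /asboolP[r <-] /asboolP[r' <-]; apply/asboolP.
  by exists (r * r'); rewrite rmorphM.
- by move=> e; apply/asboolP; apply: phiC.
- by apply/asboolP; apply: phiX; rewrite !inE eqxx.
- by apply/asboolP; apply: phiX; rewrite !inE eqxx orbT.
by apply/asboolP; apply: phiX; rewrite !inE eqxx !orbT.
Qed.

Section Sufficiency.

Variables (K : fieldType) (hK : [pchar K] =i pred0).
Variables (a b c s t u t1 u1 s2 u2 s3 t3 f1 f2 f3 p1 p2 p3 : nat).
Hypothesis E : curve_data a b c s t u t1 u1 s2 u2 s3 t3 f1 f2 f3 p1 p2 p3.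

Local Notation wd := (weighted_degree a b c).
Local Notation rhoT := (@rhoT K a b c f1 f2 f3 p1 p2 p3).
Local Notation pi0 := (@pi0 K f1 f2 f3).
Local Notation P := (monomial_prime K a b c).
Local Notation f := (varz ^+ u - varx ^+ s3 * vary ^+ t3 : {mpoly K[3]}).
Local Notation g1 := (varx ^+ s - vary ^+ t1 * varz ^+ u1 : {mpoly K[3]}).
Local Notation g2 := (vary ^+ t - varx ^+ s2 * varz ^+ u2 : {mpoly K[3]}).

Hypothesis genP : ideal_gen (mem [:: g1; g2; f]) =i P.

Let SP n h : h \in symbolic_power P n <-> ordge n (rhoT h) :=
  symbolic_power_ordge E genP n h.

Lemma is_ideal_symbolic n : is_ideal (symbolic_power P n).
Proof.
split=> [|g h gP hP|e h hP]; apply/SP.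
- by have -> : rhoT 0 = 0 by [exact: rmorph0]; apply: ordge0.
- have -> : rhoT (g + h) = rhoT g + rhoT h by exact: rmorphD.
  by apply: ordgeD; apply/SP.
have -> : rhoT (e * h) = rhoT e * rhoT h by exact: rmorphM.
by apply: (@ordgeM _ 0 n); last exact/SP.
Qed.

Lemma f_symbolic : f \in symbolic_power P 1.
Proof.
by apply/SP; apply: prime_ordge; rewrite -genP; have [] := mem_ideal_gen3 g1 g2 f.
Qed.

Lemma symbolic_pihomog n d h : h \in symbolic_power P n ->
  pihomog wd d h \in symbolic_power P n.
Proof.
move=> /SP/ordge_rhoT oh; apply/SP; apply/(ordge_rhoT_homog _ _ _ _ _ _ _ (pihomogP wd d h)).
exact: oh.
Qed.

Lemma symbolic_pi0 n d h : h \is d.-homog for wd -> h \in symbolic_power P n ->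
  ('X - 1%:P) ^+ n %| pi0 h.
Proof.
move=> hd /SP/(ordge_rhoT_homog _ _ _ _ _ _ _ hd) oh.
rewrite -dvdp_shift -(rho1_0 a b c f1 f2 f3 p1 p2 p3).
by apply/dvdp_XnP=> i lt; apply: oh; rewrite add0n.
Qed.

(** [f] becomes [W] times a factor with nonzero constant term, so dividing by it loses only one
    order. *)
Lemma symbolic_divf n h : f * h \in symbolic_power P n.+1 -> h \in symbolic_power P n.
Proof.
move=> /SP ofh; apply/SP; move: ofh.
have -> : rhoT (f * h) = rhoT f * rhoT h by exact: rmorphM.
pose U3 := ('X ^+ (u * c))%:P%:P * (('X + 1%:P) ^+ (f3 * u))%:P
  * ('X + 1%:P) ^+ (p1 * s3 + p2 * t3) : {poly {poly {poly K}}}.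
have -> : rhoT f = U3 * 'X by exact: (rho_f E).
have U30 : U3`_0`_0 != 0.
  rewrite /U3 !(coef0M, coefC) /= !coef_X1n !bin0 !mulr1.
  by rewrite ?(coef0M, coefC, coef1) /= ?mulr1 expf_neq0 // polyX_eq0.
rewrite -mulrA => /(ordge_mulKl U30) oXh i j lt.
by have := oXh i.+1 j; rewrite mulrC coefMX /=; apply; rewrite addSn ltnS.
Qed.

Variable eta : {mpoly K[3]}.
Hypothesis eta_symbolic : eta \in symbolic_power P u.
Hypothesis eta_homog : eta \is (a * b)%N.-homog for wd.
Hypothesis eta_y : eta@_(mon 0 a 0) != 0.

Let eta_order : ('X - 1%:P) ^+ u %| pi0 eta := symbolic_pi0 eta_homog eta_symbolic.

(** Each homogeneous component is either divisible by [f] or, by [order_bound], of degree large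
    enough to be divided by [eta^j] modulo [f]. The symbolic orders of [g] and [k] are left open
    here. *)
Lemma symbolic_mod_f j n h : (j * u <= n)%N -> h \in symbolic_power P n ->
  exists g k, h = eta ^+ j * g + f * k.
Proof.
move=> le hn; pose J : {pred {mpoly K[3]}} := fun h => `[< exists g k, h = eta ^+ j * g + f * k >].
suff: h \in J by move=> /asboolP.
have idJ : is_ideal J.
  split=> [|_ _ /asboolP[g [k ->]] /asboolP[g' [k' ->]]|e _ /asboolP[g [k ->]]]; apply/asboolP.
  - by exists 0, 0; rewrite !mulr0 addr0.
  - by exists (g + g'), (k + k'); rewrite !mulrDr addrACA.
  - by exists (e * g), (e * k); rewrite mulrDr !(mulrCA e).
rewrite [h](pihomog_partitionE (leqnn (mmeasure wd h))).
apply: is_ideal_sum => // d _; apply/asboolP; set hd := pihomog _ _ _.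
have hom : hd \is (d : nat).-homog for wd by apply: pihomogP.
have dvd := symbolic_pi0 hom (symbolic_pihomog d hn).
have [z|nz] := eqVneq (pi0 hd) 0.
  have [k -> _] := dvd_f_of_pi0 E hom z.
  by exists 0, k; rewrite mulr0 add0r.
have led : (j * (a * b) <= d)%N.
  have := order_bound E hom nz dvd => le'.
  rewrite -(leq_pmul2r (cd_u E)) (leq_trans _ le') // mulnAC.
  by rewrite leq_mul2r le orbT.
have [|G eG Gd] := eta_pow_division hK E eta_homog eta_y eta_order (j := j) hom.
  by apply: dvdp_trans dvd; apply: dvdp_exp2l.
have hom' : hd - eta ^+ j * G \is (d : nat).-homog for wd.
  rewrite rpredB //; have -> : (d : nat) = (a * b * j + (d - j * (a * b)))%N.
    by rewrite [(a * b * j)%N]mulnC subnKC.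
  by apply: dhomogM => //; apply: dhomogMn.
have [|k ek _] := dvd_f_of_pi0 E hom' _.
  by rewrite rmorphB rmorphM rmorphXn /= eG subrr.
by exists G, k; rewrite -ek addrC subrK.
Qed.

(** [Q i j] is the colon of [p^(i + j u) + (f)] by [eta^j]; it grows with [j] and stabilises. So
    [h = eta^(j+1) g + f k] can be rewritten with [eta^j g] replaced by an element of [p^(n - u)]
    modulo [f], and [symbolic_divf] then gives the order of the cofactor of [f]. *)
Lemma symbolic_recursion : exists M, forall n h, (M <= n)%N -> (u <= n)%N ->
  h \in symbolic_power P n -> exists h1 h2,
  [/\ h1 \in symbolic_power P (n - u), h2 \in symbolic_power P n.-1
    & h = eta * h1 + f * h2].
Proof.
have u0 := cd_u E.
pose Q i j : {pred {mpoly K[3]}} := fun g => `[< exists h k,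
  h \in symbolic_power P (i + j * u) /\ eta ^+ j * g = h + f * k >].
have idQ i j : is_ideal (Q i j).
  have [S0 SD SM] := is_ideal_symbolic (i + j * u).
  split=> [|g g' /asboolP[h [k [hS eh]]] /asboolP[h' [k' [h'S eh']]]|
            e g /asboolP[h [k [hS eh]]]]; apply/asboolP.
  - by exists 0, 0; rewrite !mulr0 addr0.
  - by exists (h + h'), (k + k'); rewrite !mulrDr eh eh' addrACA SD.
  - by exists (e * h), (e * k); rewrite mulrCA eh mulrDr (mulrCA e f) SM.
have incQ i j : {subset Q i j <= Q i j.+1}.
  move=> g /asboolP[h [k [hS eh]]]; apply/asboolP.
  exists (eta * h), (eta * k); split.
    by rewrite mulSn addnCA; apply: symbolic_powerM.
  by rewrite exprS -mulrA eh mulrDr (mulrCA eta f).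
have /choice[J JP] : forall i, exists N, forall j, (N <= j)%N -> {subset Q i j <= Q i N}.
  by move=> i; apply: noetherian_chain => //; apply: noetherian_mpoly.
pose N := (\max_(i < u) J i)%N.
have stab i j : (i < u)%N -> (N <= j)%N -> {subset Q i j.+1 <= Q i j}.
  move=> lt le g gQ.
  have leJ : (J i <= j)%N.
    by apply: leq_trans le; apply: (leq_bigmax (F := fun i : 'I_u => J i) (Ordinal lt)).
  have gJ : g \in Q i (J i) by apply: JP gQ; apply: leqW.
  move: gJ; rewrite -(subnK leJ); elim: (j - J i)%N => // k IH /IH; exact: incQ.
exists (N.+1 * u)%N => n h leM leu hn.
pose i := (n %% u)%N; pose j := (n %/ u).-1.
have ltiu : (i < u)%N by rewrite ltn_mod.
have ltN : (N < n %/ u)%N by rewrite leq_divRL.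
have en : n = (i + j.+1 * u)%N.
  by rewrite /j prednK 1?addnC -?divn_eq //; apply: leq_ltn_trans ltN.
have [|g [k eh]] := symbolic_mod_f (j := j.+1) _ hn.
  by rewrite [X in (_ <= X)%N]en leq_addl.
have gQ : g \in Q i j.+1.
  by apply/asboolP; exists h, (- k); split; [rewrite -en|rewrite eh mulrN addrK].
have /asboolP[h1 [k1 [h1S eh1]]] : g \in Q i j.
  by apply: stab => //; rewrite /j; lia.
have enu : (n - u = i + j * u)%N by rewrite [X in (X - _)%N]en mulSn addnCA addKn.
exists h1, (eta * k1 + k); rewrite enu; split=> //; last first.
  by rewrite eh exprS -mulrA eh1 !mulrDr (mulrCA eta f) addrA.
apply: symbolic_divf; rewrite prednK; last by apply: leq_trans leu.
have -> : f * (eta * k1 + k) = h - eta * h1.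
  by rewrite eh exprS -mulrA eh1 !mulrDr (mulrCA eta f); ring.
apply: is_idealB => //; first exact: is_ideal_symbolic.
by rewrite -(subnKC leu) enu; apply: symbolic_powerM.
Qed.

Theorem noetherian_symbolic_rees : noetherian (symbolic_rees_ring P).
Proof.
have [M recM] := symbolic_recursion.
have /choice[T TP] : forall i, exists T : seq {mpoly K[3]},
    ideal_gen (mem T) =i symbolic_power P i.
  move=> i; apply: noetherian_ideal; first exact: noetherian_mpoly.
  exact: is_ideal_symbolic.
(* The recursion requires both [M <= n] and [u <= n]; ideal generators of [p^(i)] for [i < M + u]
   cover the exponents where it may fail. *)
pose l : seq {poly {mpoly K[3]}} := [:: varx%:P; vary%:P; varz%:P; f%:P * 'X^1;
  eta%:P * 'X^u] ++ flatten [seq [seq g%:P * 'X^i | g <- T i] | i <- iota 0 (M + u)].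
have memR n h : h \in symbolic_power P n -> h%:P * 'X^n \in symbolic_rees P.
  move=> hn; apply/asboolP=> i; rewrite coefCM coefXn; case: eqP => [->|_].
    by rewrite mulr1.
  by rewrite mulr0; apply: symbolic_power0.
have memR0 h : h%:P \in symbolic_rees P.
  by rewrite -[h%:P]mulr1 -(expr0 'X); apply: memR; apply/SP.
have lR : {subset l <= symbolic_rees P}.
  move=> F; rewrite mem_cat => /orP[|/flattenP[_ /mapP[i _ ->] /mapP[g gT ->]]].
    rewrite !inE => /or4P[||| /predU1P[|]]; try by move/eqP->; apply: memR0.
    + by move=> ->; apply: memR; apply: f_symbolic.
    + by move/eqP->; apply: memR.
  by apply: memR; rewrite -TP; apply: mem_ideal_gen.
have [|R [phi [noeR phiR phiC phil]]] := @noetherian_cover K {poly {mpoly K[3]}}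
   (polyC \o @mpolyC 3 K) (symbolic_rees P) l (symbolic_rees_subring_closed P) _ lR.
  by move=> e; apply: memR0.
pose v : {rmorphism symbolic_rees_ring P -> {poly {mpoly K[3]}}} := val.
apply: (noetherian_image (phi := phi) (v := v) _ _ _ noeR).
- exact: (@val_inj _ _ (symbolic_rees_ring P)).
- by move=> r; exists (SymbolicRees (phiR r)).
move=> [F FR] /=.
pose Z : {pred {poly {mpoly K[3]}}} := fun h => `[< exists r, phi r = h >].
have Z0 : 0 \in Z by apply/asboolP; exists 0; rewrite rmorph0.
have ZD : {in Z &, forall x y, x + y \in Z}.
  move=> _ _ /asboolP[r <-] /asboolP[r' <-]; apply/asboolP.
  by exists (r + r'); rewrite rmorphD.
have ZM : {in Z &, forall x y, x * y \in Z}.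
  move=> _ _ /asboolP[r <-] /asboolP[r' <-]; apply/asboolP.
  by exists (r * r'); rewrite rmorphM.
have lZ x : x \in l -> x \in Z by move=> /phil[r <-]; apply/asboolP; exists r.
have nthZ i : (i < 5)%N -> nth 0 l i \in Z.
  by move=> lt; apply: lZ; apply: mem_nth; rewrite size_cat (leq_trans lt) ?leq_addr.
have SZ h : h%:P \in Z.
  apply: (@mpoly_in_subring _ K polyC Z); [| | |exact: Z0|exact: ZD|exact: ZM| | | |].
  - by move=> g g'; rewrite polyCD.
  - by move=> g g'; rewrite polyCM.
  - by rewrite polyC0.
  - by move=> e; apply/asboolP; apply: phiC.
  - exact: (nthZ 0%N).
  - exact: (nthZ 1%N).
  - exact: (nthZ 2%N).
have fZ : f%:P * 'X^1 \in Z by exact: (nthZ 3%N).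
have etaZ : eta%:P * 'X^u \in Z by exact: (nthZ 4%N).
suff hZ n h : h \in symbolic_power P n -> h%:P * 'X^n \in Z.
  have /asboolP Fn := FR.
  suff : F \in Z by move=> /asboolP.
  rewrite -[F]coefK poly_def.
  apply: (big_ind (fun x => x \in Z)) => // i _.
  by rewrite -mul_polyC; apply: hZ.
elim/ltn_ind: n h => n IH h hn.
have [lt|le] := ltnP n (M + u).
  pose J : {pred {mpoly K[3]}} := fun h => h%:P * 'X^n \in Z.
  have idJ : is_ideal J.
    split=> [|g g' gJ g'J|e g gJ]; rewrite unfold_in.
    - by rewrite polyC0 mul0r.
    - by rewrite polyCD mulrDl; exact: (ZD _ _ gJ g'J).
    - by rewrite polyCM -mulrA; exact: (ZM _ _ (SZ e) gJ).
  have TJ : {subset T n <= J}.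
    move=> g gT; rewrite unfold_in; apply: lZ; rewrite mem_cat; apply/orP; right.
    apply/flattenP; exists [seq g%:P * 'X^n | g <- T n].
      by apply: map_f; rewrite mem_iota.
    exact: map_f.
  by apply: (ideal_gen_subP idJ TJ); rewrite TP.
have [||h1 [h2 [h1S h2S ->]]] := recM n h _ _ hn.
- exact: leq_trans (leq_addr _ _) le.
- exact: leq_trans (leq_addl _ _) le.
have u0 := cd_u E.
have lun : (u <= n)%N by apply: leq_trans (leq_addl _ _) le.
rewrite polyCD !polyCM mulrDl; apply: ZD.
  rewrite -{1}(subnKC lun) exprD mulrACA; apply: (ZM _ _ etaZ).
  by apply: (IH _ _ _ h1S); rewrite ltn_subrL u0 (leq_trans u0 lun).
have -> : ('X^n : {poly {mpoly K[3]}}) = 'X ^+ 1 * 'X ^+ n.-1.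
  by rewrite -exprD add1n prednK // (leq_trans u0 lun).
rewrite mulrACA; apply: (ZM _ _ fZ).
by apply: (IH _ _ _ h2S); rewrite prednK // (leq_trans u0 lun).
Qed.

End Sufficiency.

(** * Necessity: elements of small defect *)

Lemma coprime_semigroup (a b n : nat) : (0 < a)%N -> (0 < b)%N -> coprime a b ->
  (a * b <= n)%N -> exists x y, (x < b)%N /\ (n = x * a + y * b)%N.
Proof.
move=> a0 b0 cab le; have := egcdnP b a0; case: egcdnP => // km kn e _ _.
rewrite (eqP (cab : gcdn a b == 1%N)) in e.
pose x := ((km * n) %% b)%N; have ltx : (x < b)%N by rewrite ltn_mod.
have lexn : (x * a <= n)%N.
  by apply: leq_trans le; rewrite mulnC leq_mul2l (ltnW ltx) orbT.
have exn : (n = x * a %[mod b])%N.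
  by rewrite /x modnMml mulnAC e mulnDl mul1n mulnAC modnMDl.
have : (b %| n - x * a)%N by rewrite -eqn_mod_dvd //; apply/eqP.
by move=> /dvdnP[y ey]; exists x, y; rewrite -ey subnKC.
Qed.

Section Necessity.

Variables (K : fieldType) (hK : [pchar K] =i pred0).
Variables (a b c s t u t1 u1 s2 u2 s3 t3 f1 f2 f3 p1 p2 p3 : nat).
Hypothesis E : curve_data a b c s t u t1 u1 s2 u2 s3 t3 f1 f2 f3 p1 p2 p3.

Local Notation wt := (lin a b c).
Local Notation fd := (lin f1 f2 f3).
Local Notation wd := (weighted_degree a b c).
Local Notation rho1 := (@rho1 K a b c f1 f2 f3 p1 p2 p3).
Local Notation pi0 := (@pi0 K f1 f2 f3).
Local Notation f := (varz ^+ u - varx ^+ s3 * vary ^+ t3 : {mpoly K[3]}).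

(** The index [r] encodes the pair [(r / u, r mod u)]. The second entry is the exponent of [z]; the
    first is the quotient of the [x]-exponent by [b]. At least [a b] of the degree remains to be
    written as [x a + y b] with [x < b]. *)
Lemma many_monomials q D : (a * b * q.+1 + c * u <= D)%N ->
  exists M : nat -> 'X_{1..3},
    (forall r, (r < u * q.+1)%N -> wt (M r) = D /\ (M r 2%R < u)%N) /\
    (forall r r', (r < u * q.+1)%N -> (r' < u * q.+1)%N -> M r = M r' -> r = r').
Proof.
move=> leD; have [a0 b0 u0] := And3 (cd_a E) (cd_b E) (cd_u E).
have /choice[M MP] : forall r, exists m : 'X_{1..3}, (r < u * q.+1)%N ->
   [/\ wt m = D, m 2%R = (r %% u)%N & (m 0%R %/ b = r %/ u)%N].
  move=> r; have [lt|] := ltnP r (u * q.+1); last by exists 0%MM.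
  have ltk : (r %% u < u)%N by rewrite ltn_mod.
  have ltl : (r %/ u < q.+1)%N by rewrite ltn_divLR // mulnC.
  pose k := (r %% u)%N; pose l := (r %/ u)%N.
  have lek : (c * k <= c * u)%N by rewrite leq_mul2l (ltnW ltk) orbT.
  have lel : (a * b * l.+1 <= a * b * q.+1)%N by rewrite leq_mul2l ltl orbT.
  have le1 : (a * b <= D - c * k - a * b * l)%N by move: lel; rewrite mulnS; lia.
  have [x [y [ltx exy]]] := coprime_semigroup a0 b0 (cd_ab E) le1.
  exists (mon (x + l * b) y k) => _; split; rewrite ?monE //.
    by rewrite linE; move: lel; rewrite mulnS; lia.
  by rewrite addnC divnMDl // divn_small // addn0.
exists M; split=> [r lt|r r' lt lt' e].
  by have [-> -> _] := MP r lt; rewrite ltn_mod.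
have [_ e2 e0] := MP r lt; have [_ e2' e0'] := MP r' lt'.
by rewrite (divn_eq r u) (divn_eq r' u) -e2 -e0 -e2' -e0' e.
Qed.

Let U := (((1 : K) ^+ (u * c))%:P%:P * (('X + 1%:P) ^+ (f3 * u))%:P
  * ('X + 1%:P) ^+ (p1 * s3 + p2 * t3) : {poly {poly K}}).

Lemma rho1_f : rho1 f = U * 'X.
Proof. exact: (rho_f E). Qed.

Lemma coefU0 : U`_0 = ('X + 1%:P) ^+ (f3 * u).
Proof.
by rewrite /U expr1n !rmorph1 mul1r coefCM coef_X1n bin0 mulr1.
Qed.

Lemma rho1M g h : rho1 (g * h) = rho1 g * rho1 h.
Proof. exact: rmorphM. Qed.

Lemma rho1D g h : rho1 (g + h) = rho1 g + rho1 h.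
Proof. exact: rmorphD. Qed.

Lemma rho1B g h : rho1 (g - h) = rho1 g - rho1 h.
Proof. exact: rmorphB. Qed.

Lemma rho1X g n : rho1 (g ^+ n) = rho1 g ^+ n.
Proof. exact: rmorphXn. Qed.

Lemma pi0M g h : pi0 (g * h) = pi0 g * pi0 h.
Proof. exact: rmorphM. Qed.

Lemma pi0D g h : pi0 (g + h) = pi0 g + pi0 h.
Proof. exact: rmorphD. Qed.

Lemma pi0B g h : pi0 (g - h) = pi0 g - pi0 h.
Proof. exact: rmorphB. Qed.

Lemma pi0Xn g n : pi0 (g ^+ n) = pi0 g ^+ n.
Proof. exact: rmorphXn. Qed.

Lemma rho1_fX j g : rho1 (f ^+ j * g) = U ^+ j * rho1 g * 'X^j.
Proof. by rewrite rho1M rho1X rho1_f exprMn mulrAC. Qed.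

Lemma coef_rho1_fX_lt j g i : (i < j)%N -> (rho1 (f ^+ j * g))`_i = 0.
Proof. by move=> lt; rewrite rho1_fX coefMXn lt. Qed.

Lemma coef_rho1_fX_eq j g : (rho1 (f ^+ j * g))`_j =
  ('X + 1%:P) ^+ (f3 * u * j) * (pi0 g \Po ('X + 1%:P)).
Proof.
rewrite rho1_fX coefMXn ltnn subnn coef0M rho1_0 exprM -coefU0; congr (_ * _).
by elim: j => [|j IH]; rewrite ?expr0 ?coef1 // !exprS coef0M IH.
Qed.

Lemma fX_pihomog j D g : g \is D.-homog for wd ->
  f ^+ j * g \is (D + j * (u * c))%N.-homog for wd.
Proof.
move=> gD; rewrite addnC mulnC; apply: dhomogM => //; apply: dhomogMn.
exact: (f_homog K E).
Qed.

(* The coefficient of [W^j] can be corrected modulo [V^N] by adding a multiple of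
   [f^j], as soon as [N] monomials of the right degree are available. *)
Lemma lifting_step N j D (e : 'I_N -> 'X_{1..3}) (h : {mpoly K[3]}) :
  injective e -> (forall r, wt (e r) = D /\ (e r 2%R < u)%N) ->
  exists g, [/\ g \is D.-homog for wd, forall m, g@_m != 0 -> exists r, m = e r
    & 'X^N %| (rho1 (h + f ^+ j * g))`_j].
Proof.
move=> eI eP; have [|C dvd] := @sparse_interpolation K hK N
    (fun r => f3 * u * j + fd (e r))%N (- (rho1 h)`_j).
  move=> r r' /addnI ef; apply: eI; have [w z] := eP r; have [w' z'] := eP r'.
  by apply: (mon_eq_of_lin E) => //; rewrite w w'.
exists (\sum_r C r *: 'X_[e r]); split.
- by apply: rpred_sum => r _; rewrite dhomogZ // homogX; case: (eP r) => ->.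
- move=> m nz; have [//|no] := pselect (exists r, m = e r).
  case/eqP: nz; rewrite raddf_sum /= big1 // => r _; rewrite mcoeffZ mcoeffX.
  by case: eqP => [em|]; rewrite ?mulr0 //; case: no; exists r.
rewrite rho1D coefD coef_rho1_fX_eq -dvdpNr opprD.
rewrite (_ : ('X + 1%:P) ^+ _ * _ = \sum_r C r *: ('X + 1%:P) ^+ (f3 * u * j + fd (e r))) //.
have -> : pi0 (\sum_r C r *: 'X_[e r]) = \sum_r C r *: 'X^(fd (e r)).
  rewrite (_ : pi0 _ = \sum_r pi0 (C r *: 'X_[e r])); last exact: rmorph_sum.
  by apply: eq_bigr => r _; rewrite pi0Z pi0X.
rewrite rmorph_sum mulr_sumr; apply: eq_bigr => r _ /=.
by rewrite comp_polyZ comp_Xn_poly -scalerAr -exprD.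
Qed.

(** The coefficients of [W^0], [W^1], ... are corrected in turn, that of [W^k] modulo [V^(n - k)] by
    a multiple of [f^k]. Such multiples with [k > 0] do not change [pi0]. The resulting defect is
    [u (a b + c u)], whatever [m] is. *)
Lemma small_defect m : (0 < m)%N -> exists2 h : {mpoly K[3]},
  h \is (a * b * m + a * b + c * u)%N.-homog for wd
  & pi0 h != 0 /\ ordge (u * m) (rho1 h).
Proof.
move=> m0; have [a0 b0 u0] := And3 (cd_a E) (cd_b E) (cd_u E).
set d := (a * b * m + a * b + c * u)%N; pose n := (u * m)%N.
suff H k : (0 < k)%N -> (k <= n)%N -> exists2 h : {mpoly K[3]}, h \is d.-homog for wd
    & pi0 h != 0 /\ forall i, (i < k)%N -> 'X^(n - i) %| (rho1 h)`_i.
  have n0 : (0 < n)%N by rewrite muln_gt0 u0.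
  have [h hd [h0 dvd]] := H n n0 (leqnn n).
  by exists h => //; split=> //; apply/ordge_dvdp.
elim: k => // k IH _ lek; have [k0|k0] := posnP k.
  (* There are more than [n] monomials for [n] conditions: the first [n] correct [M n], whose own
     coefficient stays 1, so [pi0] is not zero. *)
  have [|M [MP MI]] := @many_monomials m d; first by rewrite mulnS /d; lia.
  have ltn : (n < u * m.+1)%N by rewrite mulnS /n; lia.
  pose e (r : 'I_n) := M r.
  have [||g [gd gs dvd]] := @lifting_step n 0 d e 'X_[M n].
  - move=> r r' /MI rr'; apply: val_inj; apply: rr'; apply: ltn_trans ltn; exact: ltn_ord.
  - by move=> r; apply: MP; apply: ltn_trans ltn; apply: ltn_ord.
  have [wn zn] := MP n ltn.
  have gn : g@_(M n) = 0.
    apply/eqP; apply: contraT => /gs[r /MI e']; have := e' ltn (ltn_trans (ltn_ord r) ltn).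
    by have := ltn_ord r => /[swap] <-; rewrite ltnn.
  exists ('X_[M n] + g); first by rewrite rpredD // homogX wn.
  split; last first.
    by move=> i; rewrite k0 ltnS leqn0 => /eqP ->; rewrite subn0 -[g]mul1r -(expr0 f).
  have hz : z_reduced u ('X_[M n] + g).
    apply: z_reducedD => i le; first rewrite mcoeffX.
      by case: eqP => // ei; move: le; rewrite -ei leqNgt zn.
    apply/eqP; apply: contraT => /gs[r er]; move: le.
    by rewrite er leqNgt; have [_ ->] := MP r (ltn_trans (ltn_ord r) ltn).
  have hd' : 'X_[M n] + g \is d.-homog for wd by rewrite rpredD // homogX wn.
  apply/eqP => p0; have := pi0_coef E hd' hz wn zn.
  by rewrite p0 coef0 mcoeffD mcoeffX eqxx gn addr0 => /esym/eqP; rewrite oner_eq0.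
have [h hd [h0 dvd]] := IH k0 (ltnW lek).
pose q := ((n - k) %/ u)%N; pose D := (d - k * (u * c))%N.
have neg := cd_neg E.
have leqm : (q <= m)%N.
  by rewrite /q -(mulnK m u0); apply: leq_div2r; rewrite /n mulnC leq_subr.
have lekq : (k <= u * (m - q))%N.
  have := leq_trunc_div (n - k) u; rewrite -/q mulnBr /n; lia.
(* The factor [f^k] uses degree [k u c], and since [k <= u (m - q)] and [u u c < a b], this is at
   most the [(m - q) a b] released by having [k] fewer conditions. *)
have led : (k * (u * c) + (a * b * q.+1 + c * u) <= d)%N.
  have le1 : (k * (u * c) <= (m - q) * (a * b))%N.
    apply: leq_trans (leq_mul lekq (leqnn _)) _.
    by rewrite [(u * (m - q))%N]mulnC -mulnA leq_mul2l mulnA (ltnW neg) orbT.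
  have : ((m - q) * (a * b) + a * b * q = a * b * m)%N.
    by rewrite mulnC -mulnDr subnK.
  by rewrite /d mulnS; lia.
have [|M [MP MI]] := @many_monomials q D; first by rewrite /D; lia.
have ltr (r : 'I_(n - k)) : (r < u * q.+1)%N.
  apply: ltn_trans (ltn_ord r) _; rewrite mulnC; exact: ltn_ceil.
have [||g [gd _ dvdg]] := @lifting_step (n - k) k D (fun r => M r) h.
- by move=> r r' /MI rr'; apply: val_inj; apply: rr'.
- by move=> r; apply: MP.
exists (h + f ^+ k * g); last split.
- rewrite rpredD //; have -> : d = (D + k * (u * c))%N by rewrite subnK //; lia.
  exact: fX_pihomog.
- by rewrite pi0D pi0M pi0Xn (pi0_f K E) expr0n eqn0Ngt k0 mul0r addr0.
move=> i; rewrite ltnS leq_eqVlt => /predU1P[->//|lt].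
by rewrite rho1D coefD coef_rho1_fX_lt // addr0 dvd.
Qed.

End Necessity.

Lemma coefM_neq0 (R : nzRingType) (p q : {poly R}) n : (p * q)`_n != 0 ->
  exists i, [/\ (i <= n)%N, p`_i != 0 & q`_(n - i) != 0].
Proof.
move=> nz; have [//|no] := pselect (exists i, [/\ (i <= n)%N, p`_i != 0 & q`_(n - i) != 0]).
case/eqP: nz; rewrite coefM big1 // => i _.
have [->|pi] := eqVneq p`_i 0; first by rewrite mul0r.
have [->|qi] := eqVneq q`_(n - i) 0; first by rewrite mulr0.
by case: no; exists i; split=> //; rewrite -ltnS.
Qed.

Lemma sum_neq0 (V : nmodType) (I : eqType) (r : seq I) (F : I -> V) :
  \sum_(i <- r) F i != 0 -> exists2 i, i \in r & F i != 0.
Proof.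
move=> nz; have [//|no] := pselect (exists2 i, i \in r & F i != 0).
case/eqP: nz; rewrite big_seq big1 // => i ir.
by apply/eqP; apply: contraT => Fi; case: no; exists i.
Qed.

(** * Additivity of defects and an element of defect zero *)

Section ZeroDefect.

Variables (K : fieldType) (hK : [pchar K] =i pred0).
Variables (a b c s t u t1 u1 s2 u2 s3 t3 f1 f2 f3 p1 p2 p3 : nat).
Hypothesis E : curve_data a b c s t u t1 u1 s2 u2 s3 t3 f1 f2 f3 p1 p2 p3.

Local Notation wd := (weighted_degree a b c).
Local Notation rhoT := (@rhoT K a b c f1 f2 f3 p1 p2 p3).
Local Notation rho1 := (@rho1 K a b c f1 f2 f3 p1 p2 p3).
Local Notation pi0 := (@pi0 K f1 f2 f3).
Local Notation P := (monomial_prime K a b c).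
Local Notation f := (varz ^+ u - varx ^+ s3 * vary ^+ t3 : {mpoly K[3]}).
Local Notation g1 := (varx ^+ s - vary ^+ t1 * varz ^+ u1 : {mpoly K[3]}).
Local Notation g2 := (vary ^+ t - varx ^+ s2 * varz ^+ u2 : {mpoly K[3]}).

Hypothesis genP : ideal_gen (mem [:: g1; g2; f]) =i P.

Lemma pi0_eq0 (h : {mpoly K[3]}) : (rho1 h)`_0 = 0 -> pi0 h = 0.
Proof.
rewrite rho1_0 => e; have := congr1 (fun q => q \Po ('X - 1%:P)) e.
rewrite -comp_polyA comp_polyD comp_polyC comp_polyX subrK comp_polyXr => ->.
by rewrite comp_polyC.
Qed.

(** Turns nonvanishing into that of a single coefficient, which can be followed through sums and
    products. *)
Lemma pi0_pihomog_neq0 d (h : {mpoly K[3]}) :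
  pi0 (pihomog wd d h) != 0 <-> exists j, (rhoT h)`_0`_j`_d != 0.
Proof.
split=> [nz|[j]]; last first.
  rewrite coef_rhoT rho1_0; apply: contraNneq => ->.
  by rewrite comp_polyC coef0.
have [//|no] := pselect (exists j, (rhoT h)`_0`_j`_d != 0).
case/eqP: nz; apply: pi0_eq0; apply/polyP=> j; rewrite coef0 -coef_rhoT.
by apply/eqP; apply: contraT => nz; case: no; exists j.
Qed.

(* The defect of [h] is [d u - n a b], which [order_bound] shows to be nonnegative. *)
Definition defect_pair n d (h : {mpoly K[3]}) : Prop :=
  [/\ h \in symbolic_power P n, h \is d.-homog for wd & pi0 h != 0].

Hypothesis noeR : noetherian (symbolic_rees_ring P).

(* Splits off one of the finitely many generators of the ideal of the elements
   with zero constant term in [T]. *)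
Lemma defect_split : exists M, forall n d h, (0 < n)%N -> defect_pair n d h ->
  exists n1 n2 d1 d2 r g, [/\ n = (n1 + n2)%N, d = (d1 + d2)%N, (0 < n2 <= M)%N,
    defect_pair n1 d1 r & defect_pair n2 d2 g].
Proof.
pose v : symbolic_rees_ring P -> {poly {mpoly K[3]}} := @symbolic_rees_val _ _.
have v0 : v 0 = 0 by exact: (rmorph0 (val : {rmorphism symbolic_rees_ring P -> _})).
have vD x y : v (x + y) = v x + v y.
  exact: (rmorphD (val : {rmorphism symbolic_rees_ring P -> _})).
have vM x y : v (x * y) = v x * v y.
  exact: (rmorphM (val : {rmorphism symbolic_rees_ring P -> _})).
have vP x n : (v x)`_n \in symbolic_power P n.
  by have /asboolP := symbolic_rees_valP x; apply.
pose J : {pred symbolic_rees_ring P} := fun F => (v F)`_0 == 0.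
have idJ : is_ideal J.
  split=> [|x y|e x]; rewrite !unfold_in.
  - by rewrite v0 coef0.
  - by move=> /eqP x0 /eqP y0; rewrite vD coefD x0 y0 addr0.
  - by move=> /eqP x0; rewrite vM coef0M x0 mulr0.
have [l lJ] := noetherian_ideal noeR idJ.
exists (\max_(x <- l) size (v x))%N => n d h n0 [hS hd h0].
have hR : h%:P * 'X^n \in symbolic_rees P.
  apply/asboolP=> i; rewrite coefCM coefXn; case: eqP => [->|_]; first by rewrite mulr1.
  by rewrite mulr0; apply: symbolic_power0.
pose F := SymbolicRees hR.
have vF : v F = h%:P * 'X^n by [].
have : F \in ideal_gen (mem l).
  by rewrite lJ unfold_in vF coefCM coefXn (ltn_eqF n0) mulr0.
move=> /ideal_genP[w wl eF].
have evF : h = \sum_(z <- w) (v z.1 * v z.2)`_n.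
  have <- : (v F)`_n = h by rewrite vF coefCM coefXn eqxx mulr1.
  rewrite eF; elim: w {wl eF} => [|z w IH]; first by rewrite !big_nil v0 coef0.
  by rewrite !big_cons vD vM coefD IH.
(* A nonzero coefficient of a sum of products selects a summand, a splitting of [n], and a splitting
   of [d]. The matching homogeneous components of the two factors are the desired pairs. *)
have /pi0_pihomog_neq0[j] : pi0 (pihomog wd d h) != 0 by rewrite pihomog_dE.
rewrite {1}evF.
have -> : rhoT (\sum_(z <- w) (v z.1 * v z.2)`_n) = \sum_(z <- w) rhoT (v z.1 * v z.2)`_n.
  exact: rmorph_sum.
rewrite !coef_sum => /sum_neq0[z zw].
rewrite coefM.
have -> : rhoT (\sum_(i < n.+1) (v z.1)`_i * (v z.2)`_(n - i))
    = \sum_(i < n.+1) rhoT ((v z.1)`_i * (v z.2)`_(n - i)) by exact: rmorph_sum.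
rewrite !coef_sum => /sum_neq0[i _].
have -> : rhoT ((v z.1)`_i * (v z.2)`_(n - i)) = rhoT (v z.1)`_i * rhoT (v z.2)`_(n - i).
  exact: rmorphM.
rewrite coef0M => nz.
have := nz; rewrite coefM coef_sum => /sum_neq0[j2 _ /coefM_neq0[d1 [led nz1 nz2]]].
have z2J : (v z.2)`_0 = 0.
  have : z.2 \in J by rewrite -lJ; apply: mem_ideal_gen; apply: wl.
  by rewrite unfold_in => /eqP.
have ltin : (i < n)%N.
  have := ltn_ord i; rewrite ltnS leq_eqVlt => /predU1P[ei|//].
  move: nz2; rewrite ei subnn z2J.
  by rewrite (_ : rhoT 0 = 0) ?coef0 ?eqxx //; exact: rmorph0.
exists (i : nat), (n - i)%N, d1, (d - d1)%N.
exists (pihomog wd d1 (v z.1)`_i), (pihomog wd (d - d1) (v z.2)`_(n - i)).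
split; rewrite ?subnKC ?(ltnW ltin) ?subn_gt0 ?ltin //.
- have : (n - i < size (v z.2))%N.
    rewrite ltnNge; apply: contra nz2 => /leq_sizeP/(_ _ (leqnn _)) ->.
    by rewrite (_ : rhoT 0 = 0) ?coef0 //; exact: rmorph0.
  move=> lt; apply: (leq_trans (ltnW lt)); apply: (leq_bigmax_seq _ _ isT).
  exact: wl.
- split; [exact: (symbolic_pihomog E genP _ (vP _ _))|exact: pihomogP|].
  by apply/pi0_pihomog_neq0; exists j2.
- split; [exact: (symbolic_pihomog E genP _ (vP _ _))|exact: pihomogP|].
  by apply/pi0_pihomog_neq0; exists (j - j2)%N.
Qed.

(** If no defect were zero, each split would lower the defect by at least 1 and [n] by at most [M],
    so [n] would be bounded by [M] times the defect. The elements of [small_defect] have constant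
    defect and unbounded [n]. *)
Lemma zero_defect : exists m (h : {mpoly K[3]}), [/\ (0 < m)%N,
  h \is (a * b * m)%N.-homog for wd, ordge (u * m) (rho1 h)
  & pi0 h = 'X^(f2 * (a * m)) * ('X - 1%:P) ^+ (u * m)].
Proof.
have [u0 a0 b0] := And3 (cd_u E) (cd_a E) (cd_b E).
have dvdS n d h : defect_pair n d h -> ('X - 1%:P) ^+ n %| pi0 h.
  by move=> [hS hd _]; apply: (symbolic_pi0 E genP hd hS).
suff [n [d [h [n0 dh edn]]]] : exists n d h,
    [/\ (0 < n)%N, defect_pair n d h & (d * u = n * (a * b))%N].
  have [hS hd h0] := dh.
  have [m [l [ed en l0 eh]]] := order_exact E hd h0 (dvdS _ _ _ dh) edn.
  exists m, (l^-1 *: h); split.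
  - by rewrite lt0n; apply: contraTneq n0 => m0; rewrite en m0 muln0.
  - by rewrite dhomogZ // -ed.
  - rewrite -en; apply/(ordge_rhoT_homog f1 f2 f3 p1 p2 p3 _ (dhomogZ _ hd)).
    apply/(symbolic_power_ordge E genP).
    have [_ _ SM] := is_ideal_symbolic E genP n.
    by rewrite -mul_mpolyC; apply: SM.
  - by rewrite pi0Z eh scalerA mulVf // scale1r.
have [//|none] := pselect (exists n d h,
    [/\ (0 < n)%N, defect_pair n d h & (d * u = n * (a * b))%N]).
exfalso; have [M split_M] := defect_split.
have bound B n d h : defect_pair n d h -> (d * u <= n * (a * b) + B)%N -> (n <= M * B)%N.
  elim: B n d h => [|B IH] n d h dh le; have [->//|n0] := posnP n.
    have [_ hd h0] := dh; have := order_bound E hd h0 (dvdS _ _ _ dh) => le'.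
    case: none; exists n, d, h; split=> //; apply/eqP.
    by rewrite eqn_leq le' -[X in (_ <= X)%N]addn0 le.
  have [n1 [n2 [d1 [d2 [r [g [en ed /andP[n20 n2M] dr dg]]]]]]] := split_M _ _ _ n0 dh.
  have [_ rd r0] := dr; have [_ gd g0] := dg.
  have le1 := order_bound E rd r0 (dvdS _ _ _ dr).
  have le2 := order_bound E gd g0 (dvdS _ _ _ dg).
  have ne : (d2 * u != n2 * (a * b))%N.
    by apply/eqP => e; case: none; exists n2, d2, g.
  have := IH _ _ _ dr; rewrite en mulnS => /(_ _)/leq_trans.
  have lt2 : (n2 * (a * b) < d2 * u)%N by rewrite ltn_neqAle eq_sym ne.
  move: le; rewrite en ed !mulnDl => le H; rewrite addnC leq_add //.
  by apply: H (leqnn _); clear - le lt2; lia.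
pose B := (u * (a * b + c * u))%N.
have [h hd [h0 oh]] := small_defect hK E (ltn0Sn (M * B)).
have dh : defect_pair (u * (M * B).+1) (a * b * (M * B).+1 + a * b + c * u)%N h.
  split=> //.
  by apply/(symbolic_power_ordge E genP)/(ordge_rhoT_homog f1 f2 f3 p1 p2 p3 _ hd).
have : (u * (M * B).+1 <= M * B)%N.
  by apply: (bound B _ _ _ dh); rewrite {2}/B; clear; lia.
by rewrite leqNgt -{1}[(M * B)%N]mul1n (leq_trans _ (leq_mul u0 (leqnn _))) // mul1n.
Qed.

End ZeroDefect.

(** * Necessity: extracting a root *)

Lemma coef_Xsub1n (R : nzRingType) n i :
  (('X - 1%:P : {poly R}) ^+ n)`_i = (-1) ^+ (n + i) *+ 'C(n, i).
Proof.
elim: n i => [|n IH] i.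
  by rewrite expr0 coef1 bin0n; case: i.
rewrite exprS mulrBl mul1r coefB coefXM !IH.
case: i => [|i] /=; first by rewrite sub0r !bin0 addSn exprS mulN1r.
have -> : (-1) ^+ (n + i.+1) = - (-1) ^+ (n + i) :> R by rewrite addnS exprS mulN1r.
have -> : (-1) ^+ (n.+1 + i.+1) = (-1) ^+ (n + i) :> R.
  by rewrite addSn addnS !exprS !mulN1r opprK.
by rewrite binS mulrnDr mulNrn opprK addrC.
Qed.

Lemma expr_add2 (R : comNzRingType) (x y : R) m : exists r,
  (x + y) ^+ m = x ^+ m + m%:R * x ^+ m.-1 * y + y ^+ 2 * r.
Proof.
elim: m => [|m [r e]]; first by exists 0; rewrite !expr0 !mul0r mulr0 !addr0.
case: m e => [|m] e.
  by exists 0; rewrite /= expr0 !expr1 mulr0 addr0 !mul1r.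
exists ((x + y) * r + m.+1%:R * x ^+ m).
rewrite exprS e /= -[in RHS]natr1 [in RHS]exprS [x ^+ m.+1]exprS; ring.
Qed.

(* The coefficient of [W^j] in an [m]-th power is affine in the coefficient of
   [W^j] of the root, up to a term of high order in [V]. *)
Lemma coef_root (K : fieldType) (A : {poly {poly K}}) m u j : (0 < m)%N -> (0 < j)%N ->
  (forall i, (i < j)%N -> 'X^(u - i) %| A`_i) -> (j < u * m)%N ->
  'X^(u * m - j) %| (A ^+ m)`_j - m%:R * A`_0 ^+ m.-1 * A`_j.
Proof.
move=> m0 j0 dA ltj; pose T := take_poly j A; pose C := drop_poly j A.
have oT : ordge u T.
  move=> i k lt; rewrite coef_take_poly; case: ltnP => [lti|_]; last by rewrite coef0.
  by have /dvdp_XnP := dA i lti; apply; lia.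
have T0 : T`_0 = A`_0 by rewrite coef_take_poly j0.
have C0 : C`_0 = A`_j by rewrite coef_drop_poly add0n.
have X0 (x : {poly {poly K}}) n : (x ^+ n)`_0 = x`_0 ^+ n.
  by elim: n => [|n IH]; rewrite ?expr0 ?coef1 // !exprS coef0M IH.
have [r er] := expr_add2 T (C * 'X^j) m.
have eA : A ^+ m = T ^+ m + m%:R * T ^+ m.-1 * C * 'X^j + (C ^+ 2 * r) * 'X^(j + j).
  rewrite -[A in LHS](poly_take_drop j) -/T -/C er exprMn -exprM muln2 -addnn; ring.
have -> : (A ^+ m)`_j = (T ^+ m)`_j + m%:R * A`_0 ^+ m.-1 * A`_j.
  rewrite eA !coefD !coefMXn ltnn subnn -{2}[j]addn0 ltn_add2l j0 addr0.
  by rewrite !coef0M X0 T0 C0 -[m%:R in LHS]polyC_natr coefC.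
rewrite addrK; apply/dvdp_XnP => k lt; apply: (ordgeX (n := m) oT); lia.
Qed.

(** The quadratic term in [T] starts at index [2 j > j], so up to index [j] the Newton correction
    acts linearly. *)
Lemma coef_pow_perturb (R : comNzRingType) (A T : {poly R}) m j i : (0 < j)%N ->
  (forall i, (i < j)%N -> T`_i = 0) -> (i <= j)%N ->
  ((A - T) ^+ m)`_i = (A ^+ m)`_i - m%:R * A`_0 ^+ m.-1 * T`_i.
Proof.
move=> j0 T0 leij; have [r ->] := expr_add2 A (- T) m.
have eT : T = drop_poly j T * 'X^j.
  rewrite -[LHS](poly_take_drop j) [take_poly j T](_ : _ = 0) ?add0r //.
  by apply/polyP=> k; rewrite coef_take_poly coef0; case: ltnP => // /T0.
have X0 (x : {poly R}) n : (x ^+ n)`_0 = x`_0 ^+ n.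
  by elim: n => [|n IH]; rewrite ?expr0 ?coef1 // !exprS coef0M IH.
have eT2 : T ^+ 2 * r = drop_poly j T ^+ 2 * r * 'X^(j + j).
  by rewrite {1}eT exprMn -exprM muln2 -addnn mulrAC.
have -> : (A ^+ m + m%:R * A ^+ m.-1 * - T + (- T) ^+ 2 * r)`_i
    = (A ^+ m)`_i - (m%:R * A ^+ m.-1 * T)`_i.
  rewrite sqrrN eT2 !coefD mulrN coefN coefMXn (leq_ltn_trans leij) ?addr0 //.
  by rewrite -{1}[j]addn0 ltn_add2l.
congr (_ - _); rewrite {1}eT mulrA coefMXn.
move: leij; rewrite leq_eqVlt => /predU1P[->|lt]; last by rewrite lt (T0 _ lt) mulr0.
rewrite ltnn subnn !coef0M X0 coef_drop_poly add0n -[m%:R in LHS]polyC_natr coefC.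
by rewrite eqxx.
Qed.

Section Root.

Variables (K : fieldType) (hK : [pchar K] =i pred0).
Variables (a b c s t u t1 u1 s2 u2 s3 t3 f1 f2 f3 p1 p2 p3 : nat).
Hypothesis E : curve_data a b c s t u t1 u1 s2 u2 s3 t3 f1 f2 f3 p1 p2 p3.

Local Notation wt := (lin a b c).
Local Notation fd := (lin f1 f2 f3).
Local Notation wd := (weighted_degree a b c).
Local Notation rho1 := (@rho1 K a b c f1 f2 f3 p1 p2 p3).
Local Notation pi0 := (@pi0 K f1 f2 f3).
Local Notation f := (varz ^+ u - varx ^+ s3 * vary ^+ t3 : {mpoly K[3]}).

Variables (m : nat) (h : {mpoly K[3]}).
Hypotheses (m0 : (0 < m)%N) (hd : h \is (a * b * m)%N.-homog for wd).
Hypothesis oh : ordge (u * m) (rho1 h).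
Hypothesis eh : pi0 h = 'X^(f2 * (a * m)) * ('X - 1%:P) ^+ (u * m).

(* A monomial of degree [a b m] close to [y^(a m)] and its translate close to
   [x^(b m)] agree up to [y^(a (m - 1))] and [x^(b (m - 1))]. *)
Lemma degree_ab_monomial i : (i <= u)%N -> exists m' : 'X_{1..3},
  [/\ wt m' = (a * b)%N, (m' 2%R < u)%N & fd m' = (f2 * a + i)%N].
Proof.
move=> lei; have [g [r [e rd rz _]]] := z_reduction E hd.
have er : pi0 r = pi0 h.
  by rewrite e (pi0D f1 f2 f3) (pi0M f1 f2 f3) (pi0_f K E) mul0r add0r.
have mon_at k : (k <= u * m)%N -> exists m' : 'X_{1..3},
    [/\ wt m' = (a * b * m)%N, (m' 2%R < u)%N & fd m' = (f2 * (a * m) + k)%N].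
  move=> lek; have [|m' m'r em'] := @pi0_supp K f1 f2 f3 r (f2 * (a * m) + k).
    rewrite er eh coefXnM ltnNge leq_addr /= addKn coef_Xsub1n -mulr_natr.
    by rewrite mulf_neq0 ?signr_eq0 // (natr_neq0 hK) // bin_gt0.
  by exists m'; split; [exact: homog_wt rd m'r|exact: z_reduced_supp rz m'r|].
have [k1 [w1 z1 e1]] := mon_at i (leq_trans lei (leq_pmulr _ m0)).
have le2 : (i + u * m.-1 <= u * m)%N by rewrite -{2}(prednK m0) mulnS leq_add2r.
have [k2 [w2 z2 e2]] := mon_at _ le2.
(* Both sides have the same weight and [fd], as [x^b] exceeds [y^a] by [u], so [mon_eq_of_lin]
   identifies them. Hence [y^(a (m - 1))] divides [k1], and the quotient has degree [a b]. *)
have eqk : (k1 + mon (b * m.-1) 0 0)%MM = (k2 + mon 0 (a * m.-1) 0)%MM.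
  apply: (mon_eq_of_lin E).
  - by rewrite !linD !linE w1 w2; lia.
  - rewrite !linD !linE e1 e2; have := cd_f1b E; clear; nia.
  - by rewrite mnmDE monE addn0.
  - by rewrite mnmDE monE addn0.
have e1k : (k1 1%R = k2 1%R + a * m.-1)%N.
  by have := congr1 (fun k : 'X_{1..3} => k 1%R) eqk; rewrite !mnmDE !monE addn0.
pose k := (k1 - mon 0 (a * m.-1) 0)%MM.
have ek : k1 = (k + mon 0 (a * m.-1) 0)%MM.
  by rewrite submK // mon_lem e1k leq_addl.
exists k; split.
- by move: w1; rewrite ek linD linE -{2}(prednK m0); clear; nia.
- by move: z1; rewrite ek mnmDE monE addn0.
by move: e1; rewrite ek linD linE -{2}(prednK m0); clear; nia.
Qed.

Lemma root_mod_f : exists eta0, [/\ eta0 \is (a * b)%N.-homog for wd,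
  pi0 eta0 = 'X^(f2 * a) * ('X - 1%:P) ^+ u & eta0@_(mon 0 a 0) != 0].
Proof.
have /choice[M MP] : forall i : 'I_u.+1, exists m' : 'X_{1..3},
    [/\ wt m' = (a * b)%N, (m' 2%R < u)%N & fd m' = (f2 * a + i)%N].
  by move=> i; apply: degree_ab_monomial; rewrite -ltnS.
pose q : {poly K} := ('X - 1%:P) ^+ u.
exists (\sum_(i < u.+1) q`_i *: 'X_[M i]).
set eta0 := \sum_(i < _) _.
have ed : eta0 \is (a * b)%N.-homog for wd.
  by apply: rpred_sum => i _; rewrite dhomogZ // homogX; have [-> _ _] := MP i.
have ep : pi0 eta0 = 'X^(f2 * a) * q.
  rewrite (_ : pi0 eta0 = \sum_(i < u.+1) pi0 (q`_i *: 'X_[M i])); last exact: rmorph_sum.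
  have sq : size q = u.+1 by rewrite size_exp_XsubC.
  rewrite -[q in RHS]coefK poly_def sq mulr_sumr; apply: eq_bigr => i _.
  by rewrite pi0Z pi0X; have [_ _ ->] := MP i; rewrite exprD scalerAr.
split=> //.
have := @pi0_lowcoef K _ _ _ _ _ _ _ _ _ _ _ _ _ _ _ _ _ _ E 1 eta0.
rewrite !muln1 => <- //; rewrite ep coefXnM ltnn subnn coef_Xsub1n bin0 mulr1n.
by rewrite signr_eq0.
Qed.

(** Each vanishing coefficient in [W] yields one factor [f] by [dvd_f_of_pi0]. Removing it shifts
    the remaining coefficients, up to a factor whose leading coefficient in [W] is nonzero. *)
Lemma dvd_fX_of_coef j D (F : {mpoly K[3]}) : F \is (D + j * (u * c))%N.-homog for wd ->
  (forall i, (i < j)%N -> (rho1 F)`_i = 0) ->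
  exists2 G, F = f ^+ j * G & G \is D.-homog for wd.
Proof.
elim: j F => [|j IH] F Fd F0.
  by exists F; rewrite ?expr0 ?mul1r //; move: Fd; rewrite mul0n addn0.
have [G1 eF G1d] := dvd_f_of_pi0 E Fd (pi0_eq0 (F0 0%N isT)).
have [||G eG Gd] := IH G1; [by apply: G1d; lia| |].
  move=> i; have [n] := ubnP i; elim: n i => // n IHn i lti ltj.
  have := F0 i.+1 ltj; rewrite eF.
  have -> : rho1 (f * G1) = rho1 (f ^+ 1 * G1) by rewrite expr1.
  rewrite (rho1_fX E) expr1 coefMXn /= subSS subn0 coefM big_ord_recl /= subn0.
  rewrite big1 => [|k _]; last first.
    by rewrite IHn ?mulr0 //; rewrite /bump /=; have := ltn_ord k; lia.
  rewrite addr0 (coefU0 K) => /eqP; rewrite mulf_eq0 expf_eq0 => /orP[/andP[_]|/eqP //].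
  by rewrite -[1%:P]opprK -rmorphN /= polyXsubC_eq0.
by exists G; rewrite // eF eG exprS mulrA.
Qed.

Lemma coprime_XD1 k n : coprimep ('X^n : {poly K}) (('X + 1%:P) ^+ k).
Proof.
apply: coprimep_expl; apply: coprimep_expr; rewrite coprimep_sym coprimepX.
by rewrite /root hornerD hornerX hornerC add0r oner_eq0.
Qed.

(* Newton iteration for the [m]-th root of [h] along the powers of [f]. *)
Lemma root_iteration eta0 j : eta0 \is (a * b)%N.-homog for wd ->
  pi0 eta0 = 'X^(f2 * a) * ('X - 1%:P) ^+ u -> eta0@_(mon 0 a 0) != 0 ->
  (0 < j)%N -> (j <= u)%N -> exists e, [/\ e \is (a * b)%N.-homog for wd,
    pi0 e = pi0 eta0, forall i, (i < j)%N -> (rho1 e ^+ m)`_i = (rho1 h)`_i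
    & forall i, (i < j)%N -> 'X^(u - i) %| (rho1 e)`_i].
Proof.
move=> ed ep ey; elim: j => // j IH _ lej; have [j0|j0] := posnP j.
  exists eta0; split=> // i; rewrite j0 ltnS leqn0 => /eqP->.
    have X0 (x : {poly {poly K}}) n : (x ^+ n)`_0 = x`_0 ^+ n.
      by elim: n => [|n IHn]; rewrite ?expr0 ?coef1 // !exprS coef0M IHn.
    rewrite X0 !rho1_0 -rmorphXn /= ep eh exprMn -!exprM.
    by rewrite mulnA.
  by rewrite rho1_0 subn0 dvdp_shift ep dvdp_mulIr.
have [e [ed' ep' er edv]] := IH j0 (ltnW lej).
have u0 := cd_u E; have neg := cd_neg E.
have leab : (j * (u * c) <= a * b)%N.
  by apply: leq_trans (ltnW neg); rewrite -mulnA leq_mul2r (ltnW lej) orbT.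
have leabm : (a * b <= a * b * m)%N by rewrite leq_pmulr.
set A := rho1 e in er edv *; pose H := rho1 h.
have A0 : A`_0 = ('X + 1%:P) ^+ (f2 * a) * 'X^u.
  rewrite /A rho1_0 ep' ep comp_polyM comp_Xn_poly rmorphXn /=.
  by rewrite comp_polyB comp_polyX comp_polyC addrK.
have A0m : A`_0 ^+ m.-1 = ('X + 1%:P) ^+ (f2 * a * m.-1) * 'X^(u * m.-1).
  by rewrite A0 exprMn -!exprM.
have um : (u * m = u * m.-1 + u)%N by rewrite -{1}(prednK m0) mulnS addnC.
have ltum : (j < u * m)%N by rewrite um; apply: leq_trans lej (leq_addl _ _).
have dvdH : 'X^(u * m - j) %| H`_j.
  by apply/dvdp_XnP => k lt; apply: oh; rewrite -ltn_subRL.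
have Fd : e ^+ m - h \is (a * b * m - j * (u * c) + j * (u * c))%N.-homog for wd.
  by rewrite subnK ?(leq_trans leab) // rpredB //; apply: dhomogMn.
have rF : rho1 (e ^+ m - h) = A ^+ m - H.
  by rewrite (rho1B a b c f1 f2 f3 p1 p2 p3) (rho1X a b c f1 f2 f3 p1 p2 p3).
have [|g eF gd] := dvd_fX_of_coef Fd.
  by move=> i lt; rewrite rF coefB er // subrr.
have eFj : (A ^+ m)`_j - H`_j = ('X + 1%:P) ^+ (f3 * u * j) * (pi0 g \Po ('X + 1%:P)).
  by rewrite -coefB -rF eF (coef_rho1_fX_eq E).
(* The correction must solve a linear equation with factor [m A_0^(m - 1)], so the error has to be
   divisible by [pi0 eta0 ^ (m - 1)]. By [coef_root] it vanishes to the required order, and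
   [eta_pow_division] makes the quotient a homogeneous [G]. *)
have dvdg : ('X - 1%:P) ^+ (m.-1 * u) %| pi0 g.
  rewrite -dvdp_shift mulnC -(Gauss_dvdpr _ (coprime_XD1 (f3 * u * j) _)) -eFj.
  have dvdA := coef_root m0 j0 edv ltum.
  rewrite -[(A ^+ m)`_j](subrK (m%:R * A`_0 ^+ m.-1 * A`_j)).
  have le : (u * m.-1 <= u * m - j)%N by rewrite um -addnBA ?leq_addr // ltnW.
  have dvdle q : 'X^(u * m - j) %| q -> 'X^(u * m.-1) %| q.
    by apply: dvdp_trans; apply: dvdp_exp2l.
  apply: dvdp_sub; last exact: dvdle dvdH.
  apply: dvdp_add; first exact: dvdle dvdA.
  by rewrite A0m dvdp_mulr // mulrA dvdp_mulIr.
have eta_order : ('X - 1%:P) ^+ u %| pi0 eta0 by rewrite ep dvdp_mulIr.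
have [G eG Gd] := eta_pow_division hK E ed ey eta_order gd dvdg.
have rZ k x : rho1 (k *: x) = k%:P%:P * rho1 x by exact: rhoZ.
have qd : m%:R^-1 *: (f ^+ j * G) \is (a * b)%N.-homog for wd.
  have eD : (a * b = a * b * m - j * (u * c) - m.-1 * (a * b) + j * (u * c))%N.
    have abm : (a * b * m = a * b + m.-1 * (a * b))%N.
      by rewrite mulnC -{1}(prednK m0) mulSn.
    by move: leab; rewrite abm; clear; lia.
  by rewrite dhomogZ // eD; apply: (fX_pihomog E j Gd).
have q0 : pi0 (m%:R^-1 *: (f ^+ j * G)) = 0.
  rewrite pi0Z (pi0M f1 f2 f3) (pi0Xn f1 f2 f3) (pi0_f K E).
  by rewrite expr0n eqn0Ngt j0 mul0r scaler0.
pose q := m%:R^-1 *: (f ^+ j * G); pose T := rho1 q.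
have T0 i : (i < j)%N -> T`_i = 0.
  by move=> lt; rewrite /T /q rZ coefCM (coef_rho1_fX_lt E) // mulr0.
have Tj : m%:R * A`_0 ^+ m.-1 * T`_j = (A ^+ m)`_j - H`_j.
  rewrite eFj eG /T /q rZ coefCM (coef_rho1_fX_eq E) /A rho1_0 ep' comp_polyM.
  rewrite [comp_poly _ (_ ^+ _)]rmorphXn /=.
  have mm : m%:R * (m%:R^-1)%:P = 1 :> {poly K}.
    by rewrite -polyC_natr -rmorphM /= mulfV ?(natr_neq0 hK) // polyC1.
  by rewrite mulrACA mm mul1r mulrCA.
have re' : rho1 (e - q) = A - T by rewrite (rho1B a b c f1 f2 f3 p1 p2 p3).
have ed'' : e - q \is (a * b)%N.-homog for wd by rewrite rpredB.
have ep'' : pi0 (e - q) = pi0 eta0 by rewrite (pi0B f1 f2 f3) q0 subr0.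
clearbody T; move: re' ed'' ep''; set e' := e - q; clearbody e' => re' ed'' ep''.
clear q qd q0.
have pertl i : (i <= j)%N -> (rho1 e' ^+ m)`_i = H`_i.
  move=> le; rewrite re' (coef_pow_perturb _ _ j0 T0 le).
  move: le; rewrite leq_eqVlt => /predU1P[->|lt].
    by rewrite Tj opprB addrC subrK.
  by rewrite (T0 _ lt) mulr0 subr0 er.
have e'i i : (i < j)%N -> (rho1 e')`_i = A`_i.
  by move=> lt; rewrite re' coefB (T0 _ lt) subr0.
exists e'; split=> //.
move=> i; rewrite ltnS leq_eqVlt => /predU1P[->|lt]; last by rewrite e'i // edv.
have dvd' : forall k, (k < j)%N -> 'X^(u - k) %| (rho1 e')`_k.
  by move=> k lt; rewrite e'i // edv.
(* [coef_root] read backwards: the coefficient of [W^j] in the power is now that of [h], hence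
   divisible by [V^(u m - j)]. Cancelling [V^(u (m - 1))] from [A_0^(m - 1)] leaves [V^(u - j)]. *)
have := coef_root m0 j0 dvd' ltum; 
rewrite (pertl _ (leqnn j)) (dvdp_subr _ dvdH) (e'i _ j0) A0m.
have -> : (u * m - j = u * m.-1 + (u - j))%N by rewrite um addnBA // ltnW.
rewrite -polyC_natr mul_polyC -scalerAl dvdpZr ?(natr_neq0 hK) //.
rewrite exprD [_ * 'X^(u * m.-1)]mulrC -mulrA dvdp_mul2l; last first.
  by rewrite expf_neq0 // polyX_eq0.
by rewrite Gauss_dvdpr // coprime_XD1.
Qed.

End Root.

Section Necessary.

Variables (K : fieldType) (hK : [pchar K] =i pred0).
Variables (a b c s t u t1 u1 s2 u2 s3 t3 f1 f2 f3 p1 p2 p3 : nat).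
Hypothesis E : curve_data a b c s t u t1 u1 s2 u2 s3 t3 f1 f2 f3 p1 p2 p3.

Local Notation wd := (weighted_degree a b c).
Local Notation P := (monomial_prime K a b c).
Local Notation f := (varz ^+ u - varx ^+ s3 * vary ^+ t3 : {mpoly K[3]}).
Local Notation g1 := (varx ^+ s - vary ^+ t1 * varz ^+ u1 : {mpoly K[3]}).
Local Notation g2 := (vary ^+ t - varx ^+ s2 * varz ^+ u2 : {mpoly K[3]}).

Hypothesis genP : ideal_gen (mem [:: g1; g2; f]) =i P.

Theorem noetherian_eta : noetherian (symbolic_rees_ring P) ->
  exists eta, [/\ eta \in symbolic_power P u, eta \is (a * b)%N.-homog for wd
    & eta@_(mon 0 a 0) != 0].
Proof.
move=> noeR; have [m [h [m0 hd oh eh]]] := zero_defect hK E genP noeR.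
have [eta0 [ed ep ey]] := root_mod_f hK E m0 hd eh.
have [e [ed' ep' _ dvd]] := root_iteration hK E m0 hd oh eh ed ep ey (cd_u E) (leqnn u).
exists e; split=> //.
  apply/(symbolic_power_ordge E genP)/(ordge_rhoT_homog f1 f2 f3 p1 p2 p3 _ ed').
  by apply/ordge_dvdp.
have := @pi0_lowcoef K _ _ _ _ _ _ _ _ _ _ _ _ _ _ _ _ _ _ E 1 e.
have := @pi0_lowcoef K _ _ _ _ _ _ _ _ _ _ _ _ _ _ _ _ _ _ E 1 eta0.
by rewrite !muln1 ep' => e1 <- //; rewrite e1.
Qed.

End Necessary.

(** * Minimal generation, the numerical hypothesis and the conclusion *)

Lemma minimally_generated_drop (R : comNzRingType) (I : {pred R}) s1 g s2 :
  minimally_generated_by I (s1 ++ g :: s2) -> g \notin ideal_gen (mem (s1 ++ s2)).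
Proof.
move=> [genI minI]; apply/negP => gs; apply: (minI (s1 ++ s2)).
- by rewrite cat_subseq // subseq_cons.
- by apply/eqP => /(congr1 size); rewrite !size_cat /=; lia.
move=> h; rewrite -genI; apply/idP/idP; last first.
  apply: ideal_gen_subP; first exact: is_ideal_gen.
  move=> k; rewrite -[_ \in mem _]/(k \in s1 ++ g :: s2) mem_cat inE orbCA -mem_cat.
  by move=> /orP[/eqP->//|ks]; apply: mem_ideal_gen.
apply: ideal_gen_mono => k ks; have : k \in s1 ++ s2 by [].
rewrite -[is_true (k \in mem _)]/(is_true (k \in s1 ++ g :: s2)).
by rewrite !mem_cat inE orbCA => ->; rewrite orbT.
Qed.

Lemma minimally_generated_sum (R : comNzRingType) (I : {pred R}) (g1 g2 g3 : R) :
  minimally_generated_by I [:: g1; g2; g3] ->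
  [/\ g1 + g2 <> 0, g2 + g3 <> 0, g1 + g3 <> 0 & g1 + g2 + g3 <> 0].
Proof.
move=> mg; have /negP n2 := minimally_generated_drop (s1 := [:: g1]) mg.
have /negP n3 := minimally_generated_drop (s1 := [:: g1; g2]) mg.
have g13 : g1 \in ideal_gen (mem [:: g1; g3]).
  by apply: mem_ideal_gen; rewrite [_ \in _]mem_head.
have g12 : g1 \in ideal_gen (mem [:: g1; g2]).
  by apply: mem_ideal_gen; rewrite [_ \in _]mem_head.
have g22 : g2 \in ideal_gen (mem [:: g1; g2]).
  by apply: mem_ideal_gen; rewrite [_ \in _]inE mem_head orbT.
split=> /eqP; rewrite addr_eq0 => /eqP e.
- by apply: n2; rewrite -[g2]opprK -e rpredN.
- by apply: n3; rewrite -[g3]opprK -e rpredN.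
- by apply: n3; rewrite -[g3]opprK -e rpredN.
by apply: n3; rewrite -[g3]opprK -e rpredN rpredD.
Qed.

Lemma binomials_irredundant (K : fieldType) (I : {pred {mpoly K[3]}})
    s t u t1 u1 s2 u2 s3 t3 :
  minimally_generated_by I
    [:: varx ^+ s - vary ^+ t1 * varz ^+ u1;
        vary ^+ t - varx ^+ s2 * varz ^+ u2;
        varz ^+ u - varx ^+ s3 * vary ^+ t3] ->
  ~ binomials_redundant s t u t1 u1 s2 u2 s3 t3.
Proof.
move=> /minimally_generated_sum; move: varx vary varz => x y z [n12 n23 n13 n123].
case=> [[es [et [e1 e2]]]|].
  by apply: n12; rewrite -es -et e1 e2 !expr0; ring.
case=> [[es [et [e1 e2]]]|].
  by apply: n23; rewrite -es -et e1 e2 !expr0; ring.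
case=> [[es [et [e1 e2]]]|].
  by apply: n13; rewrite -es -et e1 e2 !expr0; ring.
case=> -[es [et [eu [e1 [e2 e3]]]]].
  by apply: n123; rewrite -es -et -eu e1 e2 e3 !expr0; ring.
by apply: n123; rewrite -es -et -eu e1 e2 e3 !expr0; ring.
Qed.

Lemma ltn_of_sqrt (a b c u : nat) : (0 < c)%N ->
  (u * c)%:R < Num.sqrt ((a * b * c)%:R : realalg) -> (u * u * c < a * b)%N.
Proof.
move=> c0 lt; rewrite -(ltn_pmul2r c0) -(ltr_nat realalg).
have -> : (u * u * c * c)%:R = (u * c)%:R ^+ 2 :> realalg.
  by rewrite -natrX; congr _%:R; lia.
have /sqr_sqrtr <- : 0 <= (a * b * c)%:R :> realalg by exact: ler0n.
by rewrite ltr_pXn2r // nnegrE ?ler0n ?sqrtr_ge0.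
Qed.

Theorem theorem1p1
  (K : fieldType) (a b c : nat)
  (ha : (0 < a)%N) (hb : (0 < b)%N) (hc : (0 < c)%N)
  (hab : coprime a b) (hac : coprime a c) (hbc : coprime b c)
  (s t u t1 u1 s2 u2 s3 t3 : nat)
  (hs : least_positive (fun k => in_semigroup b c (k * a)%N) s)
  (ht : least_positive (fun k => in_semigroup a c (k * b)%N) t)
  (hu : least_positive (fun k => in_semigroup a b (k * c)%N) u)
  (hsa : (s * a = t1 * b + u1 * c)%N)
  (htb : (t * b = s2 * a + u2 * c)%N)
  (huc : (u * c = s3 * a + t3 * b)%N)
  (hK : [pchar K] =i pred0)
  (hp : minimally_generated_by (monomial_prime K a b c)
          [:: varx ^+ s - vary ^+ t1 * varz ^+ u1;
              vary ^+ t - varx ^+ s2 * varz ^+ u2;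
              varz ^+ u - varx ^+ s3 * vary ^+ t3])
  (hsqrt : (u * c)%:R < Num.sqrt ((a * b * c)%:R : realalg)) :
  noetherian (symbolic_rees_ring (monomial_prime K a b c)) <->
  exists eta : {mpoly K[3]},
    [/\ eta \in symbolic_power (monomial_prime K a b c) u,
        eta \is (a * b)%N.-homog for (weighted_degree a b c)
      & module_length (ideal_quotient (mem
          [:: varx; varz ^+ u - varx ^+ s3 * vary ^+ t3; eta]))
        = omap (muln u) (module_length (ideal_quotient
            [predU1 varx & monomial_prime K a b c]))].
Proof.
have genP := hp.1.
have [t10 u10 s20 [u20 s30 t30]] :=
  exponents_gt0 ha hb hc hab hac hbc hs ht hu hsa htb huc (binomials_irredundant hp).
have [es et eu] :=
  exponents_sum ha hb hc hab hs ht hu hsa htb huc t10 u10 s20 u20 s30 t30.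
have [ea eb _] := weightsE ha hb hc hab hs ht hu hsa htb huc t10 u10 s20 u20 s30 t30.
have [f1 [f2 [f3 [p1 [p2 [p3 [e1 e2 e3 e4]]]]]]] :=
  curve_functionals ha hb hc hab hs ht hu hsa htb huc t10 u10 s20 u20 s30 t30.
have [u0 _ _] := hu.
have E : curve_data a b c s t u t1 u1 s2 u2 s3 t3 f1 f2 f3 p1 p2 p3.
  by constructor=> //; apply: ltn_of_sqrt hsqrt.
split=> [noeR|[eta [eta_symbolic eta_homog len]]].
  have [eta [eta_symbolic eta_homog eta_y]] := noetherian_eta hK E genP noeR.
  by exists eta; split=> //; apply/(length_criterion E genP eta_homog).
apply: (noetherian_symbolic_rees hK E genP eta_symbolic eta_homog).
exact/(length_criterion E genP eta_homog).
Qed.
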